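(* Let $c,s\in\mathbb R_+^d$, $L>0$, and let the error density $g$ satisfy $\mathbb E_g(U^{2c-2})<\infty$. Assume that $\mathcal M_c[g](t)\ne0$ for all $t\in\mathbb R^d$, that $\int_{Q_k}|\mathcal M_c[g](t)|^{-2}dt<\infty$ for all $k\in\mathbb R_+^d$, and that there are constants $c_g,C_g>0$ and $\gamma\in\mathbb R_+^d$ with $$c_g\prod_{j=1}^d(1+t_j^2)^{-\gamma_j/2}\le|\mathcal M_c[g](t)|\le C_g\prod_{j=1}^d(1+t_j^2)^{-\gamma_j/2},\qquad t\in\mathbb R^d .$$ Then there is a constant $C(L,g,s)>0$ such that for all $n\in\mathbb N$, $$\sup_{f\in\mathbb D_c^s(L)}\mathbb E_{f_Y}^n\big(\|f-\widehat f_{k_n}\|_{x^{2c-1}}^2\big)\le C(L,g,s)\,n^{-1/(1+2^{-1}\sum_{j=1}^d(2\gamma_j+1)s_j^{-1})}$$ for the choice $k_n=(k_{1,n},\dots,k_{d,n})$ with $k_{i,n}:=n^{1/(2s_i+s_i\sum_{j=1}^d(2\gamma_j+1)s_j^{-1})}$.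
   Context: Notation. $\mathbb R_+=(0,\infty)$, $d\ge1$, $\mathbb N=\{1,2,\dots\}$; $c$ and $d$ are fixed throughout. For $v\in\mathbb R_+^d$ and $u\in\mathbb C^d$, $v^{u}:=\prod_{j=1}^d v_j^{u_j}$; a scalar such as $1$ or $2$ appearing in an exponent next to $c$ stands for the constant vector (e.g. $x^{2c-1}=\prod_j x_j^{2c_j-1}$). Products and quotients of vectors are componentwise. For a weight $\omega$ on $\mathbb R_+^d$, $\|h\|_\omega^2=\int_{\mathbb R_+^d}|h(x)|^2\omega(x)\,dx$, and $L^2(\mathbb R_+^d,\omega)$, $L^1(\mathbb R_+^d,\omega)$ are the corresponding weighted spaces of complex-valued functions; $\|\cdot\|_{\mathbb R^d}$ is the usual norm of $L^2(\mathbb R^d)$. Model. $X$ and $U$ are independent $\mathbb R_+^d$-valued random vectors with Lebesgue densities $f$ (unknown) and $g$ (known). $Y=XU$ (componentwise) has density $f_Y(y)=\int_{\mathbb R_+^d}f(x)g(y/x)\prod_j x_j^{-1}\,dx$. One observes an i.i.d. sample $Y_1,\dots,Y_n$ from $f_Y$; $\mathbb E_{f_Y}^n$ is expectation with respect to this sample; $\mathbb E_f,\mathbb E_g$ are expectations under $X\sim f$, $U\sim g$. Mellin transform. For $h\in L^1(\mathbb R_+^d,x^{c-1})$, $\mathcal M_c[h](t)=\int_{\mathbb R_+^d}x^{c-1+it}h(x)\,dx$, $t\in\mathbb R^d$. For $h\in L^2(\mathbb R_+^d,x^{2c-1})$, $\mathcal M_c[h]:=(2\pi)^{d/2}\mathcal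 F[\Phi_c[h]]\in L^2(\mathbb R^d)$, where $\Phi_c[h](x)=e^{-\langle c,x\rangle}h(e^{-x_1},\dots,e^{-x_d})$ and $\mathcal F$ is the (unitary) Plancherel–Fourier transform with kernel $(2\pi)^{-d/2}e^{-i\langle t,x\rangle}$; the two definitions agree on $L^1\cap L^2$. Estimator. For $k\in\mathbb R_+^d$, $Q_k:=\{x\in\mathbb R^d:|x_j|\le k_j\text{ for all }j\}$, $\widehat{\mathcal M}_c(t):=n^{-1}\sum_{j=1}^nY_j^{c-1+it}$ and $$\widehat f_k(x):=\frac1{(2\pi)^d}\int_{Q_k}x^{-c-it}\frac{\widehat{\mathcal M}_c(t)}{\mathcal M_c[g](t)}\,dt,\quad x\in\mathbb R_+^d.$$ Regularity classes. $\mathbb W_c^s(\mathbb R_+^d):=\{h\in L^2(\mathbb R_+^d,x^{2c-1}):|h|_{s,c}^2:=\sum_{j=1}^d\|(1+|t_j|)^{s_j}\mathcal M_c[h]\|_{\mathbb R^d}^2<\infty\}$, $\mathbb W_c^s(L):=\{h\in\mathbb W_c^s(\mathbb R_+^d):|h|_{s,c}^2\le L\}$, and $\mathbb D_c^s(L):=\{f\in\mathbb W_c^s(L): f\text{ is a probability density on }\mathbb R_+^d,\ \mathbb E_f(X^{2c-2})\le L\}$. *)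

(* Defs.v *)
From HB Require Import structures.
From mathcomp Require Import all_boot all_order all_algebra.
From mathcomp Require Import all_classical all_reals all_analysis.
From mathcomp.real_closed Require Import complex.

Set Implicit Arguments.
Unset Strict Implicit.
Unset Printing Implicit Defensive.

Import Order.TTheory GRing.Theory Num.Theory.
Import numFieldNormedType.Exports.

Local Open Scope classical_set_scope.
Local Open Scope ring_scope.
Local Open Scope complex_scope.

Section power_measure.
Context {disp : measure_display} {T : measurableType disp} {R : realType}.

Definition tuple_cons (n : nat) (p : T * n.-tuple T) : n.+1.-tuple T :=
  [tuple of p.1 :: p.2].

Lemma measurable_tuple_cons (n : nat) :
  measurable_fun [set: T * n.-tuple T] (@tuple_cons n).
Proof. exact: measurable_cons. Qed.

Section succ.
Variables (mu : {sigma_finite_measure set T -> \bar R}) (n : nat).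
Variable nu : {sigma_finite_measure set (n.-tuple T) -> \bar R}.

Definition tuple_cons_measure : set (n.+1.-tuple T) -> \bar R :=
  pushforward (mu \x nu)%E (@tuple_cons n).

Let m0 : tuple_cons_measure set0 = 0%E.
Proof. by rewrite /tuple_cons_measure /pushforward preimage_set0 measure0. Qed.

Let m_ge0 A : (0 <= tuple_cons_measure A)%E.
Proof. by rewrite /tuple_cons_measure /pushforward measure_ge0. Qed.

Let m_sigma_additive : semi_sigma_additive tuple_cons_measure.
Proof.
move=> F mF tF mUF; rewrite /tuple_cons_measure /pushforward preimage_bigcup.
have mpre A : measurable A -> measurable (@tuple_cons n @^-1` A).
  by move=> mA; rewrite -[X in measurable X]setTI; exact: measurable_tuple_cons.
apply: measure_semi_sigma_additive.
- by move=> i; exact: mpre.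
- apply/trivIsetP => /= i j _ _ ij; rewrite -preimage_setI.
  by move/trivIsetP : tF => /(_ _ _ _ _ ij) ->//; rewrite preimage_set0.
- by rewrite -preimage_bigcup; exact: mpre.
Qed.

HB.instance Definition _ := isMeasure.Build _ _ _ tuple_cons_measure
  m0 m_ge0 m_sigma_additive.

Let m_sigma_finite : sigma_finite setT tuple_cons_measure.
Proof.
have /sigma_finiteP[F [TF ndF Foo]] := sigma_finiteT mu.
have /sigma_finiteP[G [TG ndG Goo]] := sigma_finiteT nu.
pose split (x : n.+1.-tuple T) : T * n.-tuple T :=
  (thead x, [tuple of behead x]).
have msplit : measurable_fun setT split.
  apply/measurable_fun_pairP; split => /=.
    exact: measurable_tnth.
  exact: measurable_behead.
exists (fun i => split @^-1` (F i `*` G i)).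
  rewrite predeqE => x; split => // _.
  have [i _ Fx] : (\bigcup_i F i) (split x).1 by rewrite -TF.
  have [j _ Gx] : (\bigcup_i G i) (split x).2 by rewrite -TG.
  exists (maxn i j) => //=; split.
    by move: Fx; exact/subsetPset/ndF/leq_maxl.
  by move: Gx; exact/subsetPset/ndG/leq_maxr.
move=> i; have [mF Fi] := Foo i; have [mG Gi] := Goo i; split.
  by rewrite -[X in measurable X]setTI; apply: msplit => //; exact: measurableX.
rewrite /tuple_cons_measure /pushforward -comp_preimage.
rewrite (_ : split \o _ = id) ?preimage_id.
  by rewrite product_measure1E// lte_mul_pinfty// ge0_fin_numE.
apply/funext => -[x y]/=; rewrite /split /tuple_cons /=.
by congr (_, _); apply/val_inj.
Qed.

HB.instance Definition _ := Measure_isSigmaFinite.Build _ _ _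
  tuple_cons_measure m_sigma_finite.

End succ.

(* mu^{(x) n}, with (x_1, (x_2, ..., x_n)) identified with
   (x_1, ..., x_n). *)
Fixpoint power_measure (mu : {sigma_finite_measure set T -> \bar R}) (n : nat) :
    {sigma_finite_measure set (n.-tuple T) -> \bar R} :=
  if n is m.+1 then tuple_cons_measure mu (power_measure mu m)
  else \d_([tuple] : 0.-tuple T).

Lemma power_measure_rect (mu : {sigma_finite_measure set T -> \bar R}) (n : nat)
    (A : 'I_n -> set T) : (forall i, measurable (A i)) ->
  power_measure mu n [set x | forall i, A i (tnth x i)] =
  (\big[*%E/1]_(i < n) mu (A i))%E.
Proof.
elim: n A => [|n IHn] A mA /=.
  rewrite big_ord0 (_ : [set x | _] = setT) ?diracT//.
  by apply/seteqP; split => // x _ [].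
rewrite big_ord_recl /= /tuple_cons_measure /pushforward.
pose B := [set y : n.-tuple T | forall i, A (lift ord0 i) (tnth y i)].
have mB : measurable B.
  rewrite (_ : B = \bigcap_(i in [set: 'I_n])
      ((fun y : n.-tuple T => tnth y i) @^-1` A (lift ord0 i))).
    apply: fin_bigcap_measurable => // i _.
    by rewrite -[X in measurable X]setTI; exact: measurable_tnth.
  by apply/seteqP; split => y /= By i; [move=> _|]; exact: By.
rewrite (_ : @tuple_cons n @^-1` _ = A ord0 `*` B).
  rewrite product_measure1E//; congr (_ * _)%E.
  by rewrite -(IHn (fun i => A (lift ord0 i))).
apply/seteqP; split => [[x y] /= H|[x y] /= [Ax By] i].
  split; first exact: H ord0.
  by move=> i; have := H (lift ord0 i); rewrite /tuple_cons tnthS.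
by case: (unliftP ord0 i) => [j ->|->]; rewrite /tuple_cons ?tnthS ?tnth0.
Qed.

End power_measure.

Section mellin.
Context {R : realType} {d : nat}.

Notation vec := (d.-tuple (measurableTypeR R)).

(* Vectors of R^d are tuples; functions on the open orthant are functions on R^d
   whose values outside the orthant are never used. *)
Definition lebesgue : {sigma_finite_measure set vec -> \bar R} :=
  power_measure (@lebesgue_measure R) d.

Definition orthant : set vec := [set x | forall j, 0 < tnth x j].

Definition box (k : vec) : set vec := [set t | forall j, `|tnth t j| <= tnth k j].

Definition dot (t x : vec) : R := \sum_(j < d) tnth t j * tnth x j.

Definition divv (y x : vec) : vec := [tuple tnth y j / tnth x j | j < d].

(* the complex exponential *)
Definition cexp (z : R[i]) : R[i] :=
  (expR (complex.Re z))%:C * (cos (complex.Im z) +i* sin (complex.Im z)).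

(* v^u for v in the orthant, with real and with complex exponents *)
Definition vpow (v : vec) (u : 'I_d -> R) : R := \prod_(j < d) tnth v j `^ u j.

Definition cvpow (v : vec) (u : 'I_d -> R[i]) : R[i] :=
  \prod_(j < d) cexp (u j * (ln (tnth v j))%:C).

Definition cmeasurable (D : set vec) (h : vec -> R[i]) : Prop :=
  measurable_fun D (fun x => complex.Re (h x)) /\
  measurable_fun D (fun x => complex.Im (h x)).

Definition cintegral (D : set vec) (h : vec -> R[i]) : R[i] :=
  (\int[lebesgue]_(x in D) complex.Re (h x)) +i*
  (\int[lebesgue]_(x in D) complex.Im (h x)).

Definition normsq (D : set vec) (w : vec -> R) (h : vec -> R[i]) : \bar R :=
  (\int[lebesgue]_(x in D) (Normc.normc (h x) ^+ 2 * w x)%:E)%E.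

Definition in_L2 (D : set vec) (w : vec -> R) (h : vec -> R[i]) : Prop :=
  cmeasurable D h /\ (normsq D w h < +oo)%E.

Definition in_L1 (D : set vec) (w : vec -> R) (h : vec -> R[i]) : Prop :=
  cmeasurable D h /\
  (\int[lebesgue]_(x in D) (Normc.normc (h x) * w x)%:E < +oo)%E.

Definition weight1 : vec -> R := fun=> 1.

Definition fourier (h : vec -> R[i]) (t : vec) : R[i] :=
  ((2 * pi) `^ (- (d%:R / 2)))%:C *
  cintegral setT (fun x => cexp (0 +i* (- dot t x)) * h x).

(* G is (a version of) the image of h under the continuous extension to L^2 of
   the Fourier transform on L^1 /\ L^2. *)
Definition is_plancherel (h G : vec -> R[i]) : Prop :=
  in_L2 setT weight1 G /\
  forall u : nat -> vec -> R[i],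
    (forall m, in_L1 setT weight1 (u m) /\ in_L2 setT weight1 (u m)) ->
    normsq setT weight1 (u m \- h) @[m --> \oo] --> 0%E ->
    normsq setT weight1 (fourier (u m) \- G) @[m --> \oo] --> 0%E.

(* For h in L^2(R^d) such a G exists and is unique up to a null set, so the
   default value 0 is irrelevant. *)
Definition plancherel (h : vec -> R[i]) : vec -> R[i] :=
  xget (fun=> 0) [set G | is_plancherel h G].

Definition mellin (c : vec) (h : vec -> R[i]) (t : vec) : R[i] :=
  cintegral orthant
    (fun x => cvpow x (fun j => (tnth c j - 1) +i* tnth t j) * h x).

Definition Phi (c : vec) (h : vec -> R[i]) (x : vec) : R[i] :=
  (expR (- dot c x))%:C * h [tuple expR (- tnth x j) | j < d].

Definition mellinL2 (c : vec) (h : vec -> R[i]) (t : vec) : R[i] :=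
  ((2 * pi) `^ (d%:R / 2))%:C * plancherel (Phi c h) t.

(* the weight x^(2c-1) *)
Definition weight (c x : vec) : R := vpow x (fun j => 2 * tnth c j - 1).

Definition sobolev_normsq (s c : vec) (h : vec -> R[i]) : \bar R :=
  (\sum_(j < d) normsq setT weight1
     (fun t => ((1 + `|tnth t j|) `^ tnth s j)%:C * mellinL2 c h t)%R)%E.

Definition sobolev (s c : vec) : set (vec -> R[i]) :=
  [set h | in_L2 orthant (weight c) h /\ (sobolev_normsq s c h < +oo)%E].

Definition sobolev_ball (s c : vec) (L : R) : set (vec -> R[i]) :=
  [set h | sobolev s c h /\ (sobolev_normsq s c h <= L%:E)%E].

Definition is_density (f : vec -> R) : Prop :=
  [/\ measurable_fun orthant f,
      (forall x, orthant x -> 0 <= f x) &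
      (\int[lebesgue]_(x in orthant) (f x)%:E = 1)%E].

(* E_f (X^(2c-2)) *)
Definition moment (c : vec) (f : vec -> R) : \bar R :=
  (\int[lebesgue]_(x in orthant)
     (vpow x (fun j => 2 * tnth c j - 2) * f x)%:E)%E.

Definition density_class (s c : vec) (L : R) : set (vec -> R) :=
  [set f | [/\ sobolev_ball s c L (fun x => (f x)%:C), is_density f &
               (moment c f <= L%:E)%E]].

(* f_Y (y).  The Lebesgue integral may be +oo on a null set of y, where the real
   value is then 0. *)
Definition mult_conv (f g : vec -> R) (y : vec) : R :=
  \int[lebesgue]_(x in orthant)
     (f x * g (divv y x) * \prod_(j < d) (tnth x j)^-1).

(* Expectation of phi (Y_1, ..., Y_n) for Y_1, ..., Y_n i.i.d. with density fY
   on the orthant: the joint density is the product of the fY (y_i). *)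
Definition iid_expectation (fY : vec -> R) (n : nat)
    (phi : n.-tuple vec -> \bar R) : \bar R :=
  (\int[power_measure lebesgue n]_(y in [set y | forall i, orthant (tnth y i)])
     (phi y * (\prod_(i < n) fY (tnth y i))%R%:E))%E.

Definition mellin_hat (c : vec) (n : nat) (y : n.-tuple vec) (t : vec) : R[i] :=
  (n%:R^-1)%:C *
  \sum_(i < n) cvpow (tnth y i) (fun j => (tnth c j - 1) +i* tnth t j).

Definition estimator (c : vec) (g : vec -> R) (k : vec) (n : nat)
    (y : n.-tuple vec) (x : vec) : R[i] :=
  (((2 * pi) ^+ d)^-1)%:C *
  cintegral (box k) (fun t =>
    cvpow x (fun j => (- tnth c j) +i* (- tnth t j)) *
    (mellin_hat c y t / mellin c (fun u => (g u)%:C) t)).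

Definition risk (c : vec) (g : vec -> R) (k : vec) (n : nat) (f : vec -> R) :
    \bar R :=
  iid_expectation (mult_conv f g) (fun y : n.-tuple vec =>
    normsq orthant (weight c) (fun x => (f x)%:C - estimator c g k y x)).

Definition smoothness_sum (gamma s : vec) : R :=
  \sum_(j < d) (2 * tnth gamma j + 1) * (tnth s j)^-1.

Definition bandwidth (gamma s : vec) (n : nat) : vec :=
  [tuple n%:R `^ (2 * tnth s i + tnth s i * smoothness_sum gamma s)^-1 | i < d].

End mellin.

(* Main.v *)
(* In the logarithmic coordinates x = exp(-u) the Mellin transform is the Fourier
   transform of Phi_c[f] and the weighted norm becomes the L^2(R^d) norm, so
   Plancherel gives
     ||f - f_k||^2 = (2 pi)^-d \int |M[f] - 1_{Q_k} Mhat / M[g]|^2 dt.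
   For fixed t, Mhat(t) is a mean of n i.i.d. variables with expectation
   M[f](t) M[g](t) and second moment E X^(2c-2) E U^(2c-2), whence the risk is at
   most (2 pi)^-d times
     \int_{Q_k^c} |M[f]|^2 + n^-1 E X^(2c-2) E U^(2c-2) \int_{Q_k} |M[g]|^-2.
   Off Q_k some |t_j| exceeds k_j, and k_j^(-2 s_j) is the rate n^-r for every j; on
   Q_k the lower bound on M[g] and k_j >= 1 bound the last integral by a multiple of
   \prod_j k_j^(2 gamma_j + 1) = n^(1-r).

   Plancherel's identity for integrable h in dimension one: |F h|^2 integrated
   against exp(-e|t|) is a double integral of h against the Poisson kernel, which
   gives \int |F h|^2 <= 2 pi \int |h|^2; conversely the inverse transform of
   exp(-e|t|) F h is a Poisson mean of h, and averaging it over [x - r, x + r],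
   letting e and then r tend to 0, recovers h(x) at Lebesgue points.  The identity
   in dimension d follows by induction with Tonelli's theorem. *)

Require Import Defs.
From HB Require Import structures.
From mathcomp Require Import all_boot all_order all_algebra.
From mathcomp Require Import all_classical all_reals all_analysis.
From mathcomp.real_closed Require Import complex.
From mathcomp Require Import measurable_realfun.
From mathcomp Require Import ring lra.

Import Order.TTheory GRing.Theory Num.Theory.
Import numFieldNormedType.Exports.

Local Open Scope classical_set_scope.
Local Open Scope ring_scope.
Local Open Scope complex_scope.

Set Implicit Arguments.
Unset Strict Implicit.
Unset Printing Implicit Defensive.

(** * Complex-valued integrals *)

(** No step needs the transform of a general square integrable function or pointwise inversion. The
    bound on [E X^(2c-2)] makes [Phi c f] integrable, so [mellin] is a genuine integral and
    [mellinL2], a chosen limit, equals it almost everywhere. Inversion is used only in norm: if [F]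
    is the Fourier integral and [A] its adjoint, [|phi - (2 pi)^-d A psi|^2] and
    [(2 pi)^-d |F phi - psi|^2] have equal integrals as soon as [F] and [A] both multiply norms by
    [(2 pi)^(d/2)]. Hence Plancherel's identity is proved for integrable functions only, but in the
    extended reals: the induction on [d] passes to slices, which are integrable almost always and
    need not be square integrable.

    Real-valued integrals are 0 where the extended integral is infinite, and densities are arbitrary
    outside the orthant. So densities are cut off to the orthant, nonnegative identities in the
    extended reals come first, and signed or complex ones follow by positive and negative parts.

    On the box [|M[g]|] is bounded below by its lower envelope at the corner [k]; this affects the
    variance bound only by a constant factor, because the integral of a power over the box is of the
    order of volume times corner value. *)

Notation cRe := (complex.Re).
Notation cIm := (complex.Im).
Notation normc := (Normc.normc).

Section complex_algebra.
Context {R : realType}.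
Implicit Types (z w : R[i]) (a b : R).

Lemma cReM z w : cRe (z * w) = cRe z * cRe w - cIm z * cIm w.
Proof. by case: z w => [a b] [c d]. Qed.

Lemma cImM z w : cIm (z * w) = cRe z * cIm w + cIm z * cRe w.
Proof. by case: z w => [a b] [c d]. Qed.

Lemma cReD z w : cRe (z + w) = cRe z + cRe w.
Proof. by case: z w => [a b] [c d]. Qed.

Lemma cImD z w : cIm (z + w) = cIm z + cIm w.
Proof. by case: z w => [a b] [c d]. Qed.

Lemma cReN z : cRe (- z) = - cRe z.
Proof. by case: z. Qed.

Lemma cImN z : cIm (- z) = - cIm z.
Proof. by case: z. Qed.

Lemma cReJ z : cRe (conjc z) = cRe z.
Proof. by case: z. Qed.

Lemma cImJ z : cIm (conjc z) = - cIm z.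
Proof. by case: z. Qed.

Lemma complex_ext z w : cRe z = cRe w -> cIm z = cIm w -> z = w.
Proof. by case: z w => [a b] [c d] /= -> ->. Qed.

Lemma normc2 z : normc z ^+ 2 = cRe z ^+ 2 + cIm z ^+ 2.
Proof. by case: z => a b /=; rewrite sqr_sqrtr// addr_ge0// sqr_ge0. Qed.

Lemma normc_ge0 z : 0 <= normc z.
Proof. by case: z => a b /=; rewrite sqrtr_ge0. Qed.

Lemma normc_conj z : normc (conjc z) = normc z.
Proof. by case: z => a b /=; rewrite sqrrN. Qed.

Lemma normcC a : normc a%:C = `|a|.
Proof. by rewrite /= expr0n/= addr0 sqrtr_sqr. Qed.

Lemma Re_le z : `|cRe z| <= normc z.
Proof.
rewrite -(ler_pXn2r (_ : 0 < 2)%N)// ?nnegrE ?normc_ge0//.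
by rewrite normc2 real_normK ?num_real// lerDl sqr_ge0.
Qed.

Lemma Im_le z : `|cIm z| <= normc z.
Proof.
rewrite -(ler_pXn2r (_ : 0 < 2)%N)// ?nnegrE ?normc_ge0//.
by rewrite normc2 real_normK ?num_real// lerDr sqr_ge0.
Qed.

Lemma normc_le z : normc z <= `|cRe z| + `|cIm z|.
Proof.
rewrite -(ler_pXn2r (_ : 0 < 2)%N)// ?nnegrE ?normc_ge0 ?addr_ge0//.
rewrite normc2 sqrrD !real_normK ?num_real//.
by rewrite -addrA lerD2l addrC lerDl pmulrn_lge0// mulr_ge0.
Qed.

Lemma normcD_le z w : normc (z + w) <= normc z + normc w.
Proof. exact: (@le_normcD R z w). Qed.

Lemma CofRM a b : (a * b)%:C = a%:C * b%:C :> R[i].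
Proof. by rewrite rmorphM. Qed.

Lemma conjcM z w : conjc (z * w) = conjc z * conjc w.
Proof. by apply: complex_ext; rewrite ?(cReM, cImM, cReJ, cImJ); ring. Qed.

Lemma mulcJ z : z * (conjc z) = (normc z ^+ 2)%:C.
Proof.
apply: complex_ext; rewrite ?cReM ?cImM cReJ cImJ ?normc2/=; ring.
Qed.

End complex_algebra.

Section complex_integral.
Context {d} {T : measurableType d} {R : realType}.
Variable mu : {measure set T -> \bar R}.
Implicit Types (h k : T -> R[i]) (f g : T -> R).

(** Counterparts of [cmeasurable], [cintegral] and [in_L1] over an arbitrary measure, since samples,
    frequencies and pairs of them are all integrated over. On the whole space [cintegral] is
    convertible to [cint lebesgue]. *)
Definition cmfun h := measurable_fun setT (fun x => cRe (h x)) /\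
  measurable_fun setT (fun x => cIm (h x)).

Definition cint h : R[i] :=
  (\int[mu]_x cRe (h x)) +i* (\int[mu]_x cIm (h x)).

Definition cintegrable h := cmfun h /\ (\int[mu]_x (normc (h x))%:E < +oo)%E.

Lemma cmfun_cst z : cmfun (fun=> z).
Proof. by split; exact: measurable_cst. Qed.

Lemma cmfunM h k : cmfun h -> cmfun k -> cmfun (fun x => h x * k x).
Proof.
move=> [h1 h2] [k1 k2]; split.
  by under eq_fun do rewrite cReM; apply: measurable_funB; apply: measurable_funM.
by under eq_fun do rewrite cImM; apply: measurable_funD; apply: measurable_funM.
Qed.

Lemma cmfunD h k : cmfun h -> cmfun k -> cmfun (fun x => h x + k x).
Proof.
move=> [h1 h2] [k1 k2]; split.
  by under eq_fun do rewrite cReD; apply: measurable_funD.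
by under eq_fun do rewrite cImD; apply: measurable_funD.
Qed.

Lemma cmfunN h : cmfun h -> cmfun (fun x => - h x).
Proof.
move=> [h1 h2]; split.
  by under eq_fun do rewrite cReN; exact: measurable_funN.
by under eq_fun do rewrite cImN; exact: measurable_funN.
Qed.

Lemma cmfunB h k : cmfun h -> cmfun k -> cmfun (fun x => h x - k x).
Proof. by move=> hh kk; apply: cmfunD => //; exact: cmfunN. Qed.

Lemma cmfunJ h : cmfun h -> cmfun (fun x => (conjc (h x))).
Proof.
move=> [h1 h2]; split.
  by under eq_fun do rewrite cReJ.
by under eq_fun do rewrite cImJ; exact: measurable_funN.
Qed.

Lemma cmfunC f : measurable_fun setT f -> cmfun (fun x => (f x)%:C).
Proof. by move=> mf; split => //=; exact: measurable_cst. Qed.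

Lemma cmfun_normc2 h : cmfun h -> measurable_fun setT (fun x => normc (h x) ^+ 2).
Proof.
move=> [h1 h2]; under eq_fun do rewrite normc2.
by apply: measurable_funD; apply: measurable_funX.
Qed.

Lemma sqrt_normc2 (z : R[i]) : normc z = (normc z ^+ 2) `^ 2^-1.
Proof. by rewrite powR12_sqrt ?sqr_ge0// sqrtr_sqr ger0_norm// normc_ge0. Qed.

Lemma cmfun_normc h : cmfun h -> measurable_fun setT (fun x => normc (h x)).
Proof.
move=> mh; under eq_fun do rewrite sqrt_normc2.
apply: (measurableT_comp (@measurable_powR R 2^-1)).
exact: cmfun_normc2.
Qed.

Lemma cmfun_sum (I : Type) (s : seq I) (F : I -> T -> R[i]) :
  (forall i, cmfun (F i)) -> cmfun (fun x => \sum_(i <- s) F i x).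
Proof.
move=> mF; elim: s => [|i s IH].
  by under eq_fun do rewrite big_nil; exact: cmfun_cst.
by under eq_fun do rewrite big_cons; exact: cmfunD.
Qed.

Lemma cmfun_prod (I : Type) (s : seq I) (F : I -> T -> R[i]) :
  (forall i, cmfun (F i)) -> cmfun (fun x => \prod_(i <- s) F i x).
Proof.
move=> mF; elim: s => [|i s IH].
  by under eq_fun do rewrite big_nil; exact: cmfun_cst.
by under eq_fun do rewrite big_cons; exact: cmfunM.
Qed.

Lemma cintegrable_Re h : cintegrable h -> mu.-integrable setT (fun x => (cRe (h x))%:E).
Proof.
move=> [mh hoo]; apply/integrableP; split; first by apply/measurable_EFinP; case: mh.
apply: le_lt_trans hoo; apply: ge0_le_integral => //.
- by apply/measurable_EFinP; apply: measurableT_comp => //; case: mh.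
- by apply/measurable_EFinP; exact: cmfun_normc.
- by move=> x _; rewrite abse_EFin lee_fin Re_le.
Qed.

Lemma cintegrable_Im h : cintegrable h -> mu.-integrable setT (fun x => (cIm (h x))%:E).
Proof.
move=> [mh hoo]; apply/integrableP; split; first by apply/measurable_EFinP; case: mh.
apply: le_lt_trans hoo; apply: ge0_le_integral => //.
- by apply/measurable_EFinP; apply: measurableT_comp => //; case: mh.
- by apply/measurable_EFinP; exact: cmfun_normc.
- by move=> x _; rewrite abse_EFin lee_fin Im_le.
Qed.

Lemma cintegrableRI h : mu.-integrable setT (fun x => (cRe (h x))%:E) ->
  mu.-integrable setT (fun x => (cIm (h x))%:E) -> cintegrable h.
Proof.
move=> /integrableP[/measurable_EFinP m1 i1] /integrableP[/measurable_EFinP m2 i2].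
split => //.
apply: (@le_lt_trans _ _ (\int[mu]_x (`|(cRe (h x))%:E| + `|(cIm (h x))%:E|))%E).
  apply: ge0_le_integral => //.
  - by move=> x _; rewrite lee_fin normc_ge0.
  - by apply/measurable_EFinP; exact: cmfun_normc.
  - apply: emeasurable_funD; apply/measurable_EFinP; exact: measurableT_comp.
  - by move=> x _; rewrite !abse_EFin -EFinD lee_fin normc_le.
rewrite ge0_integralD//=.
- by rewrite lte_add_pinfty.
- by apply/measurable_EFinP; exact: measurableT_comp.
- by apply/measurable_EFinP; exact: measurableT_comp.
Qed.

Lemma le_cintegrable h g : cmfun h -> mu.-integrable setT (EFin \o g) ->
  (forall x, normc (h x) <= g x) -> cintegrable h.
Proof.
move=> mh /integrableP[/measurable_EFinP mg goo] hg; split => //.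
apply: le_lt_trans goo; apply: ge0_le_integral => //.
- by move=> x _; rewrite lee_fin normc_ge0.
- by apply/measurable_EFinP; exact: cmfun_normc.
- by apply/measurable_EFinP; exact: measurableT_comp.
- by move=> x _; rewrite lee_fin (le_trans (hg x))// ler_norm.
Qed.

Lemma cintegrable_normc h : cintegrable h ->
  mu.-integrable setT (fun x => (normc (h x))%:E).
Proof.
move=> [mh hoo]; apply/integrableP; split.
  by apply/measurable_EFinP; exact: cmfun_normc.
by under eq_integral do rewrite gee0_abs ?lee_fin ?normc_ge0//.
Qed.

Lemma cintegrableM_bnd h k (M : R) : cmfun k -> (forall x, normc (k x) <= M) ->
  cintegrable h -> cintegrable (fun x => k x * h x).
Proof.
move=> mk kM hi; apply: (@le_cintegrable _ (fun x => M * normc (h x))).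
- by apply: cmfunM => //; case: hi.
- apply: (eq_integrable measurableT (fun x => (M%:E * (normc (h x))%:E)%E)) => //.
  by apply: integrableZl => //; exact: cintegrable_normc.
- by move=> x; rewrite Normc.normcM ler_wpM2r// normc_ge0.
Qed.

Lemma cintegrableZ h z : cintegrable h -> cintegrable (fun x => z * h x).
Proof.
by move=> hi; apply: (@cintegrableM_bnd _ _ (normc z)) => //; exact: cmfun_cst.
Qed.

Lemma cintegrableJ h : cintegrable h -> cintegrable (fun x => (conjc (h x))).
Proof.
move=> [mh hoo]; split; first exact: cmfunJ.
by under eq_integral do rewrite normc_conj.
Qed.

Lemma cintegrableD h k : cintegrable h -> cintegrable k ->
  cintegrable (fun x => h x + k x).
Proof.
move=> hi ki; apply: (@le_cintegrable _ (fun x => normc (h x) + normc (k x))).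
- by apply: cmfunD; [case: hi|case: ki].
- apply: (eq_integrable measurableT
    (fun x => ((normc (h x))%:E + (normc (k x))%:E)%E)) => //.
  by apply: integrableD => //; exact: cintegrable_normc.
- by move=> x; exact: normcD_le.
Qed.

Lemma cintD h k : cintegrable h -> cintegrable k ->
  cint (fun x => h x + k x) = cint h + cint k.
Proof.
move=> hi ki; apply: complex_ext; rewrite ?cReD ?cImD /=.
  under eq_Rintegral do rewrite cReD.
  by rewrite RintegralD//; exact: cintegrable_Re.
under eq_Rintegral do rewrite cImD.
by rewrite RintegralD//; exact: cintegrable_Im.
Qed.

Lemma RintZl (f : T -> R) r : mu.-integrable setT (EFin \o f) ->
  mu.-integrable setT (fun x => (r * f x)%:E).
Proof.
move=> fi; apply: (eq_integrable measurableT (fun x => (r%:E * (f x)%:E)%E)) => //.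
exact: integrableZl.
Qed.

Lemma cintZ h z : cintegrable h -> cint (fun x => z * h x) = z * cint h.
Proof.
move=> hi; apply: complex_ext; rewrite ?cReM ?cImM /=.
  under eq_Rintegral do rewrite cReM.
  rewrite RintegralB//; try (by apply: RintZl; [exact: cintegrable_Re || exact: cintegrable_Im]).
  by rewrite !RintegralZl//; [exact: cintegrable_Im|exact: cintegrable_Re].
under eq_Rintegral do rewrite cImM.
rewrite RintegralD//; try (by apply: RintZl; [exact: cintegrable_Re || exact: cintegrable_Im]).
by rewrite !RintegralZl//; [exact: cintegrable_Re|exact: cintegrable_Im].
Qed.

Lemma cintJ h : cintegrable h -> cint (fun x => (conjc (h x))) = (conjc (cint h)).
Proof.
move=> hi; apply: complex_ext; rewrite ?cReJ ?cImJ /=.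
  by under eq_Rintegral do rewrite cReJ.
under eq_Rintegral do rewrite cImJ -mulN1r.
by rewrite RintegralZl ?mulN1r//; exact: cintegrable_Im.
Qed.

(** Real and imaginary parts are bounded separately, hence the factor 2. It is harmless because only
    the boundedness of transforms is drawn from this. *)
Lemma normc_cint_le h (M : R) : cmfun h -> (\int[mu]_x (normc (h x))%:E <= M%:E)%E ->
  normc (cint h) <= M *+ 2.
Proof.
move=> mh hM; have hi : cintegrable h.
  by split => //; exact: le_lt_trans hM (ltry _).
apply: le_trans (normc_le _) _; rewrite mulr2n; apply: lerD => /=.
  rewrite -lee_fin EFin_normr_Rintegral//; last exact: cintegrable_Re.
  apply: le_trans hM; apply: le_trans (le_abse_integral _ _ _) _ => //.
    by apply/measurable_EFinP; case: mh.
  apply: ge0_le_integral => //.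
  - by apply/measurable_EFinP; apply: measurableT_comp => //; case: mh.
  - by apply/measurable_EFinP; exact: cmfun_normc.
  - by move=> x _; rewrite lee_fin Re_le.
rewrite -lee_fin EFin_normr_Rintegral//; last exact: cintegrable_Im.
apply: le_trans hM; apply: le_trans (le_abse_integral _ _ _) _ => //.
  by apply/measurable_EFinP; case: mh.
apply: ge0_le_integral => //.
- by apply/measurable_EFinP; apply: measurableT_comp => //; case: mh.
- by apply/measurable_EFinP; exact: cmfun_normc.
- by move=> x _; rewrite lee_fin Im_le.
Qed.

End complex_integral.

(** * Fubini's theorem for real and complex integrals *)

Section fubini.
Context {d1 d2} {T1 : measurableType d1} {T2 : measurableType d2} {R : realType}.
Variables (m1 : {sigma_finite_measure set T1 -> \bar R})
          (m2 : {sigma_finite_measure set T2 -> \bar R}).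

Lemma measurable_Rint1 (f : T1 * T2 -> R) : measurable_fun setT f ->
  measurable_fun setT (fun x => \int[m2]_y f (x, y)).
Proof.
move=> mf; rewrite /Rintegral.
apply: (measurableT_comp (f := fine)) => //.
have mF : measurable_fun setT (EFin \o f) by exact/measurable_EFinP.
rewrite (_ : (fun x => _) = (fun x => (\int[m2]_y (EFin \o f)^\+ (x, y))%E) \-
    (fun x => (\int[m2]_y (EFin \o f)^\- (x, y))%E))%E; last first.
  apply/funext=> x; rewrite [LHS]integralE /=; congr (_ - _)%E.
    by apply: eq_integral => y _; rewrite !funeposE.
  by apply: eq_integral => y _; rewrite !funenegE.
apply: emeasurable_funB.
- have := measurable_fun_fubini_tonelli_F (m2 := m2) ((EFin \o f)^\+)%E; apply => //; exact: measurable_funepos.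
- have := measurable_fun_fubini_tonelli_F (m2 := m2) ((EFin \o f)^\-)%E; apply => //; exact: measurable_funeneg.
Qed.

Lemma Rint_fubini (f : T1 * T2 -> R) :
  (m1 \x m2)%E.-integrable setT (EFin \o f) ->
  m1.-integrable setT (fun x => (\int[m2]_y f (x, y))%:E) /\
  \int[m1]_x \int[m2]_y f (x, y) = fine (\int[(m1 \x m2)%E]_p (f p)%:E)%E.
Proof.
move=> fi; have mf : measurable_fun setT f.
  by apply/measurable_EFinP; exact: (measurable_int _ fi).
have Fi := integrable_fubini_F fi; split.
  apply: le_integrable Fi => //.
    by apply/measurable_EFinP; exact: measurable_Rint1.
  move=> x _; rewrite /Rintegral /fubini_F /=.
  by case: (\int[m2]_y _)%E => [r| |]; rewrite /= ?normr0 ?leey ?lexx.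
rewrite /Rintegral; congr fine.
rewrite -(integral12_prod_meas1 fi); apply: ae_eq_integral => //.
- by apply/measurable_EFinP; exact: (measurable_Rint1 mf).
- exact: (measurable_int _ Fi).
have := integrable_ae measurableT Fi; apply: filterS => x /(_ I).
by rewrite /fubini_F => Ff _; rewrite fineK.
Qed.

End fubini.

Section swap_fubini.
Context {d1 d2} {T1 : measurableType d1} {T2 : measurableType d2} {R : realType}.
Variables (m1 : {sigma_finite_measure set T1 -> \bar R})
          (m2 : {sigma_finite_measure set T2 -> \bar R}).

Lemma measurable_swap_fun d (T : measurableType d) (f : T1 * T2 -> T) :
  measurable_fun setT f -> measurable_fun setT (fun p : T2 * T1 => f (p.2, p.1)).
Proof. by move=> mf; apply: measurableT_comp => //; exact: measurable_swap. Qed.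

Lemma Rint_fubini_swap (f : T1 * T2 -> R) : measurable_fun setT f ->
  (\int[m1]_x \int[m2]_y `|f (x, y)|%:E < +oo)%E ->
  \int[m1]_x \int[m2]_y f (x, y) = \int[m2]_y \int[m1]_x f (x, y).
Proof.
move=> mf foo.
have mF : measurable_fun setT (EFin \o f) by exact/measurable_EFinP.
have fi : (m1 \x m2)%E.-integrable setT (EFin \o f) by apply/integrable12ltyP.
have fi' : (m2 \x m1)%E.-integrable setT (EFin \o (fun p : T2 * T1 => f (p.2, p.1))).
  apply/integrable12ltyP.
    by apply/measurable_EFinP; exact: (measurable_swap_fun mf).
  rewrite /= -(fubini_tonelli (fun p => `|f p|%:E))//.
  by apply/measurable_EFinP; apply: measurableT_comp.
have [_ ->] := Rint_fubini fi.
have [_ ->] := Rint_fubini fi'.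
congr fine.
rewrite -(integral12_prod_meas1 fi') -(integral21_prod_meas1 fi).
by [].
Qed.

Lemma cmfun_swap (h : T1 * T2 -> R[i]) : cmfun h -> cmfun (fun p : T2 * T1 => h (p.2, p.1)).
Proof.
by move=> [h1 h2]; split; [exact: (measurable_swap_fun h1)|exact: (measurable_swap_fun h2)].
Qed.

Lemma cmfun_comp d (T : measurableType d) d' (T' : measurableType d') (h : T' -> R[i])
  (f : T -> T') : cmfun h -> measurable_fun setT f -> cmfun (fun x => h (f x)).
Proof.
by move=> [h1 h2] mf; split; [exact: (measurableT_comp h1)|exact: (measurableT_comp h2)].
Qed.

Lemma cmfun_section1 (h : T1 * T2 -> R[i]) x : cmfun h -> cmfun (fun y => h (x, y)).
Proof. by move=> mh; apply: (cmfun_comp mh). Qed.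

Lemma cmfun_cint (h : T1 * T2 -> R[i]) : cmfun h ->
  cmfun (fun x => cint m2 (fun y => h (x, y))).
Proof.
by move=> [h1 h2]; split => /=; [exact: (measurable_Rint1 _ h1)|exact: (measurable_Rint1 _ h2)].
Qed.

Lemma cintegrable_prod (h : T1 * T2 -> R[i]) : cmfun h ->
  (\int[m1]_x \int[m2]_y (normc (h (x, y)))%:E < +oo)%E ->
  cintegrable (m1 \x m2)%E h.
Proof.
move=> mh hoo; split => //; rewrite fubini_tonelli1//.
  by apply/measurable_EFinP; exact: cmfun_normc.
by move=> p; rewrite lee_fin normc_ge0.
Qed.

Lemma cintegrable_cint (h : T1 * T2 -> R[i]) : cmfun h ->
  (\int[m1]_x \int[m2]_y (normc (h (x, y)))%:E < +oo)%E ->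
  cintegrable m1 (fun x => cint m2 (fun y => h (x, y))).
Proof.
move=> mh /(cintegrable_prod mh) hi.
apply: cintegrableRI => /=.
  by have [] := Rint_fubini (cintegrable_Re hi).
by have [] := Rint_fubini (cintegrable_Im hi).
Qed.

Lemma cint_prod (h : T1 * T2 -> R[i]) : cmfun h ->
  (\int[m1]_x \int[m2]_y (normc (h (x, y)))%:E < +oo)%E ->
  cint (m1 \x m2)%E h = cint m1 (fun x => cint m2 (fun y => h (x, y))).
Proof.
move=> mh /(cintegrable_prod mh) hi.
apply: complex_ext => /=.
  by have [_ ->] := Rint_fubini (cintegrable_Re hi).
by have [_ ->] := Rint_fubini (cintegrable_Im hi).
Qed.

Lemma cint_fubini (h : T1 * T2 -> R[i]) : cmfun h ->
  (\int[m1]_x \int[m2]_y (normc (h (x, y)))%:E < +oo)%E ->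
  cint m1 (fun x => cint m2 (fun y => h (x, y))) =
  cint m2 (fun y => cint m1 (fun x => h (x, y))).
Proof.
move=> mh hoo; have hi := cintegrable_prod mh hoo.
apply: complex_ext => /=; case: (mh) => h1 h2.
  apply: (Rint_fubini_swap h1); have := cintegrable_Re hi.
  by move=> /integrable12ltyP; apply; apply/measurable_EFinP.
apply: (Rint_fubini_swap h2); have := cintegrable_Im hi.
by move=> /integrable12ltyP; apply; apply/measurable_EFinP.
Qed.

Lemma ae_cintegrable2 (h : T1 * T2 -> R[i]) : cmfun h ->
  (\int[m1]_x \int[m2]_y (normc (h (x, y)))%:E < +oo)%E ->
  {ae m2, forall y, cintegrable m1 (fun x => h (x, y))}.
Proof.
move=> mh hoo; have hi := cintegrable_prod mh hoo.
have := ae_integrable2 (cintegrable_Re hi).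
have := ae_integrable2 (cintegrable_Im hi).
by apply: filterS2 => y h1 h2; exact: cintegrableRI.
Qed.

End swap_fubini.

Section misc.
Context {d} {T : measurableType d} {R : realType}.
Variable mu : {measure set T -> \bar R}.
Local Open Scope ereal_scope.

(** The form in which limits of squared norms are taken in both halves of Plancherel's identity: a
    uniform bound on the integrals replaces a dominating function, and convergence may fail on a
    null set. *)
Lemma fatou_le (u : nat -> T -> \bar R) (v : T -> \bar R) (M : \bar R) :
  (forall n, measurable_fun setT (u n)) -> (forall n x, 0 <= u n x) ->
  measurable_fun setT v -> (forall x, 0 <= v x) ->
  {ae mu, forall x, u n x @[n --> \oo] --> v x} ->
  (forall n, \int[mu]_x u n x <= M) -> \int[mu]_x v x <= M.
Proof.
move=> mu_ u0 mv v0 uv uM.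
apply: (@le_trans _ _ (\int[mu]_x limn_einf (u ^~ x))).
  apply: ae_ge0_le_integral => //.
  - move=> x _; rewrite limn_einf_lim; apply: lime_ge; first exact: is_cvg_einfs.
    by apply: nearW => n; apply: le_ereal_inf_tmp => _ [m _ <-].
  (* A lower limit is minus the upper limit of the negated sequence, whose measurability is
     available. *)
  - rewrite (_ : (fun x => _) = fun x => - limn_esup (fun n => - u n x)).
      apply: measurableT_comp => //.
      by apply: measurable_fun_limn_esup => n; exact: measurableT_comp.
    by apply/funext => x.
  - move: uv; apply: filterS => x uv _.
    by have [-> _] := cvg_limn_einf_sup uv.
apply: (le_trans (fatou _ _ _ _)) => //.
rewrite limn_einf_lim; apply: lime_le; first exact: is_cvg_einfs.
by apply: nearW => n; apply: ereal_inf_le; exists (\int[mu]_x u n x) => //; exists n => /=.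
Qed.

End misc.

(** * Product measures and substitutions *)

Section power.
Context {d} {T : measurableType d} {R : realType}.
Variable mu : {sigma_finite_measure set T -> \bar R}.

Lemma tnth_cons0 n (p : T * n.-tuple T) : tnth (tuple_cons p) ord0 = p.1.
Proof. by rewrite /tuple_cons tnth0. Qed.

Lemma tnth_consS n (p : T * n.-tuple T) j : tnth (tuple_cons p) (lift ord0 j) = tnth p.2 j.
Proof. by rewrite /tuple_cons tnthS. Qed.

Lemma ge0_integral_cons n (H : n.+1.-tuple T -> \bar R) :
  measurable_fun setT H -> (forall x, 0 <= H x)%E ->
  (\int[power_measure mu n.+1]_x H x =
   \int[mu]_x \int[power_measure mu n]_y H (tuple_cons (x, y)))%E.
Proof.
move=> mH H0 /=.
rewrite (ge0_integral_pushforward (@measurable_tuple_cons _ T n))//=.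
rewrite preimage_setT fubini_tonelli1//=.
by apply: measurableT_comp => //; exact: measurable_tuple_cons.
Qed.

Lemma cmfun_cons n (h : n.+1.-tuple T -> R[i]) :
  cmfun h -> cmfun (fun p => h (tuple_cons p)).
Proof. by move=> mh; apply: (cmfun_comp mh); exact: measurable_tuple_cons. Qed.

Lemma cintegrable_cons n (h : n.+1.-tuple T -> R[i]) : cintegrable (power_measure mu n.+1) h ->
  (\int[mu]_x \int[power_measure mu n]_y (normc (h (tuple_cons (x, y))))%:E < +oo)%E.
Proof.
move=> [mh hoo]; rewrite -(ge0_integral_cons (H := fun z => (normc (h z))%:E))//.
  by apply/measurable_EFinP; exact: cmfun_normc.
by move=> x; rewrite lee_fin normc_ge0.
Qed.

Lemma cint_cons n (h : n.+1.-tuple T -> R[i]) : cintegrable (power_measure mu n.+1) h ->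
  cint (power_measure mu n.+1) h =
  cint (mu \x power_measure mu n)%E (fun p => h (tuple_cons p)).
Proof.
move=> hi; have hp := cintegrable_prod (cmfun_cons hi.1) (cintegrable_cons hi).
have [mR mI] := hi.1.
apply: complex_ext => /=; rewrite /Rintegral; congr fine.
  rewrite (integral_pushforward (@measurable_tuple_cons _ T n))//=.
    exact/measurable_EFinP.
  by rewrite preimage_setT; exact: (cintegrable_Re hp).
rewrite (integral_pushforward (@measurable_tuple_cons _ T n))//=.
  exact/measurable_EFinP.
by rewrite preimage_setT; exact: (cintegrable_Im hp).
Qed.

Lemma measurable_map_tuple n (f : 'I_n -> T -> T) : (forall j, measurable_fun setT (f j)) ->
  measurable_fun setT (fun x : n.-tuple T => [tuple f j (tnth x j) | j < n]).
Proof.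
move=> mf; apply/measurable_fun_tnthP => j /=.
rewrite (_ : _ \o _ = f j \o (@tnth n T)^~ j).
  by apply: measurableT_comp => //; exact: measurable_tnth.
by apply/funext => x /=; rewrite tnth_mktuple.
Qed.

Lemma measurable_prod_tnth n (f : 'I_n -> T -> R) : (forall j, measurable_fun setT (f j)) ->
  measurable_fun setT (fun x : n.-tuple T => \prod_(j < n) f j (tnth x j)).
Proof.
move=> mf; apply: measurable_prod => j _.
by apply: measurableT_comp => //; exact: measurable_tnth.
Qed.

Lemma map_tuple_cons n (f : 'I_n.+1 -> T -> T) p :
  [tuple f j (tnth (tuple_cons p) j) | j < n.+1] =
  tuple_cons (f ord0 p.1, [tuple f (lift ord0 j) (tnth p.2 j) | j < n]).
Proof.
apply: eq_from_tnth => i; rewrite tnth_mktuple.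
case: (unliftP ord0 i) => [j ->|->]; first by rewrite !tnth_consS tnth_mktuple.
by rewrite !tnth_cons0.
Qed.

(** [v] carries the indicator of a half-line and [w] the Jacobian, possibly with an indicator, so
    that both [x = exp(-u)] and the dilations of the orthant are instances. Each coordinate may use
    a different map, as dilations require. *)
Lemma ge0_power_substitution n (f : 'I_n -> T -> T) (v w : 'I_n -> T -> R) :
  (forall j, measurable_fun setT (f j)) ->
  (forall j, measurable_fun setT (v j)) -> (forall j x, 0 <= v j x) ->
  (forall j, measurable_fun setT (w j)) -> (forall j x, 0 <= w j x) ->
  (forall j (G : T -> \bar R), measurable_fun setT G -> (forall x, 0 <= G x)%E ->
     \int[mu]_x (G x * (v j x)%:E) = \int[mu]_x (G (f j x) * (w j x)%:E))%E ->
  forall G : n.-tuple T -> \bar R, measurable_fun setT G -> (forall x, 0 <= G x)%E ->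
  (\int[power_measure mu n]_x (G x * (\prod_(j < n) v j (tnth x j))%R%:E) =
   \int[power_measure mu n]_x
     (G [tuple f j (tnth x j) | j < n] * (\prod_(j < n) w j (tnth x j))%R%:E))%E.
Proof.
elim: n f v w => [|n IH] f v w mf mv v0 mw w0 vw G mG G0.
  rewrite /= !integral_dirac//= ?diracT ?mul1e ?big_ord0.
  - by congr (_ * _)%E; congr (G _); rewrite [LHS]tuple0 [RHS]tuple0.
  - apply: emeasurable_funM.
      by apply: measurableT_comp => //; exact: measurable_map_tuple.
    by apply/measurable_EFinP; exact: measurable_prod_tnth.
  - by apply: emeasurable_funM => //; apply/measurable_EFinP; exact: measurable_prod_tnth.
have mcons x : measurable_fun setT (fun y : n.-tuple T => tuple_cons (x, y)).
  by apply: (measurableT_comp (@measurable_tuple_cons _ T n)).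
have p0 m (u : 'I_m -> T -> R) (y : m.-tuple T) : (forall j x, 0 <= u j x) ->
    (0 <= (\prod_(j < m) u j (tnth y j))%R%:E)%E.
  by move=> u0; rewrite lee_fin prodr_ge0.
rewrite (@ge0_integral_cons n); last 2 first.
- by apply: emeasurable_funM => //; apply/measurable_EFinP; exact: measurable_prod_tnth.
- by move=> x; rewrite mule_ge0// p0.
rewrite [RHS](@ge0_integral_cons n); last 2 first.
- apply: emeasurable_funM.
    by apply: measurableT_comp => //; exact: measurable_map_tuple.
  by apply/measurable_EFinP; exact: measurable_prod_tnth.
- by move=> x; rewrite mule_ge0// p0.
pose f' j := f (lift ord0 j); pose v' j := v (lift ord0 j); pose w' j := w (lift ord0 j).
(* The remaining coordinates are integrated out first: the one-dimensional hypothesis acts on [K],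
   and the induction hypothesis then acts inside [K]. *)
pose K x := (\int[power_measure mu n]_y (G (tuple_cons (x, y)) *
   (\prod_(j < n) v' j (tnth y j))%R%:E))%E.
have mK : measurable_fun setT K.
  apply: (measurable_fun_fubini_tonelli_F (fun p => (G (tuple_cons p) *
    (\prod_(j < n) v' j (tnth p.2 j))%R%:E)%E)).
    apply: emeasurable_funM.
      by apply: measurableT_comp => //; exact: measurable_tuple_cons.
    apply/measurable_EFinP.
    apply: (measurableT_comp (f := fun y : n.-tuple T => \prod_(j < n) v' j (tnth y j))) => //.
    by apply: measurable_prod_tnth => j; exact: mv.
  by move=> p; rewrite mule_ge0// p0// => j x; exact: v0.
have K0 x : (0 <= K x)%E.
  by apply: integral_ge0 => y _; rewrite mule_ge0// p0// => j z; exact: v0.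
transitivity (\int[mu]_x (K x * (v ord0 x)%:E))%E.
  apply: eq_integral => x _.
  rewrite muleC -ge0_integralZl//=; last 3 first.
  - apply: emeasurable_funM; first exact: measurableT_comp.
    by apply/measurable_EFinP; apply: measurable_prod_tnth => j; exact: mv.
  - by move=> y _; rewrite mule_ge0// p0// => j z; exact: v0.
  - by rewrite lee_fin v0.
  apply: eq_integral => y _; rewrite big_ord_recl tnth_cons0 EFinM.
  rewrite muleCA; congr (_ * (_ * _%:E))%E.
  by apply: eq_bigr => j _; rewrite tnth_consS.
rewrite vw//; apply: eq_integral => x _.
rewrite /K (IH f' v' w')//; last 7 first.
- by move=> j; exact: mf.
- by move=> j; exact: mv.
- by move=> j z; exact: v0.
- by move=> j; exact: mw.
- by move=> j z; exact: w0.
- by move=> j; exact: vw.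
- exact: measurableT_comp.
rewrite muleC -ge0_integralZl//=; last 3 first.
- apply: emeasurable_funM.
    apply: (measurableT_comp (measurableT_comp mG (mcons _))).
    by apply: measurable_map_tuple => j; exact: mf.
  by apply/measurable_EFinP; apply: measurable_prod_tnth => j; exact: mw.
- by move=> y _; rewrite mule_ge0// p0// => j z; exact: w0.
- by rewrite lee_fin w0.
apply: eq_integral => y _; rewrite map_tuple_cons big_ord_recl tnth_cons0 EFinM.
rewrite muleCA; congr (_ * (_ * _%:E))%E.
by apply: eq_bigr => j _; rewrite tnth_consS.
Qed.

End power.

(** * Transport of densities along a map *)

Section transfer.
Context {d1 d2} {T1 : measurableType d1} {T2 : measurableType d2} {R : realType}.
Variables (mu : {measure set T1 -> \bar R}) (nu : {measure set T2 -> \bar R}).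
Variables (phi : T1 -> T2) (w : T1 -> R) (v : T2 -> R).
Hypotheses (mphi : measurable_fun setT phi) (mw : measurable_fun setT w)
  (mv : measurable_fun setT v) (w0 : forall x, 0 <= w x) (v0 : forall y, 0 <= v y).
Local Open Scope ereal_scope.
Hypothesis indicP : forall A, measurable A ->
  \int[nu]_y (\1_A y * v y)%:E = \int[mu]_x (\1_A (phi x) * w x)%:E.

Import HBNNSimple.

(** [indicP] says that the measure [v nu] is the image of [w mu] under [phi]. Linearity extends this
    to simple functions and monotone convergence to [G]. *)
Lemma ge0_density_transfer (G : T2 -> \bar R) : measurable_fun setT G -> (forall y, 0 <= G y) ->
  \int[nu]_y (G y * (v y)%:E) = \int[mu]_x (G (phi x) * (w x)%:E).
Proof.
move=> mG G0; pose g := nnsfun_approx measurableT mG.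
have mI n k : measurable_fun setT (fun x => \1_(g n @^-1` [set k]) (phi x) : R).
  have m1 : measurable_fun setT (\1_(g n @^-1` [set k]) : T2 -> R) by exact: measurable_indic.
  exact: (measurableT_comp m1 mphi).
have step (n : nat) : \int[nu]_y ((g n y)%:E * (v y)%:E) =
    \int[mu]_x ((g n (phi x))%:E * (w x)%:E).
  transitivity (\sum_(k \in range (g n)) \int[nu]_y ((k * \1_(g n @^-1` [set k]) y)%:E * (v y)%:E)).
    rewrite -ge0_integral_fsum//.
    - apply: eq_integral => y _; rewrite fimfunE -fsumEFin// ge0_mule_fsuml//.
      by move=> k; rewrite EFinM nnfun_muleindic_ge0.
    - move=> k; apply: emeasurable_funM; apply/measurable_EFinP => //.
      by apply: measurable_funM => //; exact: measurable_indic.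
    - by move=> k y _; rewrite mule_ge0 ?lee_fin//; rewrite -lee_fin EFinM nnfun_muleindic_ge0.
  transitivity (\sum_(k \in range (g n)) \int[mu]_x ((k * \1_(g n @^-1` [set k]) (phi x))%:E * (w x)%:E)).
    apply: eq_fsbigr => k /set_mem[y0 _ gk].
    have k0 : (0 <= k)%R by rewrite -gk.
    transitivity (k%:E * \int[nu]_y (\1_(g n @^-1` [set k]) y * v y)%:E).
      rewrite -ge0_integralZl//.
      - by apply: eq_integral => y _; rewrite EFinM -muleA.
      - by apply/measurable_EFinP; apply: measurable_funM.
      - by move=> y _; rewrite lee_fin mulr_ge0.
    rewrite indicP// -ge0_integralZl//.
    - by apply: eq_integral => y _; rewrite EFinM muleA.
    - apply/measurable_EFinP; exact: measurable_funM.
    - by move=> y _; rewrite lee_fin mulr_ge0.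
  rewrite -ge0_integral_fsum//.
  - apply: eq_integral => x _; rewrite (fimfunE (g n)) -fsumEFin// ge0_mule_fsuml//.
    by move=> k; rewrite EFinM nnfun_muleindic_ge0.
  - move=> k; apply: emeasurable_funM; apply/measurable_EFinP => //.
    by apply: measurable_funM => //; exact: measurable_funM.
  - by move=> k y _; rewrite mule_ge0 ?lee_fin//; rewrite -lee_fin EFinM nnfun_muleindic_ge0.
(* One limit serves both sides: [f = id] over [nu] and [f = phi] over [mu]. *)
have lim1 d (T : measurableType d) (m : {measure set T -> \bar R}) (f : T -> T2) (u : T -> R) :
    measurable_fun setT f -> measurable_fun setT u -> (forall x, 0 <= u x)%R ->
    (\int[m]_x ((g n (f x))%:E * (u x)%:E)) @[n --> \oo] --> \int[m]_x (G (f x) * (u x)%:E).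
  move=> mf mu_ u0.
  rewrite [X in _ --> X](_ : _ = \int[m]_x limn (fun n => (g n (f x))%:E * (u x)%:E)).
    apply: cvg_monotone_convergence => //.
    - by move=> n; apply: emeasurable_funM; apply/measurable_EFinP => //; exact: measurableT_comp.
    - by move=> n x _; rewrite mule_ge0 ?lee_fin.
    - by move=> x _ a b ab; rewrite lee_wpmul2r ?lee_fin//; exact/lefP/nd_nnsfun_approx.
  apply: eq_integral => x _; apply/esym/cvg_lim => //.
  apply: cvgeZr => //; apply: cvg_nnsfun_approx => //.
have h1 := lim1 _ _ nu id v (@measurable_id _ _ setT) mv v0.
have h2 := lim1 _ _ mu phi w mphi mw w0.
move: h1; under eq_cvg do rewrite step.
by move=> h1; apply/(cvg_unique _ h1 h2).
Qed.

End transfer.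

Section density_measure.
Context {d} {T : measurableType d} {R : realType}.
Variables (mu : {measure set T -> \bar R}) (w : T -> \bar R).
Hypotheses (mw : measurable_fun setT w) (w0 : forall x, (0 <= w x)%E).

(** The two proofs are arguments so that the measure structure can be attached to the resulting
    term. *)
Definition density_measure (_ : measurable_fun setT w) (_ : forall x, (0 <= w x)%E)
  (A : set T) : \bar R := (\int[mu]_(x in A) w x)%E.

Let dens := density_measure mw w0.

Let dens0 : dens set0 = 0%E.
Proof. by rewrite /dens /density_measure integral_set0. Qed.

Let dens_ge0 A : (0 <= dens A)%E.
Proof. by apply: integral_ge0. Qed.

Let dens_sigma : semi_sigma_additive dens.
Proof. exact: semi_sigma_additive_nng_induced. Qed.

HB.instance Definition _ := isMeasure.Build _ _ _ (density_measure mw w0)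
  dens0 dens_ge0 dens_sigma.

End density_measure.

(* The library's measure structure on [pushforward], with the measurability
   proof as an explicit argument. *)
Definition image_measure d1 d2 (T1 : measurableType d1) (T2 : measurableType d2)
    (R : realType) (mu : {measure set T1 -> \bar R}) (f : T1 -> T2)
    (mf : measurable_fun setT f) : {measure set T2 -> \bar R} :=
  measure_function_pushforward__canonical__measure_function_Measure mu mf.

Section substitution.
Context {R : realType}.
Notation X := (measurableTypeR R).
Notation lam := (@lebesgue_measure R).
Local Open Scope ereal_scope.

(** The image of Lebesgue measure under [y -> (y - b) / a], scaled by [a^-1], gives each interval
    []p, q]] its length, so it is Lebesgue measure by uniqueness. *)
Lemma ge0_affine_substitution (a b : R) (G : X -> \bar R) : (0 < a)%R ->
  measurable_fun setT G -> (forall x, 0 <= G x) ->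
  \int[lam]_x G x = \int[lam]_y (G ((y - b) / a)%R * (a^-1)%:E).
Proof.
move=> a0 mG G0; have ai0 : (0 <= a^-1)%R by rewrite invr_ge0 ltW.
pose f : X -> X := fun y => ((y - b) / a)%R.
have mf : measurable_fun setT f.
  by apply: measurable_funM => //; exact: measurable_funB.
pose nu := mscale (NngNum ai0) (image_measure lam mf).
have lamE : forall A, measurable A -> lam A = nu A.
  apply: (lebesgue_measure_unique) => _ [[p q]] _ <-.
  rewrite /nu /= /mscale /= /pushforward.
  have -> : f @^-1` `]p, q] = `](a * p + b)%R, (a * q + b)%R]%classic.
    apply/seteqP; split => y /=; rewrite !in_itv /= /f.
      by rewrite ltr_pdivlMr// ler_pdivrMr// ltrBrDr lerBlDr ![(_ * a)%R]mulrC.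
    by rewrite ltr_pdivlMr// ler_pdivrMr// ltrBrDr lerBlDr ![(_ * a)%R]mulrC.
  rewrite !lebesgue_measure_itv /= !lte_fin ltrD2r ltr_pM2l//.
  case: ifPn => pq; last by rewrite mule0.
  rewrite -!EFinB -EFinM; congr _%:E; field; lra.
rewrite (eq_measure_integral nu) => [|A mA _]; last exact: lamE.
rewrite /nu ge0_integral_mscale//= ge0_integral_pushforward//=.
rewrite preimage_setT muleC -ge0_integralZr//.
by apply: measurableT_comp.
Qed.

(** A weight in place of the domain []0, +oo[]: over several coordinates the orthant becomes a
    product of weights, which fits [ge0_power_substitution]. *)
Definition posind (x : R) : R := (0 < x)%R%:R.

Lemma measurable_posind : measurable_fun setT (posind : X -> R).
Proof.
rewrite (_ : posind = (\1_(`]0%R, +oo[) : X -> R)); first exact: measurable_indic.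
by apply/funext => x; rewrite /posind indicE mem_setE in_itv /= andbT.
Qed.

Lemma posind_ge0 x : (0 <= posind x)%R.
Proof. by rewrite /posind ler0n. Qed.

Lemma ge0_scale_substitution (a : R) (G : X -> \bar R) : (0 < a)%R ->
  measurable_fun setT G -> (forall x, 0 <= G x) ->
  \int[lam]_x (G x * (posind x)%:E) = \int[lam]_y (G (y / a)%R * (posind y * a^-1)%:E).
Proof.
move=> a0 mG G0; rewrite (ge0_affine_substitution 0%R a0)//; last 2 first.
- by apply: emeasurable_funM => //; apply/measurable_EFinP; exact: measurable_posind.
- by move=> x; rewrite mule_ge0// lee_fin posind_ge0.
apply: eq_integral => y _; rewrite subr0 EFinM muleA; congr (_ * _%:E * _).
by rewrite /posind pmulr_lgt0// invr_gt0.
Qed.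

Lemma expRN_integral (b : R) : (0 < b)%R ->
  \int[lam]_(u in `[(- ln b)%R, +oo[) (expR (- u))%:E = b%:E.
Proof.
move=> b0; rewrite (@ge0_continuous_FTC2y R (fun u => expR (- u)) (fun u => - expR (- u))%R _ 0%R).
- by rewrite opprK lnK// -EFinB sub0r opprK.
- by move=> x _; exact: expR_ge0.
- apply: continuous_subspaceT => x; apply: continuous_comp; last exact: continuous_expR.
  exact: opp_continuous.
- by rewrite -oppr0; apply: cvgN; exact: cvgr_expR.
- by move=> x _; exact: ex_derive.
- apply: cvg_at_right_filter; apply: cvgN.
  apply: continuous_comp; [exact: opp_continuous|exact: continuous_expR].
- move=> x _; rewrite derive1E; apply: derive_val; apply: is_derive_eq.
  by rewrite mulrN1 opprK.
Qed.

Notation expN := (fun u : X => expR (- u) : X).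

Lemma measurable_expN : measurable_fun setT expN.
Proof. by apply: measurableT_comp => //; exact: measurable_funN. Qed.

Lemma measurable_EFin_expN : measurable_fun setT (fun u : X => (expR (- u))%:E).
Proof. by apply/measurable_EFinP; exact: measurable_expN. Qed.

Lemma EFin_expN_ge0 (u : X) : 0 <= (expR (- u))%:E.
Proof. by rewrite lee_fin expR_ge0. Qed.

(** The image under [u -> exp(-u)] of the measure with density [exp(-u)], which turns out to be
    Lebesgue measure on the positive half-line. *)
Definition exp_image : {measure set X -> \bar R} :=
  image_measure (density_measure lam measurable_EFin_expN EFin_expN_ge0) measurable_expN.

Lemma exp_imageE A : exp_image A = \int[lam]_(u in expN @^-1` A) (expR (- u))%:E.
Proof. by []. Qed.

Lemma exp_image_itv0 (b : R) : (0 < b)%R -> exp_image `]0%R, b]%classic = b%:E.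
Proof.
move=> b0; rewrite exp_imageE -[RHS]expRN_integral//; congr (integral _ _ _).
apply/seteqP; split => u /=; rewrite !in_itv /= expR_gt0 /= ?andbT.
  by rewrite -[X in (_ <= X)%R -> _]lnK// ler_expR lerNl.
by rewrite -[X in _ -> (_ <= X)%R]lnK// ler_expR lerNl.
Qed.

Lemma exp_image_itv (a b : R) : (0 <= a < b)%R -> exp_image `]a, b]%classic = (b - a)%:E.
Proof.
move=> /andP[a0 ab]; have [->|aN0] := eqVneq a 0%R.
  by rewrite subr0 exp_image_itv0//; exact: le_lt_trans ab.
have {aN0}a0 : (0 < a)%R by rewrite lt_neqAle eq_sym aN0.
have b0 := lt_trans a0 ab.
have : exp_image `]0%R, b]%classic = exp_image `]0%R, a]%classic + exp_image `]a, b]%classic.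
  rewrite -measureU//.
    congr (exp_image _); apply/seteqP; split => x /=; rewrite !in_itv /=.
      by move=> /andP[x0 xb]; have [xa|xa] := leP x a; [left|right]; rewrite ?x0 ?xa.
    by case => /andP[h1 h2]; apply/andP; split; lra.
  by apply/seteqP; split => // x [] /=; rewrite !in_itv/= => /andP[_ h] /andP[h' _]; lra.
rewrite !exp_image_itv0// => bE.
by rewrite EFinB bE addeAC subee ?add0e.
Qed.

(** Uniqueness of Lebesgue measure is a statement about the whole line. So Lebesgue measure
    restricted to []-oo, 0]] is added to [exp_image], and the sum is compared with Lebesgue measure
    on intervals []p, q]], cut at 0. *)
Lemma lebesgue_exp_image A : measurable A -> exp_image A = lam (A `&` `]0%R, +oo[).
Proof.
move=> mA.
have mN : measurable (`]-oo, 0%R] : set X) by [].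
have preP B : exp_image B = exp_image (B `&` `]0%R, +oo[).
  rewrite !exp_imageE; congr (integral _ _ _).
  by apply/seteqP; split => u /=; rewrite in_itv /= expR_gt0 //; case.
pose nu := measure_add exp_image (mrestr lam mN).
have nuE : forall A, measurable A -> lam A = nu A.
  apply: lebesgue_measure_unique => _ [[p q]] _ <-.
  rewrite /nu [RHS]measure_addE /= /mrestr preP.
  have [qp|pq] := leP q p.
    by rewrite set_itv_ge ?bnd_simp -?leNgt// !set0I !measure0 adde0.
  have -> : `]p, q]%classic `&` `]0%R, +oo[%classic = `](Num.max p 0%R), q]%classic :> set X.
    apply/seteqP; split => x /=; rewrite !in_itv /= ?gt_max.
      by case=> /andP[-> ->]; rewrite andbT => ->.
    by move=> /andP[/andP[-> ->] ->].
  have -> : `]p, q]%classic `&` `]-oo, 0%R]%classic = `]p, (Num.min q 0%R)]%classic :> set X.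
    apply/seteqP; split => x /=; rewrite !in_itv /= ?le_min.
      by case=> /andP[-> ->] ->.
    by move=> /andP[-> /andP[-> ->]].
  have [q0|q0] := leP q 0%R.
    rewrite [X in exp_image X]set_itv_ge; last by rewrite bnd_simp -leNgt le_max q0 orbT.
    by rewrite measure0 add0e.
  rewrite exp_image_itv; last by rewrite le_max lexx orbT /= gt_max pq.
  rewrite !lebesgue_measure_itv /= !lte_fin pq.
  have [p0|p0] := leP p 0%R.
    case: ltP => p0'; first by rewrite -!EFinD; congr _%:E; lra.
    by rewrite adde0 -!EFinD; congr _%:E; lra.
  by rewrite ltNge ltW//= adde0 EFinB.
have := nuE (A `&` `]0%R, +oo[) (measurableI _ _ mA (measurable_itv _)).
rewrite /nu [X in _ = X -> _]measure_addE /= /mrestr => ->.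
rewrite -setIA (_ : `]0%R, +oo[%classic `&` _ = set0); last first.
  by apply/seteqP; split => // x [] /=; rewrite !in_itv/= andbT => h1 h2; lra.
by rewrite setI0 measure0 adde0 -preP.
Qed.

Lemma ge0_exp_substitution (G : X -> \bar R) :
  measurable_fun setT G -> (forall x, 0 <= G x) ->
  \int[lam]_x (G x * (posind x)%:E) = \int[lam]_u (G (expR (- u)) * (expR (- u))%:E).
Proof.
apply: ge0_density_transfer.
- exact: measurable_expN.
- exact: measurable_expN.
- exact: measurable_posind.
- by move=> u; exact: expR_ge0.
- exact: posind_ge0.
move=> A mA.
transitivity (lam (A `&` `]0%R, +oo[)).
  rewrite -[A `&` _]setIT -integral_indic//; last exact: measurableI.
  apply: eq_integral => x _; congr _%:E.
  by rewrite indicI /= /posind !indicE; congr (_ * _)%R; rewrite mem_setE in_itv/= andbT.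
rewrite -lebesgue_exp_image// exp_imageE [LHS]integral_mkcond.
apply: eq_integral => u _; rewrite patchE indicE.
have -> : (u \in expN @^-1` A) = (expR (- u) \in A).
  by apply/idP/idP; rewrite !inE.
by case: ifPn => _; rewrite ?mul1r ?mul0r.
Qed.

End substitution.

(** * Plancherel's theorem in dimension one *)

Section poisson.
Context {R : realType}.
Notation X := (measurableTypeR R).
Notation lam := (@lebesgue_measure R).

Definition cis (x : R) : R[i] := cos x +i* sin x.

Definition expAbs (e t : R) : R := expR (- (e * `|t|)).

(** The Fourier transform of [expAbs e]: the Poisson kernel of the half-plane normalised to total
    mass [2 * pi] instead of 1. *)
Definition poisson (e z : R) : R := 2 * e / (e ^+ 2 + z ^+ 2).

Lemma poisson_ge0 e z : 0 < e -> 0 <= poisson e z.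
Proof. by move=> e0; rewrite divr_ge0 ?addr_ge0 ?sqr_ge0 ?mulr_ge0 ?ltW. Qed.

Lemma poissonN e z : poisson e (- z) = poisson e z.
Proof. by rewrite /poisson sqrrN. Qed.

Lemma poisson_le e z : 0 < e -> poisson e z <= 2 * e / e ^+ 2.
Proof.
move=> e0; apply: ler_wpM2l; first by rewrite mulr_ge0// ltW.
have p0 : 0 < e ^+ 2 + z ^+ 2 by rewrite ltr_pwDl ?exprn_gt0 ?sqr_ge0.
by rewrite lef_pV2 ?posrE ?exprn_gt0// lerDl sqr_ge0.
Qed.

Lemma continuous_poisson e : 0 < e -> continuous (poisson e).
Proof.
move=> e0 z; apply: cvgM; first exact: cvg_cst.
apply: cvgV; first by rewrite gt_eqF// ltr_pwDl ?exprn_gt0// sqr_ge0.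
by apply: cvgD; [exact: cvg_cst|exact: exprn_continuous].
Qed.

Lemma measurable_poisson e : 0 < e -> measurable_fun setT (poisson e : X -> R).
Proof. by move=> e0; apply: continuous_measurable_fun; exact: continuous_poisson. Qed.

Lemma measurable_cos : measurable_fun setT (@cos R : X -> R).
Proof. by apply: continuous_measurable_fun; exact: continuous_cos. Qed.

Lemma measurable_sin : measurable_fun setT (@sin R : X -> R).
Proof. by apply: continuous_measurable_fun; exact: continuous_sin. Qed.

Lemma poissonE e y z : 0 < e ->
  poisson e (z - y) = (2 * (oneDsqr ((z - y) / e))^-1) * e^-1.
Proof.
move=> e0; rewrite /poisson /oneDsqr.
have h1 : e ^+ 2 + (z - y) ^+ 2 != 0 by rewrite gt_eqF// ltr_pwDl ?exprn_gt0// sqr_ge0.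
have h2 : 1 + ((z - y) / e) ^+ 2 != 0 by rewrite gt_eqF// ltr_pwDl// sqr_ge0.
by field; rewrite h1 gt_eqF.
Qed.

Lemma integral_oneDsqrV :
  (\int[lam]_u (2 * (oneDsqr u)^-1)%:E = (2 * pi)%:E)%E.
Proof.
under eq_integral do rewrite EFinM.
rewrite ge0_integralZl//; last first.
  by apply/measurable_EFinP; apply: continuous_measurable_fun; exact: continuous_oneDsqrV.
rewrite ge0_symfun_integralT.
- rewrite -set_itvcy integral0y_oneDsqr -!EFinM; congr _%:E; lra.
- by move=> x; rewrite invr_ge0 ltW// (lt_le_trans ltr01)// oneDsqr_ge1.
- exact: continuous_oneDsqrV.
- by move=> x /=; rewrite /oneDsqr sqrrN.
Qed.

Lemma integral_poisson e y : 0 < e ->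
  (\int[lam]_z (poisson e (z - y))%:E = (2 * pi)%:E)%E.
Proof.
move=> e0; rewrite -integral_oneDsqrV [RHS](ge0_affine_substitution y e0).
- by apply: eq_integral => z _; rewrite -EFinM poissonE.
- apply/measurable_EFinP; apply: measurable_funM => //.
  by apply: continuous_measurable_fun; exact: continuous_oneDsqrV.
- by move=> u; rewrite lee_fin mulr_ge0// invr_ge0 ltW// (lt_le_trans ltr01)// oneDsqr_ge1.
Qed.

Lemma integral_poisson_itv (e y a b : R) : 0 < e -> a < b ->
  (\int[lam]_(z in `[a, b]) (poisson e (z - y))%:E =
   (2 * (atan ((b - y) / e) - atan ((a - y) / e)))%:E)%E.
Proof.
move=> e0 ab; pose F z := 2 * atan ((z - y) / e).
have dF (z : R) : is_derive z 1 F (poisson e (z - y)).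
  rewrite poissonE//; apply: is_derive_eq.
  rewrite /GRing.scale /= /oneDsqr; field.
  by rewrite !gt_eqF// ltr_pwDl ?exprn_gt0 ?sqr_ge0.
have cF (z : R) : {for z, continuous F}.
  by apply/differentiable_continuous/derivable1_diffP; exact: ex_derive.
rewrite (@continuous_FTC2 _ _ F)//.
- by rewrite /F -EFinB; congr _%:E; ring.
- apply: continuous_subspaceT => z.
  apply: (@continuous_comp _ _ _ (fun z => z - y) (poisson e)); last exact: continuous_poisson.
  by apply: cvgB; [exact: cvg_id|exact: cvg_cst].
- split.
  + by move=> x _; exact: ex_derive.
  + by apply: cvg_at_right_filter; exact: cF.
  + by apply: cvg_at_left_filter; exact: cF.
- by move=> x _; rewrite derive1E; exact: derive_val.
Qed.

Lemma cvg0_expN (e C : R) (F : R -> R) : 0 < e ->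
  (forall t, 0 <= t -> `|F t| <= C * expR (- (e * t))) -> F t @[t --> +oo] --> 0.
Proof.
move=> e0 FC.
have h : C * expR (- (e * t)) @[t --> +oo] --> 0.
  rewrite -(mulr0 C); apply: cvgM; first exact: cvg_cst.
  apply: (cvg_comp (fun t => e * t) (fun t => expR (- t))); last exact: cvgr_expR.
  exact: gt0_cvgMry.
apply/norm_cvg0P; apply: (squeeze_cvgr _ (cvg_cst 0) h).
by near=> t; rewrite normr_ge0/= FC//; near: t; apply: nbhs_pinfty_ge; exact: num_real.
Unshelve. all: by end_near. Qed.

(** The summand 1 makes the integrand nonnegative, so the fundamental theorem of calculus applies on
    the half-line without prior integrability. The cosine part is recovered later by subtraction. *)
Lemma integral0y_1Dcos (e z : R) : 0 < e ->
  (\int[lam]_(t in `[0%R, +oo[) ((1 + cos (z * t)) * expR (- (e * t)))%:E =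
   (e^-1 + e / (e ^+ 2 + z ^+ 2))%:E)%E.
Proof.
move=> e0; have q0 : e ^+ 2 + z ^+ 2 != 0.
  by rewrite gt_eqF// ltr_pwDl ?exprn_gt0// sqr_ge0.
(* The first quotient is an antiderivative of [cos (z * t) * expR (- (e * t))], the second of
   [expR (- (e * t))]. *)
pose F (t : R) := (z * sin (z * t) - e * cos (z * t)) * expR (- (e * t)) / (e ^+ 2 + z ^+ 2)
  - expR (- (e * t)) / e.
have dF (t : R) : is_derive t 1 F ((1 + cos (z * t)) * expR (- (e * t))).
  apply: is_derive_eq.
  by rewrite /GRing.scale /=; field; rewrite q0 gt_eqF.
have cf : continuous (fun t : R => (1 + cos (z * t)) * expR (- (e * t))).
  move=> t; apply/differentiable_continuous/derivable1_diffP; exact: ex_derive.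
rewrite (@ge0_continuous_FTC2y _ _ F _ 0).
- rewrite -EFinB /F !mulr0 sin0 cos0 oppr0 expR0 mulr0; congr _%:E.
  by field; rewrite q0 gt_eqF.
- by move=> t _; rewrite mulr_ge0 ?expR_ge0// -lerBlDl sub0r cos_geN1.
- exact: continuous_subspaceT.
- apply: (@cvg0_expN e ((`|z| + e) / (e ^+ 2 + z ^+ 2) + e^-1)) => // t t0.
  rewrite /F (le_trans (ler_normB _ _))// [leRHS]mulrDl; apply: lerD.
    rewrite !normrM mulrAC (ger0_norm (expR_ge0 _)) ler_wpM2r ?expR_ge0//.
    rewrite normfV [X in _ / X]ger0_norm ?addr_ge0 ?sqr_ge0// ler_wpM2r ?invr_ge0 ?addr_ge0 ?sqr_ge0//.
    rewrite (le_trans (ler_normB _ _))// !normrM (gtr0_norm e0); apply: lerD.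
      by rewrite ler_piMr// sin_max.
    by rewrite ler_piMr ?cos_max// ltW.
  by rewrite normrM (ger0_norm (expR_ge0 _)) gtr0_norm ?invr_gt0// mulrC.
- by move=> t _; exact: ex_derive.
- apply: cvg_at_right_filter.
  by apply/differentiable_continuous/derivable1_diffP; exact: ex_derive.
- by move=> t _; rewrite derive1E; exact: derive_val.
Qed.

Lemma continuous_expAbs e : continuous (expAbs e).
Proof.
move=> t; apply: continuous_comp; last exact: continuous_expR.
by apply: cvgN; apply: cvgM; [exact: cvg_cst|exact: norm_continuous].
Qed.

Lemma measurable_expAbs e : measurable_fun setT (expAbs e : X -> R).
Proof. by apply: continuous_measurable_fun; exact: continuous_expAbs. Qed.

Lemma expAbs_ge0 e t : 0 <= expAbs e t. Proof. exact: expR_ge0. Qed.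

Lemma expAbs_le1 e t : 0 < e -> expAbs e t <= 1.
Proof. by move=> e0; rewrite -expR0 ler_expR oppr_le0 mulr_ge0// ltW. Qed.

Lemma integral_1Dcos (e z : R) : 0 < e ->
  (\int[lam]_t ((1 + cos (z * t)) * expAbs e t)%:E =
   (2 / e + poisson e z)%:E)%E.
Proof.
move=> e0; rewrite ge0_symfun_integralT.
- rewrite [X in (_ * X)%E](_ : _ = (e^-1 + e / (e ^+ 2 + z ^+ 2))%:E).
    by rewrite -EFinM; congr _%:E; rewrite /poisson; ring.
  rewrite -integral0y_1Dcos// set_itvcy; apply: eq_integral => t.
  by rewrite inE /= => t0; rewrite /expAbs ger0_norm.
- by move=> t; rewrite mulr_ge0 ?expR_ge0// -lerBlDl sub0r cos_geN1.
- move=> t; apply: cvgM; last exact: continuous_expAbs.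
  apply: cvgD; first exact: cvg_cst.
  apply: (continuous_comp (f := fun t => z * t)); last exact: continuous_cos.
  by apply: cvgM; [exact: cvg_cst|exact: cvg_id].
- by move=> t /=; rewrite /expAbs normrN mulrN cosN.
Qed.

(** This is [integral_1Dcos] at [z = 0], where the integrand is twice [expAbs e t] and
    [poisson e 0 = 2 / e]. *)
Lemma integral_expAbs (e : R) : 0 < e -> (\int[lam]_t (expAbs e t)%:E = (2 / e)%:E)%E.
Proof.
move=> e0; have := integral_1Dcos 0 e0.
under eq_integral do rewrite mul0r cos0 EFinM.
rewrite ge0_integralZl//; last 2 first.
- by apply/measurable_EFinP; exact: measurable_expAbs.
- by move=> t _; rewrite lee_fin expAbs_ge0.
have -> : (2 / e + poisson e 0)%:E = ((1 + 1)%:E * (2 / e)%:E)%E.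
  by rewrite -EFinM /poisson; congr _%:E; field; rewrite gt_eqF.
move=> h; have : ((2^-1)%:E * ((1 + 1)%:E * \int[lam]_t (expAbs e t)%:E) =
  (2^-1)%:E * ((1 + 1)%:E * (2 / e)%:E))%E by rewrite h.
by rewrite !muleA -!EFinM (_ : 2^-1 * (1 + 1) = 1 :> R) ?mul1e ?mul1r//; lra.
Qed.

End poisson.

Section cis.
Context {R : realType}.
Implicit Types x y : R.

Lemma cisD x y : cis (x + y) = cis x * cis y.
Proof.
by apply: complex_ext; rewrite ?cReM ?cImM /= ?cosD ?sinD; ring.
Qed.

Lemma cisJ x : (conjc (cis x)) = cis (- x).
Proof. by rewrite /cis /= cosN sinN. Qed.

Lemma normc_cis x : normc (cis x) = 1.
Proof. by rewrite /= cos2Dsin2 sqrtr1. Qed.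

Lemma cis0 : cis 0 = 1 :> R[i].
Proof. by rewrite /cis cos0 sin0. Qed.

Lemma cexp_cis x : cexp (0 +i* x) = cis x.
Proof. by rewrite /cexp /= expR0 mul1r. Qed.

Lemma cmfun_cis d (T : measurableType d) (f : T -> R) : measurable_fun setT f ->
  cmfun (fun z => cis (f z)).
Proof.
by move=> mf; split => /=; [exact: (measurableT_comp measurable_cos)|
  exact: (measurableT_comp measurable_sin)].
Qed.

End cis.

Section le_integral.
Context {d} {T : measurableType d} {R : realType}.
Variable mu : {measure set T -> \bar R}.

Lemma Rint_EFin (f : T -> R) : mu.-integrable setT (EFin \o f) ->
  (\int[mu]_x f x)%:E = (\int[mu]_x (f x)%:E)%E.
Proof. by move=> fi; rewrite /Rintegral fineK//; exact: integrable_fin_num. Qed.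

(** The majorant [g] may have infinite integral, as it may when [h] is integrable but not square
    integrable. *)
Lemma Rint_le_integral (f : T -> R) (g : T -> \bar R) :
  mu.-integrable setT (EFin \o f) -> measurable_fun setT g -> (forall x, 0 <= g x)%E ->
  (forall x, (f x)%:E <= g x)%E -> ((\int[mu]_x f x)%:E <= \int[mu]_x g x)%E.
Proof.
move=> fi mg g0 fg; rewrite Rint_EFin// integralE.
apply: (@le_trans _ _ (\int[mu]_x (EFin \o f)^\+ x)%E).
  by rewrite leeBlDr ?leeDl ?integral_ge0//; exact: integrable_neg_fin_num.
apply: ge0_le_integral => //.
  by apply: measurable_funepos; exact: (measurable_int _ fi).
by move=> x _; rewrite funeposE ge_max fg g0.
Qed.

End le_integral.

(** * Integral operators with oscillating kernels and their adjoints *)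

Section fourier_kernel.
Context {d1 d2} {T1 : measurableType d1} {T2 : measurableType d2} {R : realType}.
Variables (m1 : {sigma_finite_measure set T1 -> \bar R})
          (m2 : {sigma_finite_measure set T2 -> \bar R}).
Variable th : T1 * T2 -> R.
Hypothesis mth : measurable_fun setT th.

(* The integral operators with kernels exp(-i th) and exp(i th); the Fourier
   transform and its adjoint are the case of the phase <t, x>. *)
Definition FT (h : T2 -> R[i]) (t : T1) : R[i] := cint m2 (fun x => cis (- th (t, x)) * h x).

Definition AT (k : T1 -> R[i]) (x : T2) : R[i] := cint m1 (fun t => cis (th (t, x)) * k t).

Lemma cmfun_FT h : cmfun h -> cmfun (FT h).
Proof.
move=> mh; apply: (cmfun_cint m2 (h := fun p => cis (- th p) * h p.2)).
apply: cmfunM; first by apply: cmfun_cis; exact: measurable_funN.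
by apply: (cmfun_comp mh).
Qed.

Lemma cmfun_AT k : cmfun k -> cmfun (AT k).
Proof.
move=> mk; apply: (cmfun_cint m1 (h := fun p => cis (th (p.2, p.1)) * k p.2)).
apply: cmfunM; last by apply: (cmfun_comp mk).
by apply: cmfun_cis; exact: (measurable_swap_fun mth).
Qed.

Lemma normc_cisM x (z : R[i]) : normc (cis x * z) = normc z.
Proof. by rewrite Normc.normcM normc_cis mul1r. Qed.

Lemma measurable_th1 t : measurable_fun setT (fun x => th (t, x)).
Proof. by apply: (measurableT_comp mth). Qed.

Lemma measurable_th2 x : measurable_fun setT (fun t => th (t, x)).
Proof. by apply: (measurableT_comp mth). Qed.

Lemma normc_FT_le h (M : R) t : cmfun h -> (\int[m2]_x (normc (h x))%:E <= M%:E)%E ->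
  normc (FT h t) <= M *+ 2.
Proof.
move=> mh hM; apply: normc_cint_le.
  apply: cmfunM => //; apply: cmfun_cis; apply: measurable_funN; exact: measurable_th1.
by under eq_integral do rewrite normc_cisM.
Qed.

Lemma normc_AT_le k (M : R) x : cmfun k -> (\int[m1]_t (normc (k t))%:E <= M%:E)%E ->
  normc (AT k x) <= M *+ 2.
Proof.
move=> mk kM; apply: normc_cint_le.
  by apply: cmfunM => //; apply: cmfun_cis; exact: measurable_th2.
by under eq_integral do rewrite normc_cisM.
Qed.

Lemma cintegrable_bound d (T : measurableType d) (m : {measure set T -> \bar R}) (h : T -> R[i]) :
  cintegrable m h -> exists M : R, (\int[m]_x (normc (h x))%:E <= M%:E)%E.
Proof.
move=> [mh hoo]; exists (fine (\int[m]_x (normc (h x))%:E)); rewrite fineK//.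
by rewrite ge0_fin_numE// integral_ge0// => x _; rewrite lee_fin normc_ge0.
Qed.

Lemma tonelli_normcM (h : T2 -> R[i]) (k : T1 -> R[i]) : cintegrable m1 k -> cintegrable m2 h ->
  (\int[m1]_t \int[m2]_x (normc (k t) * normc (h x))%:E < +oo)%E.
Proof.
move=> ki hi; have [M1 kM] := cintegrable_bound ki; have [M2 hM] := cintegrable_bound hi.
have h0 : (0 <= \int[m2]_x (normc (h x))%:E)%E.
  by apply: integral_ge0 => x _; rewrite lee_fin normc_ge0.
apply: (@le_lt_trans _ _ (\int[m1]_t ((normc (k t))%:E * \int[m2]_x (normc (h x))%:E))%E).
  rewrite le_eqVlt; apply/orP; left; apply/eqP; apply: eq_integral => t _.
  rewrite -ge0_integralZl//.
  - by apply/measurable_EFinP; apply: cmfun_normc; case: hi.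
  - by move=> x _; rewrite lee_fin normc_ge0.
  - by rewrite lee_fin normc_ge0.
rewrite ge0_integralZr//.
- have k0 : (0 <= \int[m1]_t (normc (k t))%:E)%E.
    by apply: integral_ge0 => t _; rewrite lee_fin normc_ge0.
  by rewrite lte_mul_pinfty// ?ge0_fin_numE//; [case: ki|case: hi].
- by apply/measurable_EFinP; apply: cmfun_normc; case: ki.
- by move=> x _; rewrite lee_fin normc_ge0.
Qed.

(** Fubini's theorem: the modulus of the double integrand is [normc (h x) * normc (k t)], so
    integrability of [h] and [k] is enough. *)
Lemma FT_AT_adjoint h k : cintegrable m2 h -> cintegrable m1 k ->
  cint m1 (fun t => FT h t * (conjc (k t))) = cint m2 (fun x => h x * (conjc (AT k x))).
Proof.
move=> hi ki.
have mh := hi.1; have mk := ki.1.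
pose H p := cis (- th p) * h p.2 * (conjc (k p.1)).
have mH : cmfun H.
  apply: cmfunM; last by apply: cmfunJ; apply: (cmfun_comp mk).
  apply: cmfunM; last by apply: (cmfun_comp mh).
  by apply: cmfun_cis; exact: measurable_funN.
have Hoo : (\int[m1]_t \int[m2]_x (normc (H (t, x)))%:E < +oo)%E.
  apply: le_lt_trans (tonelli_normcM ki hi).
  rewrite le_eqVlt; apply/orP; left; apply/eqP; apply: eq_integral => t _.
  by apply: eq_integral => x _; rewrite /H Normc.normcM normc_cisM normc_conj mulrC.
transitivity (cint m1 (fun t => cint m2 (fun x => H (t, x)))).
  congr cint; apply/funext => t; rewrite mulrC -cintZ; last first.
    apply: (@cintegrableM_bnd _ _ _ _ _ _ 1) => //; last by move=> x; rewrite normc_cis.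
    by apply: cmfun_cis; apply: measurable_funN; exact: measurable_th1.
  by congr cint; apply/funext => x; rewrite /H mulrC.
rewrite cint_fubini//; congr cint; apply/funext => x.
rewrite /AT -cintJ; last first.
  apply: (@cintegrableM_bnd _ _ _ _ _ _ 1) => //; last by move=> t; rewrite normc_cis.
  by apply: cmfun_cis; exact: measurable_th2.
rewrite -cintZ; last first.
  apply: cintegrableJ; apply: (@cintegrableM_bnd _ _ _ _ _ _ 1) => //; last by move=> t; rewrite normc_cis.
  by apply: cmfun_cis; exact: measurable_th2.
by congr cint; apply/funext => t; rewrite /H conjcM cisJ; ring.
Qed.

(** Conjugation gives the adjoint a kernel of the form [exp(- i th)]; for a symmetric phase, facts
    about [FT] thereby carry over to [AT]. *)
Lemma AT_conj k x : cintegrable m1 k ->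
  AT k x = (conjc (cint m1 (fun t => cis (- th (t, x)) * (conjc (k t))))).
Proof.
move=> ki; rewrite -cintJ.
  by congr cint; apply/funext => t; rewrite conjcM cisJ opprK conjcK.
apply: (@cintegrableM_bnd _ _ _ _ _ _ 1) => //; last 2 first.
- by move=> t; rewrite normc_cis.
- exact: cintegrableJ.
by apply: cmfun_cis; apply: measurable_funN; exact: measurable_th2.
Qed.

End fourier_kernel.

(** * Upper bound in the one-dimensional identity *)

Section fourier1.
Context {R : realType}.
Notation X := (measurableTypeR R).
Notation lam := (@lebesgue_measure R).

Definition phase1 (p : X * X) : R := p.1 * p.2.

Lemma measurable_phase1 : measurable_fun setT phase1.
Proof. exact: measurable_funM. Qed.

Notation FT1 := (FT lam phase1).
Notation AT1 := (AT lam phase1).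

(** Lebesgue measure is invariant under reflection, which exchanges the positive and the negative
    part of an odd function. *)
Lemma Rint_odd (f : X -> R) : lam.-integrable setT (EFin \o f) ->
  (forall x, f (- x) = - f x) -> \int[lam]_x f x = 0.
Proof.
move=> fi fN; rewrite /Rintegral integralE.
have mf := measurable_int _ fi.
have mN : measurable_fun setT (-%R : X -> X) by [].
rewrite [X in (X - _)%E](_ : _ = \int[lam]_x (EFin \o f)^\- x)%E.
  rewrite subee//; apply: integrable_neg_fin_num => //.
have mp : measurable_fun setT ((EFin \o f)^\+)%E by exact: measurable_funepos.
rewrite (eq_measure_integral (image_measure lam mN)); last first.
  by move=> A mA _; exact/esym/lebesgue_measureN.
rewrite ge0_integral_pushforward// preimage_setT; apply: eq_integral => x _ /=.
by rewrite funeposE funenegE /= fN.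
Qed.

Lemma cintegrable_expAbs e : 0 < e -> cintegrable lam (fun t : X => (expAbs e t)%:C).
Proof.
move=> e0; split; first by apply: cmfunC; exact: measurable_expAbs.
under eq_integral do rewrite normcC ger0_norm ?expAbs_ge0//.
by rewrite integral_expAbs// ltry.
Qed.

Lemma cintegrable_cis d (T : measurableType d) (mu : {measure set T -> \bar R}) (f : T -> R)
    (h : T -> R[i]) : measurable_fun setT f -> cintegrable mu h ->
  cintegrable mu (fun x => cis (f x) * h x).
Proof.
move=> mf hi; apply: (@cintegrableM_bnd _ _ _ _ _ _ 1) => //; last by move=> t; rewrite normc_cis.
exact: cmfun_cis.
Qed.

(** The imaginary part is odd; the real part is the difference of [integral_1Dcos] and
    [integral_expAbs]. *)
Lemma cint_cis_expAbs e z : 0 < e ->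
  cint lam (fun t => cis (t * z) * (expAbs e t)%:C) = (poisson e z)%:C.
Proof.
move=> e0.
have ki := cintegrable_expAbs e0.
have hi : cintegrable lam (fun t => cis (t * z) * (expAbs e t)%:C).
  by apply: cintegrable_cis => //; exact: measurable_funM.
have ReE t : cRe (cis (t * z) * (expAbs e t)%:C) = cos (z * t) * expAbs e t.
  by rewrite cReM /= mulr0 subr0 mulrC [z * t]mulrC mulrC.
have ImE t : cIm (cis (t * z) * (expAbs e t)%:C) = sin (t * z) * expAbs e t.
  by rewrite cImM /= mulr0 add0r.
have i1 := cintegrable_Re hi; have i2 := cintegrable_Im hi.
rewrite /cint; congr (_ +i* _); last first.
  apply: Rint_odd => // t; rewrite !ImE /expAbs normrN mulNr sinN mulNr //.
have i3 := cintegrable_Re ki; rewrite /= in i3.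
have : \int[lam]_t (cRe (cis (t * z) * (expAbs e t)%:C) + expAbs e t) = 2 / e + poisson e z.
  rewrite /Rintegral (eq_integral (fun t : X => ((1 + cos (z * t)) * expAbs e t)%:E)).
    by rewrite integral_1Dcos.
  by move=> t _; rewrite ReE mulrDl mul1r addrC.
rewrite RintegralD// [X in _ + X](_ : _ = 2 / e); first by rewrite addrC => /addrI.
by rewrite /Rintegral integral_expAbs.
Qed.

Lemma cintegrable_FT_expAbs h e : 0 < e -> cintegrable lam h ->
  cintegrable lam (fun t => FT1 h t * (expAbs e t)%:C).
Proof.
move=> e0 hi; have [M hM] := cintegrable_bound hi.
apply: (@cintegrableM_bnd _ _ _ _ _ _ (M *+ 2)).
- by apply: cmfun_FT; [exact: measurable_phase1|case: hi].
- by move=> t; apply: normc_FT_le => //; [exact: measurable_phase1|case: hi].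
- exact: cintegrable_expAbs.
Qed.

(** The damping makes the double integral absolutely convergent, so the [t]-integral may be done
    first; it yields the Poisson kernel at [x - y]. *)
Lemma AT_FT_expAbs h e x : 0 < e -> cintegrable lam h ->
  AT1 (fun t => FT1 h t * (expAbs e t)%:C) x = cint lam (fun y => (poisson e (x - y))%:C * h y).
Proof.
move=> e0 hi; have mh := hi.1.
pose H (p : X * X) := cis (p.1 * x) * (expAbs e p.1)%:C * (cis (- (p.1 * p.2)) * h p.2).
have mH : cmfun H.
  apply: cmfunM; apply: cmfunM.
  - by apply: cmfun_cis; exact: measurable_funM.
  - by apply: cmfunC; apply: (measurableT_comp (measurable_expAbs e)).
  - by apply: cmfun_cis; apply: measurable_funN; exact: measurable_funM.
  - exact: (cmfun_comp mh).
have ki := cintegrable_expAbs e0.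
have Hoo : (\int[lam]_t \int[lam]_y (normc (H (t, y)))%:E < +oo)%E.
  apply: le_lt_trans (tonelli_normcM ki hi).
  rewrite le_eqVlt; apply/orP; left; apply/eqP; apply: eq_integral => t _.
  by apply: eq_integral => y _; rewrite /H Normc.normcM !normc_cisM.
transitivity (cint lam (fun t => cint lam (fun y => H (t, y)))).
  congr cint; apply/funext => t; rewrite /H /= cintZ.
    by rewrite /FT /phase1 /=; ring.
  by apply: cintegrable_cis => //; apply: measurable_funN; exact: measurable_funM.
rewrite cint_fubini//; congr cint; apply/funext => y.
rewrite -cint_cis_expAbs// mulrC -cintZ; last first.
  by apply: cintegrable_cis => //; exact: measurable_funM.
congr cint; apply/funext => t.
by rewrite /H /= mulrBr cisD; ring.
Qed.

Lemma cvg_expAbs t : expAbs (n.+1%:R^-1) t @[n --> \oo] --> (1 : R).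
Proof.
rewrite -[X in _ --> X]expR0 /expAbs.
apply: continuous_cvg; first exact: continuous_expR.
rewrite -[X in _ --> X]oppr0 -[X in _ --> - X](mul0r `|t|); apply: cvgN; apply: cvgM; last exact: cvg_cst.
exact: cvg_harmonic.
Qed.

(** Adjointness moves the damped transform onto [h]. Since [2 Re (h x * conjc (h y))] is at most
    [|h x|^2 + |h y|^2], the double integral splits into two halves, each equal to [pi] times the
    integral of [|h|^2]. Fatou's lemma then removes the damping. *)
Lemma integral_FT1_le h : cintegrable lam h ->
  (\int[lam]_t (normc (FT1 h t) ^+ 2)%:E <= (2 * pi)%:E * \int[lam]_x (normc (h x) ^+ 2)%:E)%E.
Proof.
move=> hi; have mh := hi.1; have mF := cmfun_FT lam measurable_phase1 mh.
have mh2 : measurable_fun setT (fun x => (normc (h x) ^+ 2)%:E).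
  by apply/measurable_EFinP; exact: cmfun_normc2.
apply: (@fatou_le _ _ _ _ (fun n t => (normc (FT1 h t) ^+ 2 * expAbs (n.+1%:R^-1) t)%:E)).
- move=> n; apply/measurable_EFinP; apply: measurable_funM; first exact: cmfun_normc2.
  exact: measurable_expAbs.
- by move=> n t; rewrite lee_fin mulr_ge0 ?sqr_ge0// expAbs_ge0.
- by apply/measurable_EFinP; exact: cmfun_normc2.
- by move=> t; rewrite lee_fin sqr_ge0.
- apply: aeW => t; apply: cvg_EFin; first exact: nearW.
  rewrite -[X in _ --> X]mulr1; apply: cvgM; first exact: cvg_cst.
  exact: cvg_expAbs.
move=> n; pose e : R := n.+1%:R^-1; rewrite -/e.
have e0 : 0 < e by rewrite invr_gt0.
pose k t := FT1 h t * (expAbs e t)%:C.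
have ki : cintegrable lam k by exact: cintegrable_FT_expAbs.
have mk := ki.1.
have [M kM] := cintegrable_bound ki.
have [N hN] := cintegrable_bound hi.
have FTb t : normc (FT1 h t) <= N *+ 2 by apply: normc_FT_le => //; exact: measurable_phase1.
have ReE t : normc (FT1 h t) ^+ 2 * expAbs e t = cRe (FT1 h t * conjc (k t)).
  by rewrite /k conjcM mulrA mulcJ cReM /= oppr0 mul0r subr0.
have ii : cintegrable lam (fun t => FT1 h t * conjc (k t)).
  by apply: (@cintegrableM_bnd _ _ _ _ _ _ (N *+ 2)) => //; exact: cintegrableJ.
under eq_integral do rewrite ReE.
rewrite -Rint_EFin; last exact: cintegrable_Re.
rewrite -[Rintegral _ _ _]/(cRe (cint lam (fun t => FT1 h t * conjc (k t)))).
rewrite (FT_AT_adjoint measurable_phase1 hi ki).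
(* Symmetric majorant of the real part of the double integrand; the gap is the kernel times half of
   [|h x - h y|^2]. *)
pose G x y := poisson e (x - y) * (normc (h x) ^+ 2 + normc (h y) ^+ 2) / 2.
have mG : measurable_fun setT (fun p : X * X => (G p.1 p.2)%:E).
  apply/measurable_EFinP; apply: measurable_funM => //; apply: measurable_funM.
    apply: (measurableT_comp (measurable_poisson e0)); exact: measurable_funB.
  by apply: measurable_funD; apply: (measurableT_comp (cmfun_normc2 mh)).
have G0 x y : 0 <= G x y.
  by rewrite divr_ge0// mulr_ge0 ?poisson_ge0// addr_ge0 ?sqr_ge0.
have hAi : cintegrable lam (fun x => h x * conjc (AT1 k x)).
  rewrite (_ : (fun x => _) = (fun x => conjc (AT1 k x) * h x)); last first.
    by apply/funext => x; rewrite mulrC.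
  apply: (@cintegrableM_bnd _ _ _ _ _ _ (M *+ 2)) => //.
    by apply: cmfunJ; apply: cmfun_AT => //; exact: measurable_phase1.
  by move=> x; rewrite normc_conj; apply: normc_AT_le => //; exact: measurable_phase1.
apply: (@le_trans _ _ (\int[lam]_x \int[lam]_y (G x y)%:E)%E).
  apply: Rint_le_integral.
  - exact: cintegrable_Re.
  - by apply: (measurable_fun_fubini_tonelli_F (fun p : X * X => (G p.1 p.2)%:E)) => // p; rewrite lee_fin.
  - by move=> x; apply: integral_ge0 => y _; rewrite lee_fin.
  move=> x; rewrite /k AT_FT_expAbs//.
  have pi_ : cintegrable lam (fun y => (poisson e (x - y))%:C * h y).
    apply: (@cintegrableM_bnd _ _ _ _ _ _ (2 * e / e ^+ 2)) => //.
      apply: cmfunC; apply: (measurableT_comp (measurable_poisson e0)).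
      exact: measurable_funB.
    by move=> y; rewrite normcC ger0_norm ?poisson_ge0// poisson_le.
  rewrite -cintJ// -cintZ; last exact: cintegrableJ.
  apply: Rint_le_integral.
  - by apply: cintegrable_Re; apply: cintegrableZ; exact: cintegrableJ.
  - apply/measurable_EFinP; apply: measurable_funM => //; apply: measurable_funM.
      apply: (measurableT_comp (measurable_poisson e0)); exact: measurable_funB.
    by apply: measurable_funD => //; exact: cmfun_normc2.
  - by move=> y; rewrite lee_fin.
  move=> y; rewrite lee_fin /G !normc2 !(cReM, cImM, cReJ, cImJ) /=.
  rewrite -mulrA ; set P := poisson _ _; have P0 : 0 <= P by exact: poisson_ge0.
  rewrite -subr_ge0 (_ : _ - _ = P * (((cRe (h x) - cRe (h y)) ^+ 2 + (cIm (h x) - cIm (h y)) ^+ 2) / 2)).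
    by rewrite mulr_ge0// divr_ge0// addr_ge0 ?sqr_ge0.
  by field.
have half x y : ((G x y)%:E = (poisson e (x - y) * (normc (h x) ^+ 2 / 2))%:E +
    (poisson e (x - y) * (normc (h y) ^+ 2 / 2))%:E)%E.
  by rewrite -EFinD /G; congr _%:E; ring.
have mp : measurable_fun setT (fun p : X * X => poisson e (p.1 - p.2)).
  apply: (measurableT_comp (measurable_poisson e0)); exact: measurable_funB.
have mpx x : measurable_fun setT (fun y : X => poisson e (x - y)).
  apply: (measurableT_comp (measurable_poisson e0)); exact: measurable_funB.
have mpy y : measurable_fun setT (fun x : X => poisson e (x - y)).
  apply: (measurableT_comp (measurable_poisson e0)); exact: measurable_funB.
have mhh : measurable_fun setT (fun x : X => normc (h x) ^+ 2 / 2).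
  by apply: measurable_funM => //; exact: cmfun_normc2.
have hh0 x : 0 <= normc (h x) ^+ 2 / 2 by rewrite divr_ge0 ?sqr_ge0.
have A1 : (\int[lam]_x \int[lam]_y (poisson e (x - y) * (normc (h x) ^+ 2 / 2))%:E =
    (2 * pi)%:E * \int[lam]_x (normc (h x) ^+ 2 / 2)%:E)%E.
  rewrite -ge0_integralZl//; last 3 first.
  - exact/measurable_EFinP.
  - by move=> x _; rewrite lee_fin.
  - by rewrite lee_fin mulr_ge0// pi_ge0.
  apply: eq_integral => x _.
  under eq_integral do rewrite EFinM.
  rewrite ge0_integralZr//; last 3 first.
  - exact/measurable_EFinP.
  - by move=> y _; rewrite lee_fin poisson_ge0.
  - by rewrite lee_fin.
  congr (_ * _)%E; rewrite -(integral_poisson x e0); apply: eq_integral => y _.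
  by rewrite -poissonN opprB.
(* Here the square depends on the inner variable, so Tonelli brings the kernel's mass in [x]
   inside. *)
have A2 : (\int[lam]_x \int[lam]_y (poisson e (x - y) * (normc (h y) ^+ 2 / 2))%:E =
    (2 * pi)%:E * \int[lam]_x (normc (h x) ^+ 2 / 2)%:E)%E.
  rewrite (fubini_tonelli (fun p : X * X => (poisson e (p.1 - p.2) * (normc (h p.2) ^+ 2 / 2))%:E)); last 2 first.
  - apply/measurable_EFinP; apply: measurable_funM => //.
    exact: (measurableT_comp mhh).
  - by move=> p; rewrite lee_fin mulr_ge0 ?poisson_ge0.
  rewrite -ge0_integralZl//; last 3 first.
  - exact/measurable_EFinP.
  - by move=> x _; rewrite lee_fin.
  - by rewrite lee_fin mulr_ge0// pi_ge0.
  apply: eq_integral => y _ /=.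
  under eq_integral do rewrite EFinM.
  rewrite ge0_integralZr//; last 3 first.
  - exact/measurable_EFinP.
  - by move=> x _; rewrite lee_fin poisson_ge0.
  - by rewrite lee_fin.
  by rewrite integral_poisson.
have mPh1 x : measurable_fun setT (fun y : X => (poisson e (x - y) * (normc (h x) ^+ 2 / 2))%:E).
  by apply/measurable_EFinP; exact: measurable_funM.
have mPh2 x : measurable_fun setT (fun y : X => (poisson e (x - y) * (normc (h y) ^+ 2 / 2))%:E).
  by apply/measurable_EFinP; exact: measurable_funM.
have Ph10 x y : (0 <= (poisson e (x - y) * (normc (h x) ^+ 2 / 2))%:E)%E.
  by rewrite lee_fin mulr_ge0 ?poisson_ge0.
have Ph20 x y : (0 <= (poisson e (x - y) * (normc (h y) ^+ 2 / 2))%:E)%E.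
  by rewrite lee_fin mulr_ge0 ?poisson_ge0.
rewrite (eq_integral (fun x : X => (\int[lam]_y (poisson e (x - y) * (normc (h x) ^+ 2 / 2))%:E +
   \int[lam]_y (poisson e (x - y) * (normc (h y) ^+ 2 / 2))%:E)%E)); last first.
  by move=> x _; under eq_integral do rewrite half; rewrite ge0_integralD.
rewrite ge0_integralD//=; last 4 first.
- by move=> x _; exact: integral_ge0.
- apply: (measurable_fun_fubini_tonelli_F (fun p : X * X => (poisson e (p.1 - p.2) * (normc (h p.1) ^+ 2 / 2))%:E)) => //.
  apply/measurable_EFinP; apply: measurable_funM => //; exact: (measurableT_comp mhh).
- by move=> x _; exact: integral_ge0.
- apply: (measurable_fun_fubini_tonelli_F (fun p : X * X => (poisson e (p.1 - p.2) * (normc (h p.2) ^+ 2 / 2))%:E)) => //.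
  apply/measurable_EFinP; apply: measurable_funM => //; exact: (measurableT_comp mhh).
rewrite A1 A2 -ge0_muleDr ?integral_ge0//; try by move=> x _; rewrite lee_fin.
rewrite lee_wpmul2l ?lee_fin ?mulr_ge0 ?pi_ge0// -ge0_integralD//; last 4 first.
- by move=> x _; rewrite lee_fin.
- exact/measurable_EFinP.
- by move=> x _; rewrite lee_fin.
- exact/measurable_EFinP.
rewrite le_eqVlt; apply/orP; left; apply/eqP; apply: eq_integral => x _.
by rewrite -EFinD; congr _%:E; field.
Qed.

Lemma integral_AT1_le k : cintegrable lam k ->
  (\int[lam]_x (normc (AT1 k x) ^+ 2)%:E <= (2 * pi)%:E * \int[lam]_t (normc (k t) ^+ 2)%:E)%E.
Proof.
move=> ki; have := integral_FT1_le (cintegrableJ ki).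
under [X in (_ * X)%E]eq_integral do rewrite normc_conj.
apply: le_trans; rewrite le_eqVlt; apply/orP; left; apply/eqP; apply: eq_integral => x _.
rewrite (AT_conj measurable_phase1)// normc_conj /FT /phase1 /=.
by congr ((normc (cint _ _) ^+ 2)%:E); apply/funext => t; rewrite mulrC [t * x]mulrC mulrC.
Qed.

End fourier1.

(** * Limits of integrals against bounded multipliers *)

Section dominated.
Context {d} {T : measurableType d} {R : realType}.
Variable mu : {measure set T -> \bar R}.

Lemma cvg_Rint_mul (g_ : nat -> T -> R) (g f : T -> R) (C : R) :
  (forall n, measurable_fun setT (g_ n)) -> measurable_fun setT g ->
  (forall n x, `|g_ n x| <= C) -> {ae mu, forall x, g_ n x @[n --> \oo] --> g x} ->
  mu.-integrable setT (EFin \o f) ->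
  \int[mu]_x (g_ n x * f x) @[n --> \oo] --> \int[mu]_x (g x * f x).
Proof.
move=> mg_ mg gC gg fi; have mf : measurable_fun setT f.
  by apply/measurable_EFinP; exact: (measurable_int _ fi).
have [|||||i1 _ i2] := @dominated_convergence _ _ _ mu setT measurableT
  (fun n x => (g_ n x * f x)%:E) (fun x => (g x * f x)%:E) (fun x => (C * `|f x|)%:E).
- by move=> n; apply/measurable_EFinP; exact: measurable_funM.
- by apply/measurable_EFinP; exact: measurable_funM.
- move: gg; apply: filterS => x gx _; apply: cvg_EFin; first exact: nearW.
  by apply: cvgM => //; exact: cvg_cst.
- by apply: (@RintZl _ _ _ mu (fun x => `|f x|) C); exact: integrable_norm.
- by apply: aeW => x n _; rewrite abse_EFin lee_fin normrM ler_wpM2r.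
apply: fine_cvg; rewrite fineK//; exact: integrable_fin_num.
Qed.

Lemma cRe_Cmul (a : R) (z : R[i]) : cRe (a%:C * z) = a * cRe z.
Proof. by rewrite cReM /= mul0r subr0. Qed.

Lemma cIm_Cmul (a : R) (z : R[i]) : cIm (a%:C * z) = a * cIm z.
Proof. by rewrite cImM /= mul0r addr0. Qed.

Lemma cvg_normc2_cint (g_ : nat -> T -> R) (g : T -> R) (h : T -> R[i]) (C : R) :
  (forall n, measurable_fun setT (g_ n)) -> measurable_fun setT g ->
  (forall n x, `|g_ n x| <= C) -> {ae mu, forall x, g_ n x @[n --> \oo] --> g x} ->
  cintegrable mu h ->
  normc (cint mu (fun x => (g_ n x)%:C * h x)) ^+ 2 @[n --> \oo] -->
  normc (cint mu (fun x => (g x)%:C * h x)) ^+ 2.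
Proof.
move=> mg_ mg gC gg hi.
have H f : cint mu (fun x => (f x)%:C * h x) =
    (\int[mu]_x (f x * cRe (h x))) +i* (\int[mu]_x (f x * cIm (h x))).
  rewrite /cint; congr (_ +i* _).
    by apply: eq_Rintegral => x _; rewrite cRe_Cmul.
  by apply: eq_Rintegral => x _; rewrite cIm_Cmul.
have N f : normc (cint mu (fun x => (f x)%:C * h x)) ^+ 2 =
    (\int[mu]_x (f x * cRe (h x))) * (\int[mu]_x (f x * cRe (h x))) +
    (\int[mu]_x (f x * cIm (h x))) * (\int[mu]_x (f x * cIm (h x))).
  by rewrite H normc2 !expr2.
rewrite N; under eq_cvg do rewrite N.
have hR := cintegrable_Re hi; have hI := cintegrable_Im hi.
by apply: cvgD; apply: cvgM; exact: (@cvg_Rint_mul _ _ _ C).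
Qed.

End dominated.

(** * Lower bound in the one-dimensional identity *)

Section fourier1_lower.
Context {R : realType}.
Notation X := (measurableTypeR R).
Notation lam := (@lebesgue_measure R).
Notation FT1 := (FT lam (@phase1 R)).
Notation AT1 := (AT lam (@phase1 R)).

(** Written as a kernel in two variables because its symmetry is used: the same mass [r *+ 2] is
    integrated over either variable. *)
Definition window (r : R) (p : X * X) : R := (`|p.1 - p.2| <= r)%R%:R.

Lemma windowE r x z : window r (x, z) = \1_(`[x - r, x + r]%classic) z.
Proof. by rewrite /window /= indicE mem_setE in_itv /= ler_distlC. Qed.

Lemma window_sym r x z : window r (x, z) = window r (z, x).
Proof. by rewrite /window /= distrC. Qed.

Lemma window_ge0 r p : 0 <= window r p. Proof. by rewrite /window ler0n. Qed.

Lemma window_le1 r p : window r p <= 1. Proof. by rewrite /window lern1 leq_b1. Qed.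

Lemma measurable_window r : measurable_fun setT (window r).
Proof.
apply: (measurableT_comp (f := fun b : bool => b%:R : R)) => //.
apply: measurable_fun_ler => //; apply: measurableT_comp => //.
exact: measurable_funB.
Qed.

Lemma measurable_window1 r x : measurable_fun setT (fun z => window r (x, z)).
Proof. by apply: (measurableT_comp (measurable_window r)). Qed.

Lemma integral_window r x : 0 < r -> (\int[lam]_z (window r (x, z))%:E = (r *+ 2)%:E)%E.
Proof.
move=> r0; under eq_integral do rewrite windowE.
rewrite integral_indic// setIT /= lebesgue_measure_itv/= lte_fin.
rewrite ifT; last by lra.
by rewrite -EFinB; congr _%:E; rewrite mulr2n; ring.
Qed.

Lemma integrable_window_mul r x (a : X -> R) (C : R) : 0 < r -> measurable_fun setT a ->
  (forall z, `|a z| <= C) -> lam.-integrable setT (fun z => (window r (x, z) * a z)%:E).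
Proof.
move=> r0 ma aC; apply/integrableP; split.
  by apply/measurable_EFinP; apply: measurable_funM => //; exact: measurable_window1.
apply: (@le_lt_trans _ _ (\int[lam]_z (C%:E * (window r (x, z))%:E))%E).
  have C0 : 0 <= C by exact: le_trans (aC 0).
  apply: ge0_le_integral => //.
  - apply/measurable_EFinP; apply: measurableT_comp => //.
    by apply: measurable_funM => //; exact: measurable_window1.
  - by apply/measurable_EFinP; apply: measurable_funM => //; exact: measurable_window1.
  - move=> z _; rewrite -EFinM lee_fin normrM (ger0_norm (window_ge0 _ _)) mulrC.
    by rewrite ler_wpM2r// window_ge0.
rewrite ge0_integralZl//.
- by rewrite integral_window// ltry.
- by apply/measurable_EFinP; exact: measurable_window1.
- by move=> z _; rewrite lee_fin window_ge0.
- by rewrite lee_fin; exact: le_trans (aC 0).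
Qed.

(* Jensen's inequality for the mean over [x - r, x + r]. *)
Lemma Rint_window_sqr_le r x (a : X -> R) (C : R) : 0 < r -> measurable_fun setT a ->
  (forall z, `|a z| <= C) ->
  (((\int[lam]_z (window r (x, z) * a z)) ^+ 2)%:E <=
   (r *+ 2)%:E * \int[lam]_z (window r (x, z) * a z ^+ 2)%:E)%E.
Proof.
move=> r0 ma aC; set S := Rintegral _ _ _; pose m := S / (r *+ 2).
have r20 : 0 < r *+ 2 by rewrite pmulrn_lgt0.
have w1 : lam.-integrable setT (fun z => (window r (x, z) * 1)%:E).
  by apply: (@integrable_window_mul r x (fun=> 1) 1) => // z; rewrite normr1.
have wa := @integrable_window_mul r x a C r0 ma aC.
have Sw : \int[lam]_z (window r (x, z) * 1) = r *+ 2.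
  by rewrite /Rintegral; under eq_integral do rewrite mulr1; rewrite integral_window.
(* This integrates [0 <= (a z - m) ^+ 2] over the window. With [m] the mean of [a], the left side
   times [r *+ 2] is exactly [S ^+ 2]. *)
have le1 : (((2 * m) * S - m ^+ 2 * (r *+ 2))%:E <=
    \int[lam]_z (window r (x, z) * a z ^+ 2)%:E)%E.
  rewrite -Sw /S -RintegralZl// -[in X in _ - X]RintegralZl// -RintegralB//; last 2 first.
  - exact: RintZl.
  - exact: RintZl.
  apply: Rint_le_integral.
  - apply: (eq_integrable measurableT (fun z => ((2 * m * (window r (x, z) * a z))%:E - (m ^+ 2 * (window r (x, z) * 1))%:E)%E)) => //.
    by apply: integrableB => //; exact: RintZl.
  - apply/measurable_EFinP; apply: measurable_funM; first exact: measurable_window1.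
    exact: measurable_funX.
  - by move=> z; rewrite lee_fin mulr_ge0 ?window_ge0 ?sqr_ge0.
  - move=> z; rewrite lee_fin -subr_ge0.
    rewrite (_ : _ - _ = window r (x, z) * (a z - m) ^+ 2); last by ring.
    by rewrite mulr_ge0 ?window_ge0 ?sqr_ge0.
have -> : (S ^+ 2)%:E = ((r *+ 2)%:E * ((2 * m) * S - m ^+ 2 * (r *+ 2))%:E)%E.
  by rewrite -EFinM; congr _%:E; rewrite /m; field; lra.
by rewrite lee_wpmul2l// lee_fin ltW.
Qed.

(** One factor [r *+ 2] comes from Jensen's inequality, applied to real and imaginary parts, the
    other from the mass of the window in [x] after the integrals are exchanged. *)
Lemma integral_window_avg_le r (u : X -> R[i]) (C : R) : 0 < r -> cmfun u ->
  (forall z, normc (u z) <= C) ->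
  (\int[lam]_x (normc (cint lam (fun z => (window r (x, z))%:C * u z)) ^+ 2)%:E <=
   ((r *+ 2) ^+ 2)%:E * \int[lam]_z (normc (u z) ^+ 2)%:E)%E.
Proof.
move=> r0 mu_ uC; have [m1 m2] := mu_.
have r20 : 0 <= r *+ 2 by rewrite pmulrn_lge0// ltW.
have mW : cmfun (fun p : X * X => (window r p)%:C * u p.2).
  apply: cmfunM; first by apply: cmfunC; exact: measurable_window.
  by apply: (cmfun_comp mu_).
have mu2 := cmfun_normc2 mu_.
have mWu : measurable_fun setT (fun p : X * X => (window r p * normc (u p.2) ^+ 2)%:E).
  apply/measurable_EFinP; apply: measurable_funM; first exact: measurable_window.
  exact: (measurableT_comp mu2).
have Wu0 p : (0 <= (window r p * normc (u p.2) ^+ 2)%:E)%E.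
  by rewrite lee_fin mulr_ge0 ?window_ge0 ?sqr_ge0.
have mInner : measurable_fun setT (fun x => \int[lam]_z (window r (x, z) * normc (u z) ^+ 2)%:E)%E.
  exact: (measurable_fun_fubini_tonelli_F (fun p : X * X => (window r p * normc (u p.2) ^+ 2)%:E)).
apply: (@le_trans _ _ (\int[lam]_x ((r *+ 2)%:E * \int[lam]_z (window r (x, z) * normc (u z) ^+ 2)%:E))%E).
  apply: ge0_le_integral => //.
  - by move=> x _; rewrite lee_fin sqr_ge0.
  - apply/measurable_EFinP; apply: cmfun_normc2.
    exact: (cmfun_cint lam mW).
  - exact: emeasurable_funM.
  move=> x _; rewrite normc2 /= EFinD.
  have -> : (\int[lam]_z (window r (x, z) * normc (u z) ^+ 2)%:E =
     \int[lam]_z (window r (x, z) * cRe (u z) ^+ 2)%:E + \int[lam]_z (window r (x, z) * cIm (u z) ^+ 2)%:E)%E.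
    rewrite -ge0_integralD//.
    - by apply: eq_integral => z _; rewrite -EFinD normc2 mulrDr.
    - by move=> z _; rewrite lee_fin mulr_ge0 ?window_ge0 ?sqr_ge0.
    - apply/measurable_EFinP; apply: measurable_funM; first exact: measurable_window1.
      exact: measurable_funX.
    - by move=> z _; rewrite lee_fin mulr_ge0 ?window_ge0 ?sqr_ge0.
    - apply/measurable_EFinP; apply: measurable_funM; first exact: measurable_window1.
      exact: measurable_funX.
  rewrite ge0_muleDr; try by apply: integral_ge0 => z _; rewrite lee_fin mulr_ge0 ?window_ge0 ?sqr_ge0.
  apply: leeD.
    under eq_Rintegral do rewrite cRe_Cmul.
    apply: (@Rint_window_sqr_le r x _ C) => // z.
    exact: le_trans (Re_le _) (uC z).
  under eq_Rintegral do rewrite cIm_Cmul.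
  apply: (@Rint_window_sqr_le r x _ C) => // z.
  exact: le_trans (Im_le _) (uC z).
rewrite ge0_integralZl//; last by move=> x _; exact: integral_ge0.
rewrite expr2 EFinM -muleA lee_wpmul2l ?lee_fin//.
rewrite (fubini_tonelli (fun p : X * X => (window r p * normc (u p.2) ^+ 2)%:E))//=.
rewrite -ge0_integralZl//; last 2 first.
- exact/measurable_EFinP.
- by move=> z _; rewrite lee_fin sqr_ge0.
rewrite le_eqVlt; apply/orP; left; apply/eqP; apply: eq_integral => z _.
under eq_integral do rewrite EFinM window_sym.
rewrite ge0_integralZr//.
- by rewrite integral_window.
- by apply/measurable_EFinP; exact: measurable_window1.
- by move=> x _; rewrite lee_fin window_ge0.
- by rewrite lee_fin sqr_ge0.
Qed.

End fourier1_lower.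

Section fourier1_isometry.
Context {R : realType}.
Notation X := (measurableTypeR R).
Notation lam := (@lebesgue_measure R).
Notation FT1 := (FT lam (@phase1 R)).
Notation AT1 := (AT lam (@phase1 R)).

Lemma cint_C d (T : measurableType d) (mu : {measure set T -> \bar R}) (f : T -> R) :
  cint mu (fun x => (f x)%:C) = (\int[mu]_x f x)%:C.
Proof.
rewrite /cint /=; congr (_ +i* _).
by rewrite /Rintegral integral0.
Qed.

(** The integral of [poisson e (z - y)] over [z] in [[x - r, x + r]]: a smoothed multiple of the
    indicator of the window, bounded uniformly in [e] as dominated convergence requires. *)
Definition window_poisson (e r x y : R) :=
  2 * (atan ((x + r - y) / e) - atan ((x - r - y) / e)).

Lemma integral_window_poisson e r x y : 0 < e -> 0 < r ->
  \int[lam]_z (window r (x, z) * poisson e (z - y)) = window_poisson e r x y.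
Proof.
move=> e0 r0; rewrite /window_poisson -[RHS]/(fine (_%:E)).
rewrite -integral_poisson_itv//; last by lra.
rewrite /Rintegral [in RHS]integral_mkcond; congr fine; apply: eq_integral => z _.
rewrite windowE patchE indicE; case: ifPn => _; by rewrite ?mul1r ?mul0r.
Qed.

Lemma measurable_window_poisson e r x : measurable_fun setT (window_poisson e r x : X -> R).
Proof.
have matan : measurable_fun setT (@atan R : X -> R).
  by apply: continuous_measurable_fun => z; exact: continuous_atan.
apply: measurable_funM => //; apply: measurable_funB; apply: (measurableT_comp matan);
  by apply: measurable_funM => //; exact: measurable_funB.
Qed.

Lemma window_poisson_le e r x y : `|window_poisson e r x y| <= 2 * pi.
Proof.
rewrite /window_poisson normrM ger0_norm// ler_wpM2l//.
have := atan_gtNpi2 ((x + r - y) / e); have := atan_ltpi2 ((x + r - y) / e).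
have := atan_gtNpi2 ((x - r - y) / e); have := atan_ltpi2 ((x - r - y) / e).
by move=> *; rewrite ler_norml; apply/andP; split; lra.
Qed.

Lemma cvg_atan_scale (a : R) : 0 < a -> atan (a / n.+1%:R^-1) @[n --> \oo] --> pi / 2.
Proof.
move=> a0.
have h : a / n.+1%:R^-1 @[n --> \oo] --> +oo.
  apply/cvgryPge => A; near=> n; rewrite invrK mulrC -ler_pdivrMr//.
  apply: (@le_trans _ _ n%:R); last by rewrite ler_nat.
  by near: n; exact: nbhs_infty_ger.
by apply: (cvg_comp (fun n : nat => a / n.+1%:R^-1) (@atan R) h); exact: cvgy_atan.
Unshelve. all: by end_near. Qed.

(** Outside the window both arctangents tend to the same limit and cancel; inside they tend to
    [pi / 2] and [- (pi / 2)]. At an endpoint the limit would be [pi], which is why the endpoints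
    are excluded. *)
Lemma cvg_window_poisson (r x y : R) : 0 < r -> y != x - r -> y != x + r ->
  window_poisson (n.+1%:R^-1) r x y @[n --> \oo] --> 2 * pi * window r (x, y).
Proof.
move=> r0 y1 y2.
have cp (a : R) : 0 < a -> atan (a / n.+1%:R^-1) @[n --> \oo] --> pi / 2 := @cvg_atan_scale a.
have cn (a : R) : a < 0 -> atan (a / n.+1%:R^-1) @[n --> \oo] --> - (pi / 2).
  move=> a0; have na0 : 0 < - a by rewrite oppr_gt0.
  rewrite (_ : (fun n : nat => atan (a / n.+1%:R^-1)) = (fun n => - atan (- a / n.+1%:R^-1))); last first.
    by apply/funext => n; rewrite mulNr atanN opprK.
  by apply: cvgN; exact: cp.
rewrite -mulrA; apply: cvgM; first exact: cvg_cst.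
rewrite /window /= ler_distlC.
have [yl|yl] := ltP y (x - r).
  rewrite /= mulr0 -(subrr (pi / 2)).
  by apply: cvgB; apply: cp; lra.
have {y1}yl' : x - r < y by rewrite lt_neqAle eq_sym y1.
have [yr|yr] := ltP (x + r) y.
  rewrite /= mulr0 -(subrr (- (pi / 2))).
  by apply: cvgB; apply: cn; lra.
have {y2}yr' : y < x + r by rewrite lt_neqAle y2.
rewrite /= mulr1 (_ : pi = pi / 2 - (- (pi / 2))); last by lra.
by apply: cvgB; [apply: cp|apply: cn]; lra.
Qed.

Lemma ae_neq (a : R) : {ae lam, forall y : X, y != a}.
Proof.
exists [set a]; split => //; first exact: lebesgue_measure_set1.
by move=> y /= /negP; rewrite negbK => /eqP.
Qed.

(** Fubini's theorem; as the Poisson kernel is bounded by [2 * e / e ^+ 2], the double integrand is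
    dominated by a product of integrable functions. *)
Lemma cint_window_poisson h e r x : 0 < e -> 0 < r -> cintegrable lam h ->
  cint lam (fun z => (window r (x, z))%:C * cint lam (fun y => (poisson e (z - y))%:C * h y)) =
  cint lam (fun y => (window_poisson e r x y)%:C * h y).
Proof.
move=> e0 r0 hi; have mh := hi.1.
pose K (p : X * X) := (window r (x, p.1))%:C * ((poisson e (p.1 - p.2))%:C * h p.2).
have mw := measurable_window1 r x.
have mp : measurable_fun setT (fun p : X * X => poisson e (p.1 - p.2)).
  by apply: (measurableT_comp (measurable_poisson e0)); exact: measurable_funB.
have mp1 (z : X) : measurable_fun setT (fun y : X => poisson e (z - y)).
  by apply: (measurableT_comp (measurable_poisson e0)); exact: measurable_funB.
have mp2 (y : X) : measurable_fun setT (fun z : X => poisson e (z - y)).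
  by apply: (measurableT_comp (measurable_poisson e0)); exact: measurable_funB.
have mK : cmfun K.
  apply: cmfunM; first by apply: cmfunC; exact: (measurableT_comp mw).
  by apply: cmfunM; [exact: cmfunC|exact: (cmfun_comp mh)].
have px (z : X) : cintegrable lam (fun y => (poisson e (z - y))%:C * h y).
  apply: (@cintegrableM_bnd _ _ _ _ _ _ (2 * e / e ^+ 2)) => //.
    exact: cmfunC.
  by move=> y; rewrite normcC ger0_norm ?poisson_ge0// poisson_le.
have wi (C : R) : 0 <= C -> cintegrable lam (fun z : X => (C * window r (x, z))%:C).
  move=> C0; split; first by apply: cmfunC; exact: measurable_funM.
  under eq_integral do rewrite normcC ger0_norm ?mulr_ge0 ?window_ge0// EFinM.
  rewrite ge0_integralZl ?lee_fin//; last 2 first.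
  - exact/measurable_EFinP.
  - by move=> z _; rewrite lee_fin window_ge0.
  by rewrite integral_window// ltry.
have Koo : (\int[lam]_z \int[lam]_y (normc (K (z, y)))%:E < +oo)%E.
  have C0 : 0 <= 2 * e / e ^+ 2 by rewrite divr_ge0 ?mulr_ge0 ?sqr_ge0// ltW.
  apply: le_lt_trans (tonelli_normcM (wi _ C0) hi).
  have mKn : measurable_fun setT (fun p => (normc (K p))%:E).
    by apply/measurable_EFinP; exact: cmfun_normc.
  apply: ge0_le_integral => //.
  - by move=> z _; apply: integral_ge0 => y _; rewrite lee_fin normc_ge0.
  - by apply: (measurable_fun_fubini_tonelli_F (fun p => (normc (K p))%:E)) => // p; rewrite lee_fin normc_ge0.
  - apply: (measurable_fun_fubini_tonelli_F (fun p : X * X => (normc (2 * e / e ^+ 2 * window r (x, p.1))%:C * normc (h p.2))%:E)).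
      apply/measurable_EFinP; apply: measurable_funM.
        exact: (measurableT_comp (cmfun_normc (wi _ C0).1)).
      exact: (measurableT_comp (cmfun_normc mh)).
    by move=> p; rewrite lee_fin mulr_ge0 ?normc_ge0.
  move=> z _; apply: ge0_le_integral => //.
  - by move=> y _; rewrite lee_fin normc_ge0.
  - exact: (measurableT_comp mKn).
  - by apply/measurable_EFinP; apply: measurable_funM => //; exact: cmfun_normc.
  move=> y _; rewrite lee_fin.
  have -> : K (z, y) = (window r (x, z))%:C * ((poisson e (z - y))%:C * h y) by [].
  rewrite !Normc.normcM mulrA ler_wpM2r ?normc_ge0//.
  rewrite !normcC [leRHS]normrM (ger0_norm C0) mulrC ler_wpM2r//.
  by rewrite ger0_norm ?poisson_ge0// poisson_le.
transitivity (cint lam (fun z => cint lam (fun y => K (z, y)))).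
  by congr cint; apply/funext => z; rewrite /K /= cintZ.
rewrite cint_fubini//; congr cint; apply/funext => y.
rewrite -integral_window_poisson// -cint_C mulrC -cintZ.
  by congr cint; apply/funext => z; rewrite CofRM /K; ring.
split; first by apply: cmfunC; exact: measurable_funM.
have : lam.-integrable setT (fun z => (window r (x, z) * poisson e (z - y))%:E).
  apply: (@integrable_window_mul _ _ _ _ (2 * e / e ^+ 2)) => //.
  by move=> z; rewrite ger0_norm ?poisson_ge0// poisson_le.
move/integrableP => [_]; apply: le_lt_trans.
by rewrite le_eqVlt; apply/orP; left; apply/eqP; apply: eq_integral => z _; rewrite normcC.
Qed.

(** The Poisson means [u n] of [h] are adjoint transforms of the damped [FT1 h], so their norms are
    controlled by [integral_AT1_le] and [expAbs_le1]. Averaging over a fixed window first makes the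
    limit of vanishing damping a matter of dominated convergence, with no pointwise convergence of
    the Poisson means. *)
Lemma integral_window_FT_le h r : 0 < r -> cintegrable lam h ->
  (\int[lam]_x (normc (cint lam (fun y => (2 * pi * window r (x, y))%:C * h y)) ^+ 2)%:E <=
  ((r *+ 2) ^+ 2)%:E * ((2 * pi)%:E * \int[lam]_t (normc (FT1 h t) ^+ 2)%:E))%E.
Proof.
move=> r0 hi; have mh := hi.1; have mF := cmfun_FT lam (@measurable_phase1 R) mh.
pose e n : R := n.+1%:R^-1.
have e0 n : 0 < e n by rewrite invr_gt0.
have mW (w : X * X -> R) : measurable_fun setT w ->
    cmfun (fun x => cint lam (fun y => (w (x, y))%:C * h y)).
  move=> mw; apply: (cmfun_cint lam (h := fun p => (w p)%:C * h p.2)).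
  by apply: cmfunM; [exact: cmfunC|exact: (cmfun_comp mh)].
pose u n z := cint lam (fun y => (poisson (e n) (z - y))%:C * h y).
have uE n : u n = AT1 (fun t => FT1 h t * (expAbs (e n) t)%:C).
  by apply/funext => z; rewrite AT_FT_expAbs.
have ki n := cintegrable_FT_expAbs (e0 n) hi.
have mu_ n : cmfun (u n).
  rewrite uE; apply: cmfun_AT; first exact: measurable_phase1.
  exact: (ki n).1.
apply: (@fatou_le _ _ _ lam (fun n x => (normc (cint lam (fun z => (window r (x, z))%:C * u n z)) ^+ 2)%:E)).
- move=> n; apply/measurable_EFinP; apply: cmfun_normc2.
  apply: (cmfun_cint lam (h := fun p => (window r p)%:C * u n p.2)).
  apply: cmfunM; first by apply: cmfunC; exact: measurable_window.
  exact: (cmfun_comp (mu_ n)).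
- by move=> n x; rewrite lee_fin sqr_ge0.
- apply/measurable_EFinP; apply: cmfun_normc2.
  apply: (mW (fun p => 2 * pi * window r p)).
  by apply: measurable_funM => //; exact: measurable_window.
- by move=> x; rewrite lee_fin sqr_ge0.
- apply: aeW => x; apply: cvg_EFin; first exact: nearW.
  have H : normc (cint lam (fun y => (window_poisson (e n) r x y)%:C * h y)) ^+ 2 @[n --> \oo] -->
      normc (cint lam (fun y => (2 * pi * window r (x, y))%:C * h y)) ^+ 2.
    apply: (cvg_normc2_cint (C := 2 * pi)) => //.
    + by move=> n; exact: measurable_window_poisson.
    + by apply: measurable_funM => //; exact: measurable_window1.
    + by move=> n y; exact: window_poisson_le.
    + have := ae_neq (x - r); have := ae_neq (x + r).
      by apply: filterS2 => y y1 y2; exact: cvg_window_poisson.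
  apply: cvg_trans H; apply: near_eq_cvg; apply: nearW => n.
  by rewrite -(cint_window_poisson _ (e0 n)).
- move=> n.
  have [M kM] := cintegrable_bound (ki n).
  apply: (le_trans (@integral_window_avg_le _ r (u n) (M *+ 2) r0 (mu_ n) _)).
    move=> z; rewrite uE; apply: normc_AT_le => //; first exact: measurable_phase1.
    exact: (ki n).1.
  rewrite lee_wpmul2l ?lee_fin ?sqr_ge0// uE.
  apply: (le_trans (integral_AT1_le (ki n))).
  rewrite lee_wpmul2l ?lee_fin ?mulr_ge0 ?pi_ge0//.
  apply: ge0_le_integral => //.
  - by move=> t _; rewrite lee_fin sqr_ge0.
  - by apply/measurable_EFinP; apply: cmfun_normc2; exact: (ki n).1.
  - by apply/measurable_EFinP; exact: cmfun_normc2.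
  move=> t _; rewrite lee_fin Normc.normcM normcC ger0_norm ?expAbs_ge0// exprMn.
  by rewrite ler_piMr ?sqr_ge0// expr_le1 ?expAbs_ge0// expAbs_le1.
Qed.

Lemma lebesgue_window (f : X -> R) : lam.-integrable setT (EFin \o f) ->
  {ae lam, forall x, (n.+1%:R^-1 *+ 2)^-1 * \int[lam]_z (window n.+1%:R^-1 (x, z) * f z)
     @[n --> \oo] --> f x}.
Proof.
move=> fi.
have lf : locally_integrable setT f by exact: (open_integrable_locally openT fi).
pose r n : R := n.+1%:R^-1.
have r0 n : 0 < r n by rewrite invr_gt0.
pose E (x : R) n : set R := `[x - r n, x + r n]%classic.
have muE x n : lebesgue_measure (E x n) = (r n *+ 2)%:E.
  rewrite /E lebesgue_measure_itv /= lte_fin ifT.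
    by rewrite -EFinB; congr _%:E; rewrite mulr2n; ring.
  by have := r0 n; lra.
have hE x : nicely_shrinking x (E x).
  split; first by move=> n; exact: measurable_itv.
  have p0 n : 0 < 2 * r n by rewrite mulr_gt0.
  (* A closed interval of radius [r n] does not fit in the open ball of that radius; the ball of
     radius [2 * r n] contains it and has twice its measure. *)
  exists (2, fun n => PosNum (p0 n)); split => //=.
  - rewrite -[X in _ --> X](mulr0 2); apply: cvgM; first exact: cvg_cst.
    exact: cvg_harmonic.
  - move=> n z; rewrite /E /= in_itv /= -ler_distlC /ball /= => zr.
    by apply: le_lt_trans zr _; have := r0 n; lra.
  - move=> n; have -> : lam (ball x (2 * r n)) = (2 * r n *+ 2)%:E by apply: lebesgue_measure_ball; exact: ltW.
    have -> : lam (E x n) = (r n *+ 2)%:E by exact: muE.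
    by rewrite -EFinM lee_fin !mulr2n; lra.
have [N [mN N0 NS]] := lebesgue_differentiation lf.
exists N; split=> //; apply: subset_trans NS => x /= + lx; apply.
have := nice_lebesgue_differentiation hE lf lx.
move/fine_cvgP => [_]; apply: cvg_trans; apply: near_eq_cvg; apply: nearW => n /=.
rewrite muE inver ifF; last by rewrite gt_eqF// pmulrn_lgt0.
have wi : lam.-integrable setT (fun z => (window (r n) (x, z) * f z)%:E).
  have mf : measurable_fun setT f by apply/measurable_EFinP; exact: (measurable_int _ fi).
  apply: le_integrable fi => //.
    by apply/measurable_EFinP; apply: measurable_funM => //; exact: measurable_window1.
  move=> z _; rewrite /= normrM (ger0_norm (window_ge0 _ _)) lee_fin ler_piMl ?window_le1//.
rewrite [X in (_ * X)%E](_ : _ = (\int[lam]_z (window (r n) (x, z) * f z))%:E) //.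
rewrite Rint_EFin// [LHS]integral_mkcond; apply: eq_integral => z _.
by rewrite windowE patchE indicE /E; case: ifPn => _; rewrite ?mul1r ?mul0r.
Qed.

(** The second limit, [r] to 0. Divided by [(r *+ 2) ^+ 2], the window integrals tend to
    [(2 * pi) ^+ 2 * |h x|^2] wherever both parts of [h] are differentiated by their means; Fatou's
    lemma applies and one factor [2 * pi] cancels. *)
Lemma integral_FT1_ge h : cintegrable lam h ->
  ((2 * pi)%:E * \int[lam]_x (normc (h x) ^+ 2)%:E <= \int[lam]_t (normc (FT1 h t) ^+ 2)%:E)%E.
Proof.
move=> hi; have mh := hi.1.
pose r n : R := n.+1%:R^-1.
have r0 n : 0 < r n by rewrite invr_gt0.
have p0 : 0 < 2 * pi :> R by rewrite mulr_gt0// pi_gt0.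
have mh2 : measurable_fun setT (fun x => (normc (h x) ^+ 2)%:E).
  by apply/measurable_EFinP; exact: cmfun_normc2.
pose v n x := normc (cint lam (fun y => (2 * pi * window (r n) (x, y))%:C * h y)) ^+ 2.
have mv n : measurable_fun setT (v n).
  apply: cmfun_normc2.
  apply: (cmfun_cint lam (h := fun p => (2 * pi * window (r n) p)%:C * h p.2)).
  apply: cmfunM; last exact: (cmfun_comp mh).
  by apply: cmfunC; apply: measurable_funM => //; exact: measurable_window.
have : (\int[lam]_x ((2 * pi) ^+ 2 * normc (h x) ^+ 2)%:E <=
    (2 * pi)%:E * \int[lam]_t (normc (FT1 h t) ^+ 2)%:E)%E.
  apply: (@fatou_le _ _ _ lam (fun n x => (((r n *+ 2) ^+ 2)^-1 * v n x)%:E)).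
  - by move=> n; apply/measurable_EFinP; exact: measurable_funM.
  - by move=> n x; rewrite lee_fin mulr_ge0 ?invr_ge0 ?sqr_ge0.
  - by apply/measurable_EFinP; apply: measurable_funM => //; exact: cmfun_normc2.
  - by move=> x; rewrite lee_fin mulr_ge0 ?sqr_ge0.
  - have := lebesgue_window (cintegrable_Re hi); have := lebesgue_window (cintegrable_Im hi).
    apply: filterS2 => x xI xR; apply: cvg_EFin; first exact: nearW.
    rewrite normc2 !expr2.
    have H : (2 * pi) * (2 * pi) *
       (((r n *+ 2)^-1 * \int[lam]_z (window (r n) (x, z) * cRe (h z))) *
        ((r n *+ 2)^-1 * \int[lam]_z (window (r n) (x, z) * cRe (h z))) +
        ((r n *+ 2)^-1 * \int[lam]_z (window (r n) (x, z) * cIm (h z))) *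
        ((r n *+ 2)^-1 * \int[lam]_z (window (r n) (x, z) * cIm (h z)))) @[n --> \oo] -->
        (2 * pi) * (2 * pi) * (cRe (h x) * cRe (h x) + cIm (h x) * cIm (h x)).
      by apply: cvgM; [exact: cvg_cst|apply: cvgD; exact: cvgM].
    apply: cvg_trans H; apply: near_eq_cvg; apply: nearW => n.
    rewrite -[RHS]/((r n *+ 2) ^- 2 * v n x) /v normc2 /cint.
    have wi (f : X -> R) : lam.-integrable setT (EFin \o f) ->
        \int[lam]_y (2 * pi * window (r n) (x, y) * f y) =
        2 * pi * \int[lam]_y (window (r n) (x, y) * f y).
      move=> fi; rewrite -RintegralZl//.
        by apply: eq_Rintegral => y _; rewrite mulrA.
      have mf : measurable_fun setT f by apply/measurable_EFinP; exact: (measurable_int _ fi).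
      apply: le_integrable fi => //.
        by apply/measurable_EFinP; apply: measurable_funM => //; exact: measurable_window1.
      move=> z _; rewrite /= normrM (ger0_norm (window_ge0 _ _)) lee_fin ler_piMl ?window_le1//.
    have -> : \int[lam]_y cRe ((2 * pi * window (r n) (x, y))%:C * h y) =
        2 * pi * \int[lam]_y (window (r n) (x, y) * cRe (h y)).
      rewrite -wi; last exact: cintegrable_Re.
      by apply: eq_Rintegral => y _; rewrite cRe_Cmul.
    have -> : \int[lam]_y cIm ((2 * pi * window (r n) (x, y))%:C * h y) =
        2 * pi * \int[lam]_y (window (r n) (x, y) * cIm (h y)).
      rewrite -wi; last exact: cintegrable_Im.
      by apply: eq_Rintegral => y _; rewrite cIm_Cmul.
    rewrite [cRe _]/= [cIm _]/= -exprVn !expr2; ring.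
  - move=> n.
    have q0 : 0 < (r n *+ 2) ^+ 2 by rewrite exprn_gt0// pmulrn_lgt0.
    have -> : (\int[lam]_x (((r n *+ 2) ^+ 2)^-1 * v n x)%:E =
        (((r n *+ 2) ^+ 2)^-1)%:E * \int[lam]_x (v n x)%:E)%E.
      rewrite -(@ge0_integralZl _ _ _ lam setT measurableT (fun x => (v n x)%:E)) ?lee_fin ?invr_ge0 ?(ltW q0)//.
      - exact/measurable_EFinP.
      - by move=> x _; rewrite lee_fin sqr_ge0.
    rewrite lee_pdivrMl//.
    exact: (integral_window_FT_le (r0 n) hi).
under eq_integral do rewrite EFinM.
rewrite ge0_integralZl//; last 2 first.
- by move=> x _; rewrite lee_fin sqr_ge0.
- by rewrite lee_fin sqr_ge0.
by rewrite expr2 EFinM -muleA lee_pmul2l// lte_fin.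
Qed.

(** Both sides may be infinite. This generality is what the induction on the dimension uses, as its
    slices are only known to be integrable. *)
Lemma plancherel1 h : cintegrable lam h ->
  (\int[lam]_t (normc (FT1 h t) ^+ 2)%:E = (2 * pi)%:E * \int[lam]_x (normc (h x) ^+ 2)%:E)%E.
Proof.
by move=> hi; apply/eqP; rewrite eq_le integral_FT1_le//= integral_FT1_ge.
Qed.

End fourier1_isometry.

(** * Plancherel's theorem in dimension [d] *)

Section ae_cint.
Context {d} {T : measurableType d} {R : realType}.
Variable mu : {measure set T -> \bar R}.

Lemma ae_eq_cint (f g : T -> R[i]) : cmfun f -> cmfun g ->
  {ae mu, forall x, f x = g x} -> cint mu f = cint mu g.
Proof.
move=> [f1 f2] [g1 g2] fg; rewrite /cint /Rintegral; congr (fine _ +i* fine _);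
  apply: ae_eq_integral => //; try exact/measurable_EFinP.
- by move: fg; apply: filterS => x -> _.
- by move: fg; apply: filterS => x -> _.
Qed.

End ae_cint.

Section plancherel.
Context {R : realType}.
Notation X := (measurableTypeR R).
Notation lam := (@lebesgue_measure R).
Notation vec n := (n.-tuple X).
Notation pow n := (power_measure lam n).

Definition phase n (p : vec n * vec n) : R := dot p.1 p.2.

Lemma measurable_phase n : measurable_fun setT (@phase n).
Proof.
rewrite /phase /dot; apply: measurable_sum => j; apply: measurable_funM.
  by apply: (measurableT_comp (measurable_tnth j)).
by apply: (measurableT_comp (measurable_tnth j)).
Qed.

Lemma dot_cons n (p q : X * vec n) :
  dot (tuple_cons p) (tuple_cons q) = p.1 * q.1 + dot p.2 q.2 :> R.
Proof.
rewrite /dot big_ord_recl !tnth_cons0; congr (_ + _).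
by apply: eq_bigr => j _; rewrite !tnth_consS.
Qed.

(** Fubini with the first coordinate innermost. Its slices are integrable only for almost every tail
    [x], so the factor [cis (- dot t x)] is pulled out of the inner integral almost everywhere. *)
Lemma FT_cons n (h : vec n.+1 -> R[i]) (t0 : X) (t : vec n) : cintegrable (pow n.+1) h ->
  FT (pow n.+1) (@phase n.+1) h (tuple_cons (t0, t)) =
  FT (pow n) (@phase n) (fun x => FT lam (@phase1 R) (fun x0 => h (tuple_cons (x0, x))) t0) t.
Proof.
move=> hi; have mh := hi.1.
pose H (p : X * vec n) := cis (- (t0 * p.1 + dot t p.2)) * h (tuple_cons p).
have hci := cintegrable_cons hi; have mhc := cmfun_cons mh.
have mt : measurable_fun setT (fun x : vec n => dot t x).
  exact: (measurable_th1 (@measurable_phase n) t).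
have mH : cmfun H.
  apply: cmfunM => //; apply: cmfun_cis; apply: measurable_funN; apply: measurable_funD.
    exact: measurable_funM.
  exact: (measurableT_comp mt).
have Hoo : (\int[lam]_x0 \int[pow n]_x (normc (H (x0, x)))%:E < +oo)%E.
  apply: le_lt_trans hci; rewrite le_eqVlt; apply/orP; left; apply/eqP.
  by apply: eq_integral => x0 _; apply: eq_integral => x _; rewrite /H normc_cisM.
rewrite /FT cint_cons; last first.
  apply: cintegrable_cis => //; apply: measurable_funN.
  exact: (measurable_th1 (@measurable_phase n.+1)).
transitivity (cint (lam \x pow n)%E H).
  by congr cint; apply/funext => p; rewrite /H /phase dot_cons.
rewrite cint_prod// cint_fubini//.
apply: ae_eq_cint.
- by apply: (cmfun_cint lam (h := fun p : vec n * X => H (p.2, p.1))); exact: cmfun_swap.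
- apply: cmfunM.
    by apply: cmfun_cis; apply: measurable_funN; exact: (measurable_th1 (@measurable_phase n)).
  apply: (cmfun_cint lam (h := fun p : vec n * X => cis (- (@phase1 R) (t0, p.2)) * h (tuple_cons (p.2, p.1)))).
  apply: cmfunM; last exact: (cmfun_swap mhc).
  apply: cmfun_cis; apply: measurable_funN.
  by rewrite /phase1 /=; exact: measurable_funM.
have := ae_cintegrable2 mhc hci; apply: filterS => x hx.
rewrite -cintZ.
  by congr cint; apply/funext => x0; rewrite /H opprD cisD -mulrA mulrCA.
apply: cintegrable_cis => //; apply: measurable_funN; exact: (measurable_th1 (@measurable_phase1 R)).
Qed.

(** The induction hypothesis acts for every first frequency [t0] on the partial transform [G t0],
    which is always integrable in the tail; the one-dimensional identity acts for almost every tail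
    [x]. Tonelli exchanges [t0] and [x] between the two uses. *)
Theorem plancherel_isometry n (h : vec n -> R[i]) : cintegrable (pow n) h ->
  (\int[pow n]_t (normc (FT (pow n) (@phase n) h t) ^+ 2)%:E =
   ((2 * pi) ^+ n)%:E * \int[pow n]_x (normc (h x) ^+ 2)%:E)%E.
Proof.
elim: n h => [|n IH] h hi.
  have mh := hi.1; have mF := cmfun_FT (pow 0) (@measurable_phase 0) mh.
  rewrite !integral_dirac//; last 2 first.
  - by apply/measurable_EFinP; exact: cmfun_normc2.
  - by apply/measurable_EFinP; exact: cmfun_normc2.
  rewrite !diracT !mul1e; congr ((normc _ ^+ 2)%:E).
  have ph0 x : (@phase 0) ([tuple], x) = 0 by rewrite /phase /dot big_ord0.
  rewrite /FT; under [X in cint _ X]funext do rewrite ph0 oppr0 cis0 mul1r.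
  case: mh => h1 h2; apply: complex_ext => /=; rewrite /Rintegral integral_dirac ?diracT ?mul1e//;
    exact/measurable_EFinP.
have mh := hi.1; have mF := cmfun_FT (pow n.+1) (@measurable_phase n.+1) mh.
have hci := cintegrable_cons hi; have mhc := cmfun_cons mh.
rewrite (@ge0_integral_cons _ _ _ lam n (fun t => (normc (FT (pow n.+1) (@phase n.+1) h t) ^+ 2)%:E)); last 2 first.
- by apply/measurable_EFinP; exact: cmfun_normc2.
- by move=> t; rewrite lee_fin sqr_ge0.
rewrite (@ge0_integral_cons _ _ _ lam n (fun x => (normc (h x) ^+ 2)%:E)); last 2 first.
- by apply/measurable_EFinP; exact: cmfun_normc2.
- by move=> t; rewrite lee_fin sqr_ge0.
pose G (t0 : X) (x : vec n) := FT lam (@phase1 R) (fun x0 => h (tuple_cons (x0, x))) t0.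
have mG : cmfun (fun p : X * vec n => G p.1 p.2).
  apply: (cmfun_cint lam (h := fun p : (X * vec n) * X => cis (- (p.1.1 * p.2)) * h (tuple_cons (p.2, p.1.2)))).
  apply: cmfunM.
    apply: cmfun_cis; apply: measurable_funN; apply: measurable_funM => //.
    by apply: (measurableT_comp measurable_fst).
  apply: (cmfun_comp mhc); apply: measurable_fun_pair => //.
  by apply: (measurableT_comp measurable_snd).
have Gi t0 : cintegrable (pow n) (G t0).
  apply: (cintegrable_cint (m1 := pow n) (m2 := lam) (h := fun p : vec n * X => cis (- (t0 * p.2)) * h (tuple_cons (p.2, p.1)))).
    apply: cmfunM; last exact: (cmfun_swap mhc).
    by apply: cmfun_cis; apply: measurable_funN; exact: measurable_funM.
  rewrite -(fubini_tonelli (fun p : X * vec n => (normc (cis (- (t0 * p.1)) * h (tuple_cons p)))%:E)).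
  - apply: le_lt_trans hci; rewrite le_eqVlt; apply/orP; left; apply/eqP.
    by apply: eq_integral => x0 _; apply: eq_integral => x _; rewrite normc_cisM.
  - apply/measurable_EFinP; apply: cmfun_normc; apply: cmfunM => //.
    by apply: cmfun_cis; apply: measurable_funN; exact: measurable_funM.
  - by move=> p; rewrite lee_fin normc_ge0.
have mG2 : measurable_fun setT (fun p : X * vec n => (normc (G p.1 p.2) ^+ 2)%:E).
  by apply/measurable_EFinP; exact: cmfun_normc2.
have mh2 : measurable_fun setT (fun p : X * vec n => (normc (h (tuple_cons p)) ^+ 2)%:E).
  by apply/measurable_EFinP; exact: cmfun_normc2.
have pin0 : (0 <= ((2 * pi) ^+ n)%:E :> \bar R)%E by rewrite lee_fin exprn_ge0// mulr_ge0// pi_ge0.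
transitivity (\int[lam]_t0 (((2 * pi) ^+ n)%:E * \int[pow n]_x (normc (G t0 x) ^+ 2)%:E))%E.
  apply: eq_integral => t0 _; rewrite -IH//; apply: eq_integral => t _.
  by rewrite FT_cons.
rewrite ge0_integralZl//; last 2 first.
- by apply: (measurable_fun_fubini_tonelli_F (fun p : X * vec n => (normc (G p.1 p.2) ^+ 2)%:E)) => // p; rewrite lee_fin sqr_ge0.
- by move=> t0 _; apply: integral_ge0 => x _; rewrite lee_fin sqr_ge0.
rewrite (fubini_tonelli (fun p : X * vec n => (normc (G p.1 p.2) ^+ 2)%:E))//; last first.
  by move=> p; rewrite lee_fin sqr_ge0.
rewrite [in RHS](fubini_tonelli (fun p : X * vec n => (normc (h (tuple_cons p)) ^+ 2)%:E))//; last first.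
  by move=> p; rewrite lee_fin sqr_ge0.
rewrite exprSr EFinM -muleA; congr (_ * _)%E.
have mint2 : measurable_fun setT (fun y => \int[lam]_x (normc (h (tuple_cons (x, y))) ^+ 2)%:E)%E.
  by apply: (measurable_fun_fubini_tonelli_G (fun p : X * vec n => (normc (h (tuple_cons p)) ^+ 2)%:E)) => // p; rewrite lee_fin sqr_ge0.
rewrite -ge0_integralZl//; last 2 first.
- by move=> y _; apply: integral_ge0 => x _; rewrite lee_fin sqr_ge0.
- by rewrite lee_fin mulr_ge0// pi_ge0.
apply: ge0_ae_eq_integral => //.
- by apply: (measurable_fun_fubini_tonelli_G (fun p : X * vec n => (normc (G p.1 p.2) ^+ 2)%:E)) => // p; rewrite lee_fin sqr_ge0.
- exact: emeasurable_funM.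
- by move=> y _; apply: integral_ge0 => x _; rewrite lee_fin sqr_ge0.
- move=> y _; apply: mule_ge0; first by rewrite lee_fin mulr_ge0// pi_ge0.
  by apply: integral_ge0 => x _; rewrite lee_fin sqr_ge0.
have := ae_cintegrable2 mhc hci; apply: filterS => x hx _.
exact: (plancherel1 hx).
Qed.

End plancherel.

(** * Agreement of the Fourier integral with the extension to square integrable functions *)

Section plancherel_def.
Context {R : realType} {d : nat}.
Notation vec := (d.-tuple (measurableTypeR R)).
Notation leb := (@lebesgue R d).
Notation FTd := (FT leb (@phase R d)).

Lemma in_L1_cintegrable (h : vec -> R[i]) : in_L1 setT weight1 h <-> cintegrable leb h.
Proof.
by rewrite /in_L1 /cintegrable /weight1 /=; under eq_integral do rewrite mulr1.
Qed.

Lemma normsqT (h : vec -> R[i]) :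
  normsq setT weight1 h = (\int[leb]_x (normc (h x) ^+ 2)%:E)%E.
Proof. by rewrite /normsq /weight1 /=; under eq_integral do rewrite mulr1. Qed.

Lemma fourierE (h : vec -> R[i]) t :
  fourier h t = ((2 * pi) `^ (- (d%:R / 2)))%:C * FTd h t.
Proof.
rewrite /fourier /FT; congr (_ * _); rewrite -[cintegral _ _]/(cint leb _).
by congr (cint leb _); apply/funext => x; rewrite cexp_cis.
Qed.

Lemma pi2_gt0 : 0 < 2 * pi :> R. Proof. by rewrite mulr_gt0// pi_gt0. Qed.

Lemma powR_half_sqr (a : R) : 0 < a -> (a `^ (d%:R / 2)) ^+ 2 = a ^+ d.
Proof.
by move=> a0; rewrite -powR_mulrn ?powR_ge0// -powRrM divfK ?pnatr_eq0// powR_mulrn// ltW.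
Qed.

Lemma normsq_fourier (h : vec -> R[i]) : cintegrable leb h ->
  normsq setT weight1 (fourier h) = normsq setT weight1 h.
Proof.
move=> hi; rewrite !normsqT.
under eq_integral do rewrite fourierE Normc.normcM normcC ger0_norm ?powR_ge0// exprMn EFinM.
have mF := cmfun_FT leb (@measurable_phase R d) hi.1.
rewrite ge0_integralZl//; last 3 first.
- by apply/measurable_EFinP; exact: cmfun_normc2.
- by move=> t _; rewrite lee_fin sqr_ge0.
- by rewrite lee_fin sqr_ge0.
rewrite (plancherel_isometry hi) muleA -EFinM powRN exprVn powR_half_sqr ?pi2_gt0//.
by rewrite mulVf ?mul1e// gt_eqF// exprn_gt0// pi2_gt0.
Qed.

Lemma cmfun_fourier (h : vec -> R[i]) : cmfun h -> cmfun (fourier h).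
Proof.
move=> mh; rewrite (_ : fourier h = fun t => ((2 * pi) `^ (- (d%:R / 2)))%:C * FTd h t).
  apply: cmfunM; first exact: cmfun_cst.
  by apply: cmfun_FT => //; exact: measurable_phase.
by apply/funext => t; rewrite fourierE.
Qed.

Lemma fourierB (h k : vec -> R[i]) : cintegrable leb h -> cintegrable leb k ->
  fourier (h \- k) = fourier h \- fourier k.
Proof.
move=> hi ki; apply/funext => t /=; rewrite !fourierE -mulrBr; congr (_ * _).
have mt : measurable_fun setT (fun x : vec => - phase (t, x)).
  by apply: measurable_funN; exact: (measurable_th1 (@measurable_phase R d)).
rewrite /FT -[in RHS]mulN1r -cintZ; last exact: cintegrable_cis.
rewrite -cintD.
- by congr cint; apply/funext => x; rewrite mulrBr mulN1r.
- exact: cintegrable_cis.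
- by apply: cintegrableZ; exact: cintegrable_cis.
Qed.

(** For integrable [u m] and [h] the transform of [u m - h] has the same norm as [u m - h], so the
    required convergence is the assumed one. *)
Lemma is_plancherel_fourier (h : vec -> R[i]) :
  in_L1 setT weight1 h -> in_L2 setT weight1 h -> is_plancherel h (fourier h).
Proof.
move=> /in_L1_cintegrable hi [mh h2]; split.
  by split; [exact: cmfun_fourier|rewrite normsq_fourier].
move=> u uL uh; rewrite (_ : (fun m => _) = fun m => normsq setT weight1 (u m \- h))//.
apply/funext => m; have [/in_L1_cintegrable ui _] := uL m.
rewrite -fourierB// normsq_fourier//.
rewrite (_ : u m \- h = fun x => u m x + (-1) * h x); last first.
  by apply/funext => x /=; rewrite mulN1r.
by apply: cintegrableD => //; exact: cintegrableZ.
Qed.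

(** [fourier h] is a witness, so the choice made by [xget] is not the default value. *)
Lemma plancherelP (h : vec -> R[i]) :
  in_L1 setT weight1 h -> in_L2 setT weight1 h -> is_plancherel h (plancherel h).
Proof.
move=> h1 h2; rewrite /plancherel; case: xgetP => [G _ //|].
by move/(_ (fourier h)) => /=; have := is_plancherel_fourier h1 h2.
Qed.

(** The constant sequence [h] is admissible in [is_plancherel]; the norm of
    [fourier h - plancherel h] is then a constant sequence tending to 0. *)
Lemma plancherel_fourier (h : vec -> R[i]) :
  in_L1 setT weight1 h -> in_L2 setT weight1 h ->
  {ae leb, forall t, plancherel h t = fourier h t}.
Proof.
move=> h1 h2; have [mP pP] := plancherelP h1 h2.
have {pP} := pP (fun=> h) (fun=> conj h1 h2).
have -> : normsq setT weight1 (h \- h) = 0%E.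
  rewrite normsqT; under eq_integral do rewrite /= subrr Normc.normc0 expr0n.
  by rewrite integral0.
move=> /(_ (cvg_cst _)) /(cvg_lim _); rewrite lim_cst// => /(_ (@ereal_hausdorff R)) N0.
have mD : cmfun (fourier h \- plancherel h).
  by apply: cmfunB; [apply: cmfun_fourier; exact: h1.1|exact: mP.1].
have : ae_eq leb setT (fun t => (normc ((fourier h \- plancherel h) t) ^+ 2)%:E) (cst 0%E).
  apply/ae_eq_integral_abs => //; first by apply/measurable_EFinP; exact: cmfun_normc2.
  rewrite -N0 normsqT; apply: eq_integral => t _.
  by rewrite gee0_abs// lee_fin sqr_ge0.
apply: filterS => t /(_ I) /eqP; rewrite eqe sqrf_eq0 => /eqP/Normc.eq0_normc.
by move=> /eqP; rewrite subr_eq0 => /eqP.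
Qed.

End plancherel_def.

(** * The Mellin transform in logarithmic coordinates *)

Section cexp.
Context {R : realType}.

Lemma cexpE (z : R[i]) : cexp z = (expR (cRe z))%:C * cis (cIm z).
Proof. by []. Qed.

Lemma cexpD (z w : R[i]) : cexp (z + w) = cexp z * cexp w.
Proof. by rewrite !cexpE cReD cImD expRD cisD CofRM; ring. Qed.

Lemma cexp0 : cexp 0 = 1 :> R[i].
Proof. by rewrite cexpE /= expR0 cis0 mulr1. Qed.

Lemma cexp_sum (I : Type) (s : seq I) (F : I -> R[i]) :
  \prod_(i <- s) cexp (F i) = cexp (\sum_(i <- s) F i).
Proof. by apply/esym/(big_morph cexp cexpD cexp0). Qed.

Lemma normc_cexp (z : R[i]) : normc (cexp z) = expR (cRe z).
Proof. by rewrite cexpE Normc.normcM normcC normc_cis mulr1 ger0_norm ?expR_ge0. Qed.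

End cexp.

Section orthant.
Context {R : realType} {d : nat}.
Notation X := (measurableTypeR R).
Notation vec := (d.-tuple X).
Notation leb := (@lebesgue R d).

Definition expv (u : vec) : vec := [tuple expR (- tnth u j) | j < d].

Lemma tnth_expv u j : tnth (expv u) j = expR (- tnth u j).
Proof. by rewrite tnth_mktuple. Qed.

Lemma orthant_expv u : orthant (expv u).
Proof. by move=> j; rewrite tnth_expv expR_gt0. Qed.

Lemma measurable_expv : measurable_fun setT expv.
Proof. exact: (@measurable_map_tuple _ X d (fun=> (fun x : X => expR (- x) : X)) (fun=> @measurable_expN R)). Qed.

Lemma prod_posind (x : vec) : \prod_(j < d) posind (tnth x j) = (\1_orthant x : R).
Proof.
rewrite indicE; case: (boolP (x \in orthant)) => [/set_mem ox|/negP nx].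
  by rewrite big1// => j _; rewrite /posind ox.
have [j xj] : exists j, ~~ (0 < tnth x j).
  apply: contrapT => H; apply: nx; apply/mem_set => j.
  by apply: contrapT => /negP xj; apply: H; exists j.
by rewrite (bigD1 j)//= /posind (negbTE xj) mul0r.
Qed.

Lemma measurable_orthant : measurable (orthant : set vec).
Proof.
rewrite (_ : orthant = \bigcap_(j in [set: 'I_d]) ((fun x : vec => tnth x j) @^-1` `]0%R, +oo[%classic)).
  apply: fin_bigcap_measurable => // j _.
  by rewrite -[X in measurable X]setTI; exact: (measurable_tnth j).
apply/seteqP; split => x /=.
  by move=> ox j _ /=; rewrite in_itv /= andbT.
by move=> ox j; have := ox j I; rewrite /= in_itv /= andbT.
Qed.

Lemma restrict_orthantE (G : vec -> \bar R) x :
  ((G \_ orthant) x * (\prod_(j < d) posind (tnth x j))%:E = (G \_ orthant) x)%E.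
Proof.
rewrite prod_posind patchE indicE; case: ifPn => _; by rewrite ?mule1 ?mule0.
Qed.

Lemma measurable_restrict_orthant (G : vec -> \bar R) : measurable_fun orthant G ->
  measurable_fun setT (G \_ orthant).
Proof. by move/(measurable_restrictT _ measurable_orthant). Qed.

Lemma restrict_orthant_ge0 (G : vec -> \bar R) : (forall x, orthant x -> 0 <= G x)%E ->
  forall x, (0 <= (G \_ orthant) x)%E.
Proof. by move=> G0 x; rewrite patchE; case: ifPn => // /set_mem; exact: G0. Qed.

Lemma ge0_integral_expv (G : vec -> \bar R) : measurable_fun orthant G ->
  (forall x, orthant x -> 0 <= G x)%E ->
  (\int[leb]_(x in orthant) G x =
   \int[leb]_u (G (expv u) * (\prod_(j < d) expR (- tnth u j))%:E))%E.
Proof.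
move=> mG G0; rewrite integral_mkcond.
transitivity (\int[leb]_x ((G \_ orthant) x * (\prod_(j < d) posind (tnth x j))%:E))%E.
  by apply: eq_integral => x _; rewrite restrict_orthantE.
rewrite (@ge0_power_substitution _ _ _ (@lebesgue_measure R) d (fun=> fun x => expR (- x))
   (fun=> posind) (fun=> fun x => expR (- x))).
- by apply: eq_integral => u _; rewrite patchE mem_set//; exact: orthant_expv.
- by move=> j; exact: measurable_expN.
- by move=> j; exact: measurable_posind.
- by move=> j x; exact: posind_ge0.
- by move=> j; exact: measurable_expN.
- by move=> j x; exact: expR_ge0.
- by move=> j H mH H0; exact: ge0_exp_substitution.
- exact: measurable_restrict_orthant.
- exact: restrict_orthant_ge0.
Qed.

Lemma orthant_divv (y x : vec) : orthant x -> orthant (divv y x) <-> orthant y.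
Proof.
move=> ox; split => oy j; have := oy j; have xj := ox j.
  by rewrite tnth_mktuple pmulr_lgt0// invr_gt0.
by rewrite tnth_mktuple pmulr_lgt0// invr_gt0.
Qed.

Lemma ge0_integral_divv (x : vec) (G : vec -> \bar R) : orthant x -> measurable_fun orthant G ->
  (forall u, orthant u -> 0 <= G u)%E ->
  (\int[leb]_(u in orthant) G u =
   \int[leb]_(y in orthant) (G (divv y x) * (\prod_(j < d) (tnth x j)^-1)%:E))%E.
Proof.
move=> ox mG G0; rewrite integral_mkcond.
transitivity (\int[leb]_x ((G \_ orthant) x * (\prod_(j < d) posind (tnth x j))%:E))%E.
  by apply: eq_integral => u _; rewrite restrict_orthantE.
rewrite (@ge0_power_substitution _ _ _ (@lebesgue_measure R) d (fun j => fun y => y / tnth x j)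
   (fun=> posind) (fun j => fun y => posind y * (tnth x j)^-1)).
- rewrite [RHS]integral_mkcond; apply: eq_integral => y _.
  rewrite -/(divv y x) big_split /= prod_posind !patchE indicE.
  have -> : (divv y x \in orthant) = (y \in orthant).
    by apply/idP/idP => /set_mem /(orthant_divv _ ox) oy; exact/mem_set.
  by case: ifPn => _; rewrite ?mul1r// mul0e.
- by move=> j; exact: measurable_funM.
- by move=> j; exact: measurable_posind.
- by move=> j z; exact: posind_ge0.
- by move=> j; apply: measurable_funM => //; exact: measurable_posind.
- by move=> j z; rewrite mulr_ge0 ?posind_ge0// invr_ge0 ltW.
- by move=> j H mH H0; exact: ge0_scale_substitution.
- exact: measurable_restrict_orthant.
- exact: restrict_orthant_ge0.
Qed.

Lemma measurable_comp_expv d' (T : measurableType d') (f : vec -> T) :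
  measurable_fun orthant f -> measurable_fun setT (fun u => f (expv u)).
Proof.
move=> mf; apply: (measurable_comp (F := orthant)) => //.
- exact: measurable_orthant.
- by move=> _ [u _ <-]; exact: orthant_expv.
- exact: measurable_expv.
Qed.

Lemma expR_sum_prod (a : 'I_d -> R) : \prod_(j < d) expR (a j) = expR (\sum_(j < d) a j).
Proof. by rewrite expR_sum. Qed.

(** Holds without integrability, since the substitution applies to the positive and the negative
    part separately and default values agree. *)
Lemma Rint_expv (f : vec -> R) : measurable_fun orthant f ->
  \int[leb]_(x in orthant) f x =
  \int[leb]_u (f (expv u) * \prod_(j < d) expR (- tnth u j)).
Proof.
move=> mf; rewrite /Rintegral; congr fine.
have w0 (u : vec) : 0 <= \prod_(j < d) expR (- tnth u j) by apply: prodr_ge0 => j _; exact: expR_ge0.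
have mE : measurable_fun orthant (EFin \o f) by exact/measurable_EFinP.
rewrite integralE [RHS]integralE; congr (_ - _)%E.
  rewrite ge0_integral_expv//; last exact: measurable_funepos.
  apply: eq_integral => u _; rewrite !funeposE EFinM.
  by rewrite muleC maxe_pMr ?lee_fin// mule0 muleC.
rewrite ge0_integral_expv//; last exact: measurable_funeneg.
apply: eq_integral => u _; rewrite !funenegE EFinM.
by rewrite muleC maxe_pMr ?lee_fin// mule0 muleN muleC.
Qed.

Lemma cvpow_expv (u : vec) (w : 'I_d -> R[i]) :
  cvpow (expv u) w = cexp (\sum_(j < d) w j * (- tnth u j)%:C).
Proof.
rewrite /cvpow cexp_sum; congr cexp; apply: eq_bigr => j _.
by rewrite tnth_expv expRK.
Qed.

Lemma vpow_expv (u : vec) (w : 'I_d -> R) :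
  vpow (expv u) w = expR (\sum_(j < d) w j * (- tnth u j)).
Proof.
rewrite /vpow expR_sum; apply: eq_bigr => j _.
by rewrite tnth_expv /powR gt_eqF ?expR_gt0// expRK.
Qed.

Lemma cRe_sum (I : Type) (s : seq I) (F : I -> R[i]) :
  cRe (\sum_(i <- s) F i) = \sum_(i <- s) cRe (F i).
Proof. by apply: (big_morph (@complex.Re R) cReD). Qed.

Lemma cIm_sum (I : Type) (s : seq I) (F : I -> R[i]) :
  cIm (\sum_(i <- s) F i) = \sum_(i <- s) cIm (F i).
Proof. by apply: (big_morph (@complex.Im R) cImD). Qed.

Lemma cvpow_expv_cis (u t : vec) (a : 'I_d -> R) :
  cvpow (expv u) (fun j => a j +i* tnth t j) =
  (expR (\sum_(j < d) a j * (- tnth u j)))%:C * cis (- dot t u).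
Proof.
rewrite cvpow_expv cexpE cRe_sum cIm_sum; congr ((expR _)%:C * cis _).
  by apply: eq_bigr => j _; rewrite cReM /= mulr0 subr0.
rewrite /dot -sumrN; apply: eq_bigr => j _.
by rewrite cImM /= mulr0 add0r mulrN.
Qed.

Lemma cmfun_Phi (c : vec) (h : vec -> R[i]) : cmeasurable orthant h -> cmfun (Phi c h).
Proof.
move=> [h1 h2]; apply: cmfunM; last first.
  by split; [exact: (measurable_comp_expv h1)|exact: (measurable_comp_expv h2)].
apply: cmfunC; apply: measurableT_comp => //; apply: measurable_funN.
exact: (measurable_th1 (@measurable_phase R d) c).
Qed.

Lemma normc_Phi (c : vec) (h : vec -> R[i]) u :
  normc (Phi c h u) = expR (- dot c u) * normc (h (expv u)).
Proof. by rewrite /Phi Normc.normcM normcC ger0_norm ?expR_ge0. Qed.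

Lemma cmfun_cvpow d' (T : measurableType d') (v : T -> vec) (a b : 'I_d -> T -> R) :
  measurable_fun setT v -> (forall j, measurable_fun setT (a j)) ->
  (forall j, measurable_fun setT (b j)) ->
  cmfun (fun p => cvpow (v p) (fun j => a j p +i* b j p)).
Proof.
move=> mv ma mb; apply: cmfun_prod => j.
have ml : measurable_fun setT (fun p => ln (tnth (v p) j)).
  apply: (measurableT_comp (@measurable_ln R)).
  exact: (measurableT_comp (measurable_tnth j) mv).
apply: cmfunM.
  apply: cmfunC; apply: (measurableT_comp (@measurable_expR R)).
  by under eq_fun do rewrite cReM /= mulr0 subr0; exact: measurable_funM.
apply: cmfun_cis.
by under eq_fun do rewrite cImM /= mulr0 add0r; exact: measurable_funM.
Qed.

Lemma cmeasurable_setT (D : set vec) (h : vec -> R[i]) : cmfun h -> cmeasurable D h.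
Proof. by move=> [h1 h2]; split; exact: measurable_funS _ _ h1 || exact: measurable_funS _ _ h2. Qed.

Lemma cmeasurable_cvpow (t : vec) (a : 'I_d -> R) :
  cmeasurable orthant (fun x => cvpow x (fun j => a j +i* tnth t j)).
Proof.
apply: cmeasurable_setT.
by apply: (@cmfun_cvpow _ vec id (fun j => cst (a j)) (fun j => cst (tnth t j))).
Qed.

End orthant.

Section mellin_log.
Context {R : realType} {d : nat}.
Notation X := (measurableTypeR R).
Notation vec := (d.-tuple X).
Notation leb := (@lebesgue R d).
Notation FTd := (FT leb (@phase R d)).

Lemma cmeasurableM (D : set vec) (h k : vec -> R[i]) :
  cmeasurable D h -> cmeasurable D k -> cmeasurable D (fun x => h x * k x).
Proof.
move=> [h1 h2] [k1 k2]; split.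
  by under eq_fun do rewrite cReM; apply: measurable_funB; apply: measurable_funM.
by under eq_fun do rewrite cImM; apply: measurable_funD; apply: measurable_funM.
Qed.

Lemma measurable_vpow (w : 'I_d -> R) : measurable_fun setT (fun x : vec => vpow x w).
Proof.
by apply: (@measurable_prod_tnth _ X R d (fun j x => x `^ w j)) => j; exact: measurable_powR.
Qed.

Lemma measurable_prod_expN :
  measurable_fun setT (fun u : vec => \prod_(j < d) expR (- tnth u j)).
Proof.
by apply: (@measurable_prod_tnth _ X R d (fun j x => expR (- x))) => j; exact: measurable_expN.
Qed.

(** The Jacobian of [x = exp(-u)] raises the exponent [c - 1] to [c], which is the factor
    [expR (- dot c u)] in [Phi]. Only measurability of [h] is needed. *)
Lemma mellinE (c : vec) (h : vec -> R[i]) t : cmeasurable orthant h ->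
  mellin c h t = FTd (Phi c h) t.
Proof.
move=> mh; have := cmeasurableM (cmeasurable_cvpow t (fun j => tnth c j - 1)) mh.
set K := (fun x => _ * h x) => -[K1 K2].
have KE u : K (expv u) * (\prod_(j < d) expR (- tnth u j))%:C = cis (- dot t u) * Phi c h u.
  rewrite /K cvpow_expv_cis expR_sum_prod /Phi.
  have -> : expR (- dot c u) = expR (\sum_(j < d) (tnth c j - 1) * - tnth u j) *
      expR (\sum_(j < d) - tnth u j).
    rewrite -expRD -big_split /= /dot -sumrN; congr expR; apply: eq_bigr => j _; ring.
  by rewrite CofRM /expv; ring.
rewrite /mellin /cintegral /FT /cint -/K; congr (_ +i* _).
  rewrite Rint_expv//; apply: eq_Rintegral => u _.
  by rewrite -[phase _]/(dot t u) -KE [RHS]cReM /= mulr0 subr0.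
rewrite Rint_expv//; apply: eq_Rintegral => u _.
by rewrite -[phase _]/(dot t u) -KE [RHS]cImM /= mulr0 add0r.
Qed.

(** The Jacobian raises the exponent [2c - 1] of the weight to [2c], so that the factor becomes
    [expR (- dot c u) ^+ 2]. *)
Lemma normsq_orthant (c : vec) (h : vec -> R[i]) : cmeasurable orthant h ->
  normsq orthant (weight c) h = (\int[leb]_u (normc (Phi c h u) ^+ 2)%:E)%E.
Proof.
move=> [h1 h2]; rewrite /normsq ge0_integral_expv.
- apply: eq_integral => u _; rewrite normc_Phi exprMn -EFinM; congr _%:E.
  rewrite /weight vpow_expv expR_sum_prod mulrAC -mulrA mulrC -expRD; congr (_ * _).
  rewrite expr2 -expRD; congr expR.
  rewrite -big_split /= /dot -opprD -big_split /= -sumrN; apply: eq_bigr => j _; ring.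
- apply/measurable_EFinP; apply: measurable_funM.
    under eq_fun do rewrite normc2.
    by apply: measurable_funD; apply: measurable_funX.
  exact: measurable_funS _ _ (measurable_vpow _).
- move=> x _; rewrite lee_fin mulr_ge0 ?sqr_ge0// /weight /vpow.
  by apply: prodr_ge0 => j _; exact: powR_ge0.
Qed.

Lemma cmeasurable_real (D : set vec) (f : vec -> R) : measurable_fun D f ->
  cmeasurable D (fun x => (f x)%:C).
Proof. by move=> mf; split => //=; exact: measurable_cst. Qed.

(* AM-GM: [x^(c-1) <= (1 + x^(2c-2)) / 2] *)
Lemma cintegrable_Phi (c : vec) (f : vec -> R) : is_density f -> (moment c f < +oo)%E ->
  cintegrable leb (Phi c (fun x => (f x)%:C)).
Proof.
move=> [mf f0 f1] moo; split; first by apply: cmfun_Phi; exact: cmeasurable_real.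
set V := fun x : vec => vpow x (fun j => 2 * tnth c j - 2).
have V0 x : 0 <= V x by apply: prodr_ge0 => j _; exact: powR_ge0.
have mV : measurable_fun orthant V by exact: measurable_funS _ _ (measurable_vpow _).
have mG : measurable_fun orthant (fun x => ((1 + V x) * f x)%:E).
  apply/measurable_EFinP; apply: measurable_funM => //; exact: measurable_funD.
have G0 x : orthant x -> (0 <= ((1 + V x) * f x)%:E)%E.
  by move=> ox; rewrite lee_fin mulr_ge0 ?addr_ge0 ?f0.
apply: (@le_lt_trans _ _ (\int[leb]_(x in orthant) ((1 + V x) * f x)%:E)%E).
  rewrite ge0_integral_expv//; apply: ge0_le_integral => //.
  - by move=> u _; rewrite lee_fin normc_ge0.
  - by apply/measurable_EFinP; apply: cmfun_normc; apply: cmfun_Phi; exact: cmeasurable_real.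
  - apply: emeasurable_funM; first exact: (measurable_comp_expv mG).
    by apply/measurable_EFinP; exact: measurable_prod_expN.
  move=> u _; rewrite -EFinM lee_fin normc_Phi normcC ger0_norm ?f0//; last exact: orthant_expv.
  rewrite mulrAC ler_wpM2r ?f0//; first exact: orthant_expv.
  set a := expR (\sum_(j < d) (tnth c j - 1) * - tnth u j).
  have -> : V (expv u) = a ^+ 2.
    rewrite /V vpow_expv /a expr2 -expRD -big_split /=; congr expR; apply: eq_bigr => j _; ring.
  have -> : expR (- dot c u) = a * \prod_(j < d) expR (- tnth u j).
    rewrite /a expR_sum_prod -expRD -big_split /= /dot -sumrN; congr expR.
    by apply: eq_bigr => j _; ring.
  apply: ler_wpM2r; first by apply: prodr_ge0 => j _; exact: expR_ge0.
  have : 0 <= (a - 1) ^+ 2 by exact: sqr_ge0.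
  have : 0 <= a by exact: expR_ge0.
  rewrite sqrrB; nra.
have -> : (\int[leb]_(x in orthant) ((1 + V x) * f x)%:E =
    \int[leb]_(x in orthant) (f x)%:E + \int[leb]_(x in orthant) (V x * f x)%:E)%E.
  rewrite -ge0_integralD//.
  - by apply: eq_integral => x _; rewrite -EFinD mulrDl mul1r.
  - exact: measurable_orthant.
  - exact/measurable_EFinP.
  - by move=> x ox; rewrite lee_fin mulr_ge0 ?f0.
  - by apply/measurable_EFinP; exact: measurable_funM.
by rewrite f1 lte_add_pinfty// ltry.
Qed.

End mellin_log.

(** * Multiplicative convolution and sampling variance *)

Section inverse.
Context {R : realType}.

(* [1/x = x exp(- ln (x^2))] also at the junk value [x = 0]. *)
Lemma invrE_expR (x : R) : x^-1 = x * expR (- ln (x ^+ 2)).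
Proof.
have [->|x0] := eqVneq x 0; first by rewrite invr0 mul0r.
by rewrite expRN lnK ?posrE ?exprn_even_gt0// expr2 invfM mulrA divff// mul1r.
Qed.

Lemma measurable_funV d (T : measurableType d) (f : T -> R) : measurable_fun setT f ->
  measurable_fun setT (fun x => (f x)^-1).
Proof.
move=> mf; under eq_fun do rewrite invrE_expR.
apply: measurable_funM => //; apply: (measurableT_comp (@measurable_expR R)).
apply: measurable_funN; apply: (measurableT_comp (@measurable_ln R)).
exact: measurable_funX.
Qed.

Lemma complex_invE (z : R[i]) : z^-1 = conjc z * ((normc z ^+ 2)^-1)%:C.
Proof.
have [->|z0] := eqVneq z 0; first by rewrite invr0 /conjc /= oppr0 mul0r.
apply: (mulfI z0); rewrite divff// mulrA mulcJ -CofRM divff// expf_neq0//.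
by apply: contra_neq z0; exact: Normc.eq0_normc.
Qed.

Lemma cmfunV d (T : measurableType d) (f : T -> R[i]) : cmfun f -> cmfun (fun x => (f x)^-1).
Proof.
move=> mf; rewrite (_ : (fun x => _) = fun x => conjc (f x) * ((normc (f x) ^+ 2)^-1)%:C).
  by apply: cmfunM; [exact: cmfunJ|apply: cmfunC; apply: measurable_funV; exact: cmfun_normc2].
by apply/funext => x; rewrite complex_invE.
Qed.

End inverse.

Section convolution.
Context {R : realType} {d : nat}.
Notation X := (measurableTypeR R).
Notation vec := (d.-tuple X).
Notation leb := (@lebesgue R d).

Definition mulv (x u : vec) : vec := [tuple tnth x j * tnth u j | j < d].

Lemma mulvK (x y : vec) : orthant x -> mulv x (divv y x) = y.
Proof.
by move=> ox; apply: eq_from_tnth => j; rewrite !tnth_mktuple mulrC divfK// gt_eqF//.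
Qed.

Lemma measurable_mulv : measurable_fun setT (fun p : vec * vec => mulv p.1 p.2).
Proof.
apply/measurable_fun_tnthP => j.
rewrite (_ : _ \o _ = fun p : vec * vec => tnth p.1 j * tnth p.2 j).
  by apply: measurable_funM; apply: (measurableT_comp (measurable_tnth j)).
by apply/funext => p /=; rewrite tnth_mktuple.
Qed.

Lemma measurable_divv : measurable_fun setT (fun p : vec * vec => divv p.2 p.1).
Proof.
apply/measurable_fun_tnthP => j.
rewrite (_ : _ \o _ = fun p : vec * vec => tnth p.2 j / tnth p.1 j).
  apply: measurable_funM; first by apply: (measurableT_comp (measurable_tnth j)).
  by apply: measurable_funV; apply: (measurableT_comp (measurable_tnth j)).
by apply/funext => p /=; rewrite tnth_mktuple.
Qed.

(** [is_density] leaves the values off the orthant free. Densities that vanish there can be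
    integrated over the whole space, and the powers of the coordinates need no control off the
    orthant. *)
Definition orthant_density (f : vec -> R) : Prop :=
  [/\ measurable_fun setT f, forall x, 0 <= f x, forall x, ~ orthant x -> f x = 0 &
      (\int[leb]_x (f x)%:E = 1)%E].

Lemma orthant_density_restrict (f : vec -> R) : is_density f -> orthant_density (f \_ orthant).
Proof.
move=> [mf f0 f1]; split.
- by apply/(measurable_restrictT _ measurable_orthant).
- by move=> x; rewrite patchE; case: ifPn => // /set_mem; exact: f0.
- by move=> x nx; rewrite patchE memNset.
- by rewrite -f1 [RHS]integral_mkcond; apply: eq_integral => x _; rewrite restrict_EFin.
Qed.

Variables f g : vec -> R.
Hypotheses (fd : orthant_density f) (gd : orthant_density g).

Let mf : measurable_fun setT f. Proof. by case: fd. Qed.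
Let f0 x : 0 <= f x. Proof. by case: fd. Qed.
Let fN x : ~ orthant x -> f x = 0. Proof. by case: fd => _ _ + _; exact. Qed.
Let mg : measurable_fun setT g. Proof. by case: gd. Qed.
Let g0 x : 0 <= g x. Proof. by case: gd. Qed.
Let gN x : ~ orthant x -> g x = 0. Proof. by case: gd => _ _ + _; exact. Qed.

Definition conv_kernel (p : vec * vec) : R :=
  f p.1 * g (divv p.2 p.1) * \prod_(j < d) (tnth p.1 j)^-1.

Definition conv_density (y : vec) : R := \int[leb]_x conv_kernel (x, y).

Lemma conv_kernel_ge0 p : 0 <= conv_kernel p.
Proof.
rewrite /conv_kernel; have [ox|/fN ->] := pselect (orthant p.1); last by rewrite !mul0r.
rewrite !mulr_ge0//; apply: prodr_ge0 => j _.
by rewrite invr_ge0 ltW// ox.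
Qed.

Lemma measurable_conv_kernel : measurable_fun setT conv_kernel.
Proof.
apply: measurable_funM.
  apply: measurable_funM; first exact: (measurableT_comp mf).
  exact: (measurableT_comp mg measurable_divv).
apply: (measurableT_comp (f := fun x : vec => \prod_(j < d) (tnth x j)^-1)) => //.
apply: (@measurable_prod_tnth _ X R d (fun j x => x^-1)) => j.
exact: (@measurable_funV R _ X id).
Qed.

Lemma measurable_conv_density : measurable_fun setT conv_density.
Proof.
exact: (measurable_Rint1 leb (f := fun p => conv_kernel (p.2, p.1)) (measurable_swap_fun measurable_conv_kernel)).
Qed.

Lemma conv_density_ge0 y : 0 <= conv_density y.
Proof. by apply: Rintegral_ge0 => x _; exact: conv_kernel_ge0. Qed.

Lemma conv_kernel_eq0 x y : ~ orthant y -> conv_kernel (x, y) = 0.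
Proof.
move=> oy; rewrite /conv_kernel /=; have [ox|/fN ->] := pselect (orthant x); last by rewrite !mul0r.
by rewrite gN ?mulr0 ?mul0r// => /(orthant_divv _ ox).
Qed.

Lemma conv_density_eq0 y : ~ orthant y -> conv_density y = 0.
Proof.
move=> oy; rewrite /conv_density (_ : (fun x => _) = cst 0).
  by rewrite /Rintegral integral0.
by apply/funext => x; rewrite conv_kernel_eq0.
Qed.

(** After Tonelli, the substitution [y = x u] for fixed [x] in the orthant absorbs the factor
    [\prod_j x_j^-1]; for other [x] both inner integrals vanish. *)
Lemma ge0_integral_conv_kernel (G : vec -> \bar R) : measurable_fun setT G -> (forall y, 0 <= G y)%E ->
  (\int[leb]_y (G y * \int[leb]_x (conv_kernel (x, y))%:E) =
   \int[leb]_x \int[leb]_u (G (mulv x u) * (f x * g u)%:E))%E.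
Proof.
move=> mG G0.
have mJ : measurable_fun setT (fun p => (conv_kernel p)%:E).
  by apply/measurable_EFinP; exact: measurable_conv_kernel.
have mJs y : measurable_fun setT (fun x => (conv_kernel (x, y))%:E).
  by apply: (measurableT_comp mJ).
transitivity (\int[leb]_y \int[leb]_x (G y * (conv_kernel (x, y))%:E))%E.
  apply: eq_integral => y _; rewrite ge0_integralZl//.
  by move=> x _; rewrite lee_fin conv_kernel_ge0.
rewrite -(fubini_tonelli (fun p : vec * vec => (G p.2 * (conv_kernel p)%:E)%E)); last 2 first.
- by apply: emeasurable_funM => //; exact: (measurableT_comp mG).
- by move=> p; rewrite mule_ge0// lee_fin conv_kernel_ge0.
apply: eq_integral => x _.
have [ox|ox] := pselect (orthant x); last first.
  rewrite !integral0_eq// => y _; rewrite /conv_kernel /= (fN ox) !mul0r mule0//.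
have oD : measurable (orthant : set vec) by exact: measurable_orthant.
have toO (H : vec -> \bar R) : (forall y, ~ orthant y -> H y = 0%E) ->
    (\int[leb]_y H y = \int[leb]_(y in orthant) H y)%E.
  move=> H0; rewrite [RHS]integral_mkcond; apply: eq_integral => y _; rewrite patchE.
  by case: ifPn => // /negP oy; apply: H0 => oy'; apply: oy; exact/mem_set.
rewrite /= toO; last by move=> y oy; rewrite conv_kernel_eq0// mule0.
rewrite toO; last by move=> y oy; rewrite (gN oy) mulr0 mule0.
rewrite [RHS](ge0_integral_divv ox).
- apply: eq_integral => y /set_mem oy.
  by rewrite mulvK// -muleA -EFinM.
- apply: (@measurable_funS _ _ _ _ setT) => //.
  apply: emeasurable_funM.
    have mm : measurable_fun setT (mulv x) by exact: (measurableT_comp measurable_mulv (pair1_measurable x)).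
    exact: (measurableT_comp mG mm).
  by apply/measurable_EFinP; exact: measurable_funM.
- by move=> u ou; rewrite mule_ge0// lee_fin mulr_ge0.
Qed.

Lemma integral_conv_kernel : (\int[leb]_y \int[leb]_x (conv_kernel (x, y))%:E = 1)%E.
Proof.
transitivity (\int[leb]_y (cst 1 y * \int[leb]_x (conv_kernel (x, y))%:E))%E.
  by apply: eq_integral => y _; rewrite /= mul1e.
rewrite ge0_integral_conv_kernel// [LHS](eq_integral (fun x => (f x)%:E)); first by case: fd.
move=> x _; rewrite (eq_integral (fun u => (f x)%:E * (g u)%:E)%E).
  rewrite ge0_integralZl ?lee_fin//; last 2 first.
  - exact/measurable_EFinP.
  - by move=> u _; rewrite lee_fin.
  by case: gd => _ _ _ ->; rewrite mule1.
by move=> u _; rewrite /= mul1e EFinM.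
Qed.

(** The kernel has total mass 1, so its integral in [x] is finite for almost every [y], and only a
    null set receives the default value. *)
Lemma conv_density_ae :
  {ae leb, forall y, (conv_density y)%:E = (\int[leb]_x (conv_kernel (x, y))%:E)%E}.
Proof.
have mJ : measurable_fun setT (fun p => (conv_kernel p)%:E).
  by apply/measurable_EFinP; exact: measurable_conv_kernel.
have mI : measurable_fun setT (fun y => \int[leb]_x (conv_kernel (x, y))%:E)%E.
  apply: (measurable_fun_fubini_tonelli_G (fun p => (conv_kernel p)%:E)) => // p.
  by rewrite lee_fin conv_kernel_ge0.
have I0 y : (0 <= \int[leb]_x (conv_kernel (x, y))%:E)%E.
  by apply: integral_ge0 => x _; rewrite lee_fin conv_kernel_ge0.
have Ii : leb.-integrable setT (fun y => \int[leb]_x (conv_kernel (x, y))%:E)%E.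
  apply/integrableP; split => //.
  under eq_integral do rewrite gee0_abs//.
  by rewrite integral_conv_kernel ltry.
have := integrable_ae measurableT Ii; apply: filterS => y /(_ I) yI.
by rewrite /conv_density /Rintegral fineK.
Qed.

Lemma ge0_integral_conv_density (G : vec -> \bar R) : measurable_fun setT G -> (forall y, 0 <= G y)%E ->
  (\int[leb]_y (G y * (conv_density y)%:E) =
   \int[leb]_x \int[leb]_u (G (mulv x u) * (f x * g u)%:E))%E.
Proof.
move=> mG G0; rewrite -ge0_integral_conv_kernel//.
have mJ : measurable_fun setT (fun p => (conv_kernel p)%:E).
  by apply/measurable_EFinP; exact: measurable_conv_kernel.
apply: ge0_ae_eq_integral => //.
- apply: emeasurable_funM => //; apply/measurable_EFinP; exact: measurable_conv_density.
- apply: emeasurable_funM => //.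
  apply: (measurable_fun_fubini_tonelli_G (fun p => (conv_kernel p)%:E)) => // p.
  by rewrite lee_fin conv_kernel_ge0.
- by move=> y _; rewrite mule_ge0// lee_fin conv_density_ge0.
- move=> y _; rewrite mule_ge0// integral_ge0// => x _.
  by rewrite lee_fin conv_kernel_ge0.
have := conv_density_ae; apply: filterS => y -> _ //.
Qed.

Lemma integral_conv_density : (\int[leb]_y (conv_density y)%:E = 1)%E.
Proof.
rewrite -integral_conv_kernel; apply: ge0_ae_eq_integral => //.
- by apply/measurable_EFinP; exact: measurable_conv_density.
- apply: (measurable_fun_fubini_tonelli_G (fun p => (conv_kernel p)%:E)) => [|p].
    by apply/measurable_EFinP; exact: measurable_conv_kernel.
  by rewrite lee_fin conv_kernel_ge0.
- by move=> y _; rewrite lee_fin conv_density_ge0.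
- by move=> y _; apply: integral_ge0 => x _; rewrite lee_fin conv_kernel_ge0.
by have := conv_density_ae; apply: filterS => y -> _.
Qed.

End convolution.

(** * Second moments of sums of independent centred variables *)

Section iid.
Context {d} {T : measurableType d} {R : realType}.
Variable mu : {sigma_finite_measure set T -> \bar R}.
Variables (rho : T -> R) (W : T -> R[i]) (V : R).
Hypotheses (mrho : measurable_fun setT rho) (rho0 : forall y, 0 <= rho y)
  (rho1 : (\int[mu]_y (rho y)%:E = 1)%E)
  (mW : cmfun W) (Wi : cintegrable mu (fun y => (rho y)%:C * W y))
  (W0 : cint mu (fun y => (rho y)%:C * W y) = 0)
  (WV : (\int[mu]_y (normc (W y) ^+ 2 * rho y)%:E = V%:E)%E).

(** The cross terms vanish because [W] has mean 0 under [rho]. The constant [b] holds the variance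
    of the observations already integrated out. *)
Lemma integral_shift_normc2 (a : R[i]) (b : R) :
  (\int[mu]_y (rho y * (normc (a + W y) ^+ 2 + b))%:E = (normc a ^+ 2 + V + b)%:E)%E.
Proof.
have i1 : mu.-integrable setT (EFin \o rho).
  apply/integrableP; split; first exact/measurable_EFinP.
  rewrite (eq_integral (fun y => (rho y)%:E)) ?rho1 ?ltry// => y _.
  by rewrite gee0_abs ?lee_fin.
have mW2 : measurable_fun setT (fun y => normc (W y) ^+ 2 * rho y).
  by apply: measurable_funM => //; exact: cmfun_normc2.
have i2 : mu.-integrable setT (EFin \o (fun y => normc (W y) ^+ 2 * rho y)).
  apply/integrableP; split; first exact/measurable_EFinP.
  rewrite (eq_integral (fun y => (normc (W y) ^+ 2 * rho y)%:E)) ?WV ?ltry// => y _.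
  by rewrite gee0_abs ?lee_fin// mulr_ge0 ?sqr_ge0.
have i3 := cintegrable_Re Wi; have i4 := cintegrable_Im Wi.
have r1 : \int[mu]_y rho y = 1 by rewrite /Rintegral rho1.
have r2 : \int[mu]_y (normc (W y) ^+ 2 * rho y) = V by rewrite /Rintegral WV.
have [r3 r4] : \int[mu]_y cRe ((rho y)%:C * W y) = 0 /\ \int[mu]_y cIm ((rho y)%:C * W y) = 0.
  by move: W0; rewrite /cint => -[-> ->].
have E y : rho y * (normc (a + W y) ^+ 2 + b) = (normc a ^+ 2 + b) * rho y +
   (normc (W y) ^+ 2 * rho y + (2 * cRe a * cRe ((rho y)%:C * W y) + 2 * cIm a * cIm ((rho y)%:C * W y))).
  by rewrite cRe_Cmul cIm_Cmul !normc2 cReD cImD; ring.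
have addi (p q : T -> R) : mu.-integrable setT (EFin \o p) -> mu.-integrable setT (EFin \o q) ->
    mu.-integrable setT (EFin \o (fun y => p y + q y)).
  by move=> pi qi; apply: (eq_integrable measurableT (fun y => ((p y)%:E + (q y)%:E)%E)) => //; exact: integrableD.
have j1 := RintZl (normc a ^+ 2 + b) i1.
have j3 := RintZl (2 * cRe a) i3; have j4 := RintZl (2 * cIm a) i4.
have k34 := addi _ _ j3 j4; have k2 := addi _ _ i2 k34; have k1 := addi _ _ j1 k2.
under eq_integral do rewrite E.
rewrite -(Rint_EFin k1).
by rewrite RintegralD// RintegralD// RintegralD// !RintegralZl// r1 r2 r3 r4; congr _%:E; ring.
Qed.

(** Induction with [a] general: [W] of the first observation joins [a], the others are integrated by
    the induction hypothesis, and [integral_shift_normc2] with [b = n%:R * V] integrates the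
    first. *)
Lemma iid_variance n (a : R[i]) :
  (\int[power_measure mu n]_y
     (normc (a + \sum_(i < n) W (tnth y i)) ^+ 2 * \prod_(i < n) rho (tnth y i))%:E =
   (normc a ^+ 2 + n%:R * V)%:E)%E.
Proof.
have mS m (b : R[i]) : cmfun (fun y : m.-tuple T => b + \sum_(i < m) W (tnth y i)).
  apply: cmfunD; first exact: cmfun_cst.
  by apply: cmfun_sum => i; apply: (cmfun_comp mW); exact: measurable_tnth.
have mP m : measurable_fun setT (fun y : m.-tuple T => \prod_(i < m) rho (tnth y i)).
  exact: (@measurable_prod_tnth _ T R m (fun=> rho)).
have P0 m (y : m.-tuple T) : 0 <= \prod_(i < m) rho (tnth y i) by exact: prodr_ge0.
have mSP m (b : R[i]) : measurable_fun setT (fun y : m.-tuple T =>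
    (normc (b + \sum_(i < m) W (tnth y i)) ^+ 2 * \prod_(i < m) rho (tnth y i))%:E).
  apply/measurable_EFinP; apply: measurable_funM; [exact: (cmfun_normc2 (mS m b))|exact: mP].
have SP0 m (b : R[i]) (y : m.-tuple T) :
    (0 <= (normc (b + \sum_(i < m) W (tnth y i)) ^+ 2 * \prod_(i < m) rho (tnth y i))%:E)%E.
  by rewrite lee_fin mulr_ge0 ?sqr_ge0.
elim: n a => [|n IH] a.
  rewrite /= integral_dirac//; last exact: (mSP 0%N a).
  by rewrite diracT mul1e !big_ord0 mulr1 mul0r !addr0.
rewrite (@ge0_integral_cons _ _ _ mu n (fun y : n.+1.-tuple T =>
  (normc (a + \sum_(i < n.+1) W (tnth y i)) ^+ 2 * \prod_(i < n.+1) rho (tnth y i))%:E))//.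
have -> : normc a ^+ 2 + n.+1%:R * V = normc a ^+ 2 + V + n%:R * V.
  by rewrite -[n.+1%:R]natr1; ring.
rewrite -integral_shift_normc2.
apply: eq_integral => x _.
rewrite EFinM -IH -ge0_integralZl//; last by rewrite lee_fin.
apply: eq_integral => y _; rewrite -EFinM !big_ord_recl tnth_cons0.
under eq_bigr do rewrite tnth_consS.
under [X in _ * (_ * X)]eq_bigr do rewrite tnth_consS.
by congr _%:E; rewrite addrA mulrCA.
exact: mSP.
Qed.

End iid.

(** * Moments of the product of two independent vectors *)

Section moments.
Context {R : realType} {d : nat}.
Notation X := (measurableTypeR R).
Notation vec := (d.-tuple X).
Notation leb := (@lebesgue R d).

Lemma mult_convE (f g : vec -> R) y : orthant y ->
  mult_conv f g y = conv_density (f \_ orthant) (g \_ orthant) y.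
Proof.
move=> oy; rewrite /mult_conv /conv_density [LHS]Rintegral_mkcond.
apply: eq_Rintegral => x _; rewrite /conv_kernel !patchE /=.
case: ifPn => [/set_mem ox|_]; last by rewrite !mul0r.
by rewrite mem_set//; exact/orthant_divv.
Qed.

Lemma vpow_mulv (x u : vec) (w : 'I_d -> R) : orthant x -> orthant u ->
  vpow (mulv x u) w = vpow x w * vpow u w.
Proof.
move=> ox ou; rewrite /vpow -big_split /=; apply: eq_bigr => j _.
by rewrite tnth_mktuple powRM// ltW// ?ox ?ou.
Qed.

Lemma cvpow_mulv (x u : vec) (w : 'I_d -> R[i]) : orthant x -> orthant u ->
  cvpow (mulv x u) w = cvpow x w * cvpow u w.
Proof.
move=> ox ou; rewrite /cvpow -big_split /=; apply: eq_bigr => j _.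
rewrite tnth_mktuple lnM ?posrE ?ox ?ou// -cexpD; congr cexp.
by rewrite -mulrDr; congr (_ * _); rewrite rmorphD.
Qed.

(** [x^(c - 1 + i t)]: the summand of [mellin_hat] and the kernel of [mellin]. *)
Definition zpow (c t x : vec) : R[i] := cvpow x (fun j => (tnth c j - 1) +i* tnth t j).

Definition sqpow (c x : vec) : R := vpow x (fun j => 2 * tnth c j - 2).

Lemma sqpow_ge0 c x : 0 <= sqpow c x.
Proof. by apply: prodr_ge0 => j _; exact: powR_ge0. Qed.

Lemma normc_prod (I : Type) (s : seq I) (F : I -> R[i]) :
  normc (\prod_(i <- s) F i) = \prod_(i <- s) normc (F i).
Proof. by apply: (big_morph (@Normc.normc R) (@Normc.normcM R) (@Normc.normc1 R)). Qed.

Lemma normc2_zpow c t x : orthant x -> normc (zpow c t x) ^+ 2 = sqpow c x.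
Proof.
move=> ox; rewrite /zpow /sqpow /cvpow normc_prod -prodrXl; apply: eq_bigr => j _.
rewrite normc_cexp cReM /= mulr0 subr0 expr2 -expRD /powR gt_eqF ?ox//.
by congr expR; ring.
Qed.

Lemma cmfun_zpow2 (c : vec) : cmfun (fun p : vec * vec => zpow c p.1 p.2).
Proof.
apply: (@cmfun_cvpow _ _ _ (vec * vec)%type snd (fun j => cst (tnth c j - 1)) (fun j p => tnth p.1 j)) => //.
by move=> j; apply: (measurableT_comp (measurable_tnth j)).
Qed.

Lemma cmfun_zpow (c t : vec) : cmfun (zpow c t).
Proof. exact: (cmfun_section1 t (cmfun_zpow2 c)). Qed.

Lemma measurable_sqpow c : measurable_fun setT (sqpow c : vec -> R).
Proof. exact: measurable_vpow. Qed.

Lemma integral_restrict_orthant (f : vec -> R) (w : vec -> R) :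
  (\int[leb]_x (w x * (f \_ orthant) x)%:E = \int[leb]_(x in orthant) (w x * f x)%:E)%E.
Proof.
rewrite [RHS]integral_mkcond; apply: eq_integral => x _.
by rewrite !patchE; case: ifPn => _; rewrite ?mulr0.
Qed.

(** From [|z| <= 1 + |z|^2], with [|z|^2 = sqpow c x] on the orthant and [f = 0] off it. *)
Lemma cintegrable_zpow c t (f : vec -> R) : orthant_density f ->
  (\int[leb]_x (sqpow c x * f x)%:E < +oo)%E -> cintegrable leb (fun x => (f x)%:C * zpow c t x).
Proof.
move=> [mf f0 fN f1] foo.
have mV := measurable_sqpow c.
have i1 : leb.-integrable setT (EFin \o f).
  apply/integrableP; split; first exact/measurable_EFinP.
  by rewrite (eq_integral (fun y => (f y)%:E)) ?f1 ?ltry// => y _; rewrite gee0_abs ?lee_fin.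
have i2 : leb.-integrable setT (EFin \o (fun x => sqpow c x * f x)).
  apply/integrableP; split; first by apply/measurable_EFinP; exact: measurable_funM.
  rewrite (eq_integral (fun x => (sqpow c x * f x)%:E))// => y _.
  by rewrite gee0_abs ?lee_fin// mulr_ge0 ?sqpow_ge0.
apply: (@le_cintegrable _ _ _ _ _ (fun x => f x + sqpow c x * f x)).
- by apply: cmfunM; [exact: cmfunC|exact: cmfun_zpow].
- by apply: (eq_integrable measurableT (fun y => ((f y)%:E + (sqpow c y * f y)%:E)%E)) => //; exact: integrableD.
move=> x; rewrite Normc.normcM normcC ger0_norm//.
have [ox|/fN ->] := pselect (orthant x); last by rewrite !mul0r mulr0 addr0.
rewrite -[X in _ <= X + _]mul1r -mulrDl mulrC ler_wpM2r// -(normc2_zpow c t ox).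
have := normc_ge0 (zpow c t x); set z := normc _.
have : 0 <= (z - 1) ^+ 2 by exact: sqr_ge0.
rewrite sqrrB; nra.
Qed.

Section convolution_moments.
Variables (c : vec) (f g : vec -> R).
Hypotheses (fd : orthant_density f) (gd : orthant_density g)
  (foo : (\int[leb]_x (sqpow c x * f x)%:E < +oo)%E)
  (goo : (\int[leb]_x (sqpow c x * g x)%:E < +oo)%E).
Let rho := conv_density f g.

Let mf : measurable_fun setT f. Proof. by case: fd. Qed.
Let f0 x : 0 <= f x. Proof. by case: fd. Qed.
Let fN x : ~ orthant x -> f x = 0. Proof. by case: fd => _ _ + _; exact. Qed.
Let mg : measurable_fun setT g. Proof. by case: gd. Qed.
Let g0 x : 0 <= g x. Proof. by case: gd. Qed.
Let gN x : ~ orthant x -> g x = 0. Proof. by case: gd => _ _ + _; exact. Qed.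

Lemma conv_second_moment : (\int[leb]_y (sqpow c y * rho y)%:E =
  \int[leb]_x (sqpow c x * f x)%:E * \int[leb]_u (sqpow c u * g u)%:E)%E.
Proof.
have mV := measurable_sqpow c.
under eq_integral do rewrite EFinM.
rewrite (ge0_integral_conv_density fd gd (G := fun y => (sqpow c y)%:E)); last 2 first.
- exact/measurable_EFinP.
- by move=> y; rewrite lee_fin sqpow_ge0.
have Vf x : (0 <= (sqpow c x * f x)%:E)%E by rewrite lee_fin mulr_ge0 ?sqpow_ge0.
have Vg x : (0 <= (sqpow c x * g x)%:E)%E by rewrite lee_fin mulr_ge0 ?sqpow_ge0.
have mVf : measurable_fun setT (fun x => (sqpow c x * f x)%:E).
  by apply/measurable_EFinP; exact: measurable_funM.
have mVg : measurable_fun setT (fun x => (sqpow c x * g x)%:E).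
  by apply/measurable_EFinP; exact: measurable_funM.
rewrite -ge0_integralZr ?integral_ge0//.
apply: eq_integral => x _; rewrite -ge0_integralZl//.
apply: eq_integral => u _; rewrite -!EFinM; congr _%:E.
have [ox|/fN ->] := pselect (orthant x); last by rewrite !(mul0r, mulr0).
have [ou|/gN ->] := pselect (orthant u); last by rewrite !(mul0r, mulr0).
by rewrite /sqpow vpow_mulv//; ring.
Qed.

Lemma conv_orthant_density : orthant_density rho.
Proof.
split.
- exact: measurable_conv_density.
- exact: conv_density_ge0.
- exact: conv_density_eq0.
- exact: integral_conv_density.
Qed.

(** Carries [ge0_integral_conv_density] over to signed [a]: the densities are nonnegative, so
    multiplying by them commutes with taking positive and negative parts. *)
Lemma Rint_conv_density (a : vec -> R) : measurable_fun setT a ->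
  (\int[leb]_x \int[leb]_u `|a (mulv x u) * (f x * g u)|%:E < +oo)%E ->
  \int[leb]_y (rho y * a y) = \int[leb]_x \int[leb]_u (a (mulv x u) * (f x * g u)).
Proof.
move=> ma aoo.
pose k (p : vec * vec) := a (mulv p.1 p.2) * (f p.1 * g p.2).
have mfg : measurable_fun setT (fun p : vec * vec => f p.1 * g p.2).
  by apply: measurable_funM; [exact: (measurableT_comp mf)|exact: (measurableT_comp mg)].
have mk : measurable_fun setT k.
  apply: measurable_funM => //; exact: (measurableT_comp ma measurable_mulv).
have ki : (leb \x leb)%E.-integrable setT (EFin \o k).
  by apply/integrable12ltyP => //; exact/measurable_EFinP.
have [_ ->] := Rint_fubini ki.
have fg0 p : 0 <= f p.1 * g p.2 by rewrite mulr_ge0.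
have r0 := conv_density_ge0 fd gd.
have mE : measurable_fun setT (EFin \o a) by exact/measurable_EFinP.
rewrite /Rintegral; congr fine; rewrite integralE [RHS]integralE; congr (_ - _)%E.
  rewrite (eq_integral (fun y => (EFin \o a)^\+ y * (rho y)%:E)%E); last first.
    by move=> y _; rewrite !funeposE muleC maxe_pMr ?lee_fin// mule0 -EFinM.
  rewrite (ge0_integral_conv_density fd gd)//; last exact: measurable_funepos.
  rewrite fubini_tonelli1//; last first.
    by apply: measurable_funepos; exact/measurable_EFinP.
  apply: eq_integral => x _; apply: eq_integral => u _.
  rewrite !funeposE muleC maxe_pMr ?lee_fin ?(fg0 (x, u))//.
  by rewrite mule0 -EFinM /k /= [in RHS]mulrC.
rewrite (eq_integral (fun y => (EFin \o a)^\- y * (rho y)%:E)%E); last first.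
  by move=> y _; rewrite !funenegE muleC maxe_pMr ?lee_fin// mule0 muleN -EFinM.
rewrite (ge0_integral_conv_density fd gd)//; last exact: measurable_funeneg.
rewrite fubini_tonelli1//; last first.
  by apply: measurable_funeneg; exact/measurable_EFinP.
apply: eq_integral => x _; apply: eq_integral => u _.
rewrite !funenegE muleC maxe_pMr ?lee_fin ?(fg0 (x, u))//.
by rewrite mule0 muleN -EFinM /k /= [in RHS]mulrC.
Qed.

(** The convolution theorem for Mellin transforms: [zpow c t] is multiplicative on the orthant, and
    the double integrand factors into two integrable functions. *)
Lemma conv_mean t : cint leb (fun y => (rho y)%:C * zpow c t y) =
  cint leb (fun x => (f x)%:C * zpow c t x) * cint leb (fun u => (g u)%:C * zpow c t u).
Proof.
have fi := cintegrable_zpow t fd foo; have gi := cintegrable_zpow t gd goo.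
have mz := cmfun_zpow c t.
pose K (p : vec * vec) := ((f p.1)%:C * zpow c t p.1) * ((g p.2)%:C * zpow c t p.2).
have KE x u : zpow c t (mulv x u) * (f x * g u)%:C = K (x, u).
  rewrite /K /= CofRM.
  have [ox|/fN ->] := pselect (orthant x); last by rewrite !(mul0r, mulr0).
  have [ou|/gN ->] := pselect (orthant u); last by rewrite !(mul0r, mulr0).
  by rewrite /zpow cvpow_mulv//; ring.
have Koo := tonelli_normcM fi gi.
have KooN : (\int[leb]_x \int[leb]_u (normc (K (x, u)))%:E < +oo)%E.
  apply: le_lt_trans Koo; rewrite le_eqVlt; apply/orP; left; apply/eqP.
  by apply: eq_integral => x _; apply: eq_integral => u _; rewrite /K Normc.normcM.
have mK : cmfun K by apply: cmfunM; [exact: (cmfun_comp fi.1)|exact: (cmfun_comp gi.1)].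
have Ki := cintegrable_prod mK KooN.
have -> : cint leb (fun x => (f x)%:C * zpow c t x) * cint leb (fun u => (g u)%:C * zpow c t u) =
    cint leb (fun x => cint leb (fun u => K (x, u))).
  rewrite mulrC -cintZ//; congr cint; apply/funext => x; rewrite mulrC -cintZ//.
rewrite /cint; congr (_ +i* _).
  under eq_Rintegral do rewrite cRe_Cmul.
  have E x u : cRe (zpow c t (mulv x u)) * (f x * g u) = cRe (K (x, u)).
    by rewrite -KE mulrC -cRe_Cmul mulrC.
  rewrite (Rint_conv_density mz.1).
    by apply: eq_Rintegral => x _; apply: eq_Rintegral => u _; rewrite E.
  have /integrable12ltyP := cintegrable_Re Ki.
  rewrite /=; under eq_integral do under eq_integral do rewrite -E.
  by apply; apply/measurable_EFinP; case: mK.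
under eq_Rintegral do rewrite cIm_Cmul.
have E x u : cIm (zpow c t (mulv x u)) * (f x * g u) = cIm (K (x, u)).
  by rewrite -KE mulrC -cIm_Cmul mulrC.
rewrite (Rint_conv_density mz.2).
  by apply: eq_Rintegral => x _; apply: eq_Rintegral => u _; rewrite E.
have /integrable12ltyP := cintegrable_Im Ki.
rewrite /=; under eq_integral do under eq_integral do rewrite -E.
by apply; apply/measurable_EFinP; case: mK.
Qed.

End convolution_moments.
End moments.

Section polarization.
Context {d} {T : measurableType d} {R : realType}.
Variable mu : {measure set T -> \bar R}.

Lemma integrable_normc2 (p : T -> R[i]) (a : R) : cmfun p ->
  (\int[mu]_x (normc (p x) ^+ 2)%:E = a%:E)%E ->
  mu.-integrable setT (EFin \o (fun x => normc (p x) ^+ 2)).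
Proof.
move=> mp pa; apply/integrableP; split; first by apply/measurable_EFinP; exact: cmfun_normc2.
rewrite (eq_integral (fun x => (normc (p x) ^+ 2)%:E)) ?pa ?ltry// => x _.
by rewrite gee0_abs// lee_fin sqr_ge0.
Qed.

Lemma integral_normc2B (p q : T -> R[i]) (a b : R) : cmfun p -> cmfun q ->
  (\int[mu]_x (normc (p x) ^+ 2)%:E = a%:E)%E ->
  (\int[mu]_x (normc (q x) ^+ 2)%:E = b%:E)%E ->
  cintegrable mu (fun x => p x * conjc (q x)) ->
  (\int[mu]_x (normc (p x - q x) ^+ 2)%:E =
   (a + b - 2 * cRe (cint mu (fun x => p x * conjc (q x))))%:E)%E.
Proof.
move=> mp mq pa qb pqi.
have i1 := integrable_normc2 mp pa; have i2 := integrable_normc2 mq qb.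
have i3 := RintZl (- 2) (cintegrable_Re pqi).
have E x : normc (p x - q x) ^+ 2 =
    normc (p x) ^+ 2 + (normc (q x) ^+ 2 + - 2 * cRe (p x * conjc (q x))).
  by rewrite !normc2 cReM cReD cImD cReN cImN cReJ cImJ; ring.
have addi (f g : T -> R) : mu.-integrable setT (EFin \o f) -> mu.-integrable setT (EFin \o g) ->
    mu.-integrable setT (EFin \o (fun y => f y + g y)).
  by move=> fi gi; apply: (eq_integrable measurableT (fun y => ((f y)%:E + (g y)%:E)%E)) => //; exact: integrableD.
have i23 := addi _ _ i2 i3; have i123 := addi _ _ i1 i23.
under eq_integral do rewrite E.
rewrite -(Rint_EFin i123) RintegralD// RintegralD// RintegralZl//; last exact: cintegrable_Re.
have -> : \int[mu]_x normc (p x) ^+ 2 = a by rewrite /Rintegral pa.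
have -> : \int[mu]_x normc (q x) ^+ 2 = b by rewrite /Rintegral qb.
by congr _%:E; rewrite mulNr addrA.
Qed.

End polarization.

(** * Inversion of the Fourier transform in norm *)

Section inversion.
Context {R : realType} {d : nat}.
Notation X := (measurableTypeR R).
Notation vec := (d.-tuple X).
Notation leb := (@lebesgue R d).
Notation FTd := (FT leb (@phase R d)).
Notation ATd := (AT leb (@phase R d)).
Notation K := ((2 * pi) ^+ d : R).

Let mph := @measurable_phase R d.

Lemma K_gt0 : 0 < K. Proof. by rewrite exprn_gt0// pi2_gt0. Qed.

Lemma phaseC (t x : vec) : phase (t, x) = phase (x, t).
Proof. by rewrite /phase /dot; apply: eq_bigr => j _; rewrite mulrC. Qed.

Lemma plancherel_AT (k : vec -> R[i]) : cintegrable leb k ->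
  (\int[leb]_x (normc (ATd k x) ^+ 2)%:E = K%:E * \int[leb]_t (normc (k t) ^+ 2)%:E)%E.
Proof.
move=> ki; have := plancherel_isometry (cintegrableJ ki).
under [X in _ = (_ * X)%E -> _]eq_integral do rewrite normc_conj.
move=> <-; apply: eq_integral => x _.
rewrite (AT_conj mph)// normc_conj /FT.
by congr ((normc (cint _ _) ^+ 2)%:E); apply/funext => t; rewrite phaseC.
Qed.

(* Both sides expand into norms and a cross term, and the cross terms agree
   because the inverse transform is the adjoint of the transform. *)
Lemma integral_inversion (phi psi : vec -> R[i]) :
  cintegrable leb phi -> (\int[leb]_x (normc (phi x) ^+ 2)%:E < +oo)%E ->
  cintegrable leb psi -> (\int[leb]_t (normc (psi t) ^+ 2)%:E < +oo)%E ->
  (\int[leb]_x (normc (phi x - (K^-1)%:C * ATd psi x) ^+ 2)%:E =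
   (K^-1)%:E * \int[leb]_t (normc (FTd phi t - psi t) ^+ 2)%:E)%E.
Proof.
move=> pi_ p2 qi q2; have mp := pi_.1; have mq := qi.1.
have K0 := K_gt0; have KN0 : K != 0 by rewrite gt_eqF.
pose a := fine (\int[leb]_x (normc (phi x) ^+ 2)%:E)%E.
pose b := fine (\int[leb]_t (normc (psi t) ^+ 2)%:E)%E.
have ge0 (h : vec -> R[i]) : (0 <= \int[leb]_x (normc (h x) ^+ 2)%:E)%E.
  by apply: integral_ge0 => x _; rewrite lee_fin sqr_ge0.
have pa : (\int[leb]_x (normc (phi x) ^+ 2)%:E = a%:E)%E by rewrite fineK// ge0_fin_numE.
have qb : (\int[leb]_x (normc (psi x) ^+ 2)%:E = b%:E)%E by rewrite fineK// ge0_fin_numE.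
have mF := cmfun_FT leb mph mp; have mA := cmfun_AT leb mph mq.
have Fa : (\int[leb]_t (normc (FTd phi t) ^+ 2)%:E = (K * a)%:E)%E.
  by rewrite plancherel_isometry// pa.
have Ab : (\int[leb]_x (normc ((K^-1)%:C * ATd psi x) ^+ 2)%:E = (K^-1 * b)%:E)%E.
  under eq_integral do rewrite Normc.normcM exprMn EFinM.
  rewrite ge0_integralZl//.
  - rewrite plancherel_AT// qb -!EFinM normcC; congr _%:E.
    by rewrite ger0_norm ?invr_ge0 ?(ltW K0)//; field.
  - by apply/measurable_EFinP; exact: cmfun_normc2.
  - by move=> x _; rewrite lee_fin sqr_ge0.
  - by rewrite lee_fin sqr_ge0.
have [M1 hM1] := cintegrable_bound pi_; have [M2 hM2] := cintegrable_bound qi.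
have i1 : cintegrable leb (fun t => FTd phi t * conjc (psi t)).
  apply: (@cintegrableM_bnd _ _ _ _ _ _ (M1 *+ 2)) => //; last exact: cintegrableJ.
  by move=> t; exact: normc_FT_le.
have i2 : cintegrable leb (fun x => phi x * conjc (ATd psi x)).
  rewrite (_ : (fun x => _) = fun x => conjc (ATd psi x) * phi x); last first.
    by apply/funext => x; rewrite mulrC.
  apply: (@cintegrableM_bnd _ _ _ _ _ _ (M2 *+ 2)) => //; first exact: cmfunJ.
  by move=> x; rewrite normc_conj; exact: normc_AT_le.
have E2 : (fun x => phi x * conjc ((K^-1)%:C * ATd psi x)) =
    (fun x => (K^-1)%:C * (phi x * conjc (ATd psi x))).
  apply/funext => x; rewrite conjcM mulrCA; congr (_ * _).
  by rewrite /conjc /= oppr0.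
rewrite (integral_normc2B mp _ pa Ab); last 2 first.
- by apply: cmfunM => //; exact: cmfun_cst.
- by rewrite E2; exact: cintegrableZ.
rewrite (integral_normc2B mF mq Fa qb i1) -EFinM; congr _%:E.
rewrite E2 cintZ// cRe_Cmul (FT_AT_adjoint mph)//.
by field.
Qed.

End inversion.

(** * The estimator in logarithmic coordinates *)

Section estimator.
Context {R : realType} {d : nat}.
Notation X := (measurableTypeR R).
Notation vec := (d.-tuple X).
Notation leb := (@lebesgue R d).
Notation FTd := (FT leb (@phase R d)).
Notation ATd := (AT leb (@phase R d)).
Notation K := ((2 * pi) ^+ d : R).
Let mph := @measurable_phase R d.

Lemma measurable_box (k : vec) : measurable (box k).
Proof.
rewrite (_ : box k = \bigcap_(j in [set: 'I_d]) ((fun x : vec => tnth x j) @^-1` `[- tnth k j, tnth k j]%classic)).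
  apply: fin_bigcap_measurable => // j _.
  by rewrite -[X in measurable X]setTI; exact: (measurable_tnth j).
apply/seteqP; split => x /=.
  by move=> bx j _ /=; rewrite in_itv /= -ler_norml; exact: bx.
by move=> bx j; have := bx j I; rewrite /= in_itv /= -ler_norml.
Qed.

Definition boxind (k t : vec) : R := \1_(box k) t.

Lemma measurable_boxind k : measurable_fun setT (boxind k).
Proof. by apply: measurable_indic; exact: measurable_box. Qed.

Lemma boxind_ge0 k t : 0 <= boxind k t.
Proof. by rewrite /boxind indicE ler0n. Qed.

Lemma boxind_le1 k t : boxind k t <= 1.
Proof. by rewrite /boxind indicE lern1 leq_b1. Qed.

Lemma cintegral_box (k : vec) (h : vec -> R[i]) :
  cintegral (box k) h = cint leb (fun t => (boxind k t)%:C * h t).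
Proof.
rewrite /cintegral /cint; congr (_ +i* _).
  rewrite [LHS]Rintegral_mkcond; apply: eq_Rintegral => t _.
  rewrite cRe_Cmul patchE /boxind indicE; by case: ifPn => _; rewrite ?mul1r ?mul0r.
rewrite [LHS]Rintegral_mkcond; apply: eq_Rintegral => t _.
rewrite cIm_Cmul patchE /boxind indicE; by case: ifPn => _; rewrite ?mul1r ?mul0r.
Qed.

Variables (c k : vec) (psi : vec -> R[i]).
Hypothesis mpsi : cmfun psi.
Hypothesis psii : cintegrable leb (fun t => (boxind k t)%:C * psi t).

(** The estimator with the ratio of the empirical transform to [M[g]] abstracted to [psi]; the
    statements of this section concern one fixed sample. *)
Let est (x : vec) : R[i] := (K^-1)%:C * cintegral (box k) (fun t =>
  cvpow x (fun j => (- tnth c j) +i* (- tnth t j)) * psi t).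

Lemma cmfun_estimator : cmfun est.
Proof.
rewrite /est; apply: cmfunM; first exact: cmfun_cst.
under eq_fun do rewrite cintegral_box.
apply: (cmfun_cint leb (h := fun p : vec * vec => (boxind k p.2)%:C *
  (cvpow p.1 (fun j => (- tnth c j) +i* (- tnth p.2 j)) * psi p.2))).
apply: cmfunM; first by apply: cmfunC; exact: (measurableT_comp (measurable_boxind k)).
apply: cmfunM; last exact: (cmfun_comp mpsi).
apply: (@cmfun_cvpow _ _ _ (vec * vec)%type fst (fun j => cst (- tnth c j)) (fun j p => - tnth p.2 j)) => //.
by move=> j; apply: measurable_funN; apply: (measurableT_comp (measurable_tnth j)).
Qed.

(** At [x = exp(-u)] the kernel [x^(-c - i t)] is [expR (dot c u)] times [cis (phase (t, u))], and
    [Phi] cancels the first factor. *)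
Lemma Phi_estimator u :
  Phi c est u = (K^-1)%:C * ATd (fun t => (boxind k t)%:C * psi t) u.
Proof.
rewrite /Phi -/(expv u) /est cintegral_box mulrCA; congr (_ * _).
rewrite -cintZ.
  rewrite /AT; congr cint; apply/funext => t.
  have -> : cvpow (expv u) (fun j => (- tnth c j) +i* (- tnth t j)) =
      (expR (dot c u))%:C * cis (phase (t, u)).
    rewrite cvpow_expv cexpE cRe_sum cIm_sum; congr ((expR _)%:C * cis _).
      by apply: eq_bigr => j _; rewrite cReM /= mulr0 subr0 mulrNN.
    by apply: eq_bigr => j _; rewrite cImM /= mulr0 add0r mulrNN.
  rewrite [(boxind k t)%:C * _]mulrCA !mulrA -CofRM -expRD addNr expR0 mul1r.
  by rewrite -!mulrA.
rewrite (_ : (fun x => _) = fun t => cvpow (expv u) (fun j => (- tnth c j) +i* (- tnth t j)) * ((boxind k t)%:C * psi t)).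
  apply: (@cintegrableM_bnd _ _ _ _ _ _ (expR (dot c u))) => //.
    apply: (@cmfun_cvpow _ _ _ vec (cst (expv u)) (fun j => cst (- tnth c j)) (fun j p => - tnth p j)) => //.
    by move=> j; apply: measurable_funN; exact: (measurable_tnth j).
  move=> t; rewrite cvpow_expv normc_cexp cRe_sum le_eqVlt; apply/orP; left; apply/eqP.
  by congr expR; apply: eq_bigr => j _; rewrite cReM /= mulr0 subr0 mulrNN.
by apply/funext => t; rewrite mulrCA.
Qed.

Lemma normsq_estimator (f : vec -> R[i]) : cmeasurable orthant f ->
  cintegrable leb (Phi c f) -> (\int[leb]_u (normc (Phi c f u) ^+ 2)%:E < +oo)%E ->
  (\int[leb]_t (normc ((boxind k t)%:C * psi t) ^+ 2)%:E < +oo)%E ->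
  normsq orthant (weight c) (fun x => f x - est x) =
  ((K^-1)%:E * \int[leb]_t (normc (mellin c f t - (boxind k t)%:C * psi t) ^+ 2)%:E)%E.
Proof.
move=> mf fi f2 p2; rewrite normsq_orthant; last first.
  have [e1 e2] := cmeasurable_setT orthant cmfun_estimator; case: mf => f1 f2'; split.
    by under eq_fun do rewrite cReD cReN; exact: measurable_funB.
  by under eq_fun do rewrite cImD cImN; exact: measurable_funB.
under [X in _ = (_ * X)%E]eq_integral do rewrite mellinE//.
rewrite -integral_inversion//; apply: eq_integral => u _.
by rewrite -Phi_estimator /Phi mulrBr.
Qed.

End estimator.

(** * The risk bound *)

Section risk_bound.
Context {R : realType} {d : nat}.
Notation X := (measurableTypeR R).
Notation vec := (d.-tuple X).
Notation leb := (@lebesgue R d).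
Notation FTd := (FT leb (@phase R d)).
Notation K := ((2 * pi) ^+ d : R).

Lemma mellin_zpow (c t : vec) (f : vec -> R) :
  mellin c (fun x => (f x)%:C) t = cint leb (fun x => ((f \_ orthant) x)%:C * zpow c t x).
Proof.
rewrite /mellin /cintegral /cint; congr (_ +i* _).
  rewrite [LHS]Rintegral_mkcond; apply: eq_Rintegral => x _.
  rewrite [in RHS]cRe_Cmul !patchE; case: ifPn => _; last by rewrite mul0r.
  by rewrite [in LHS]mulrC cRe_Cmul.
rewrite [LHS]Rintegral_mkcond; apply: eq_Rintegral => x _.
rewrite [in RHS]cIm_Cmul !patchE; case: ifPn => _; last by rewrite mul0r.
by rewrite [in LHS]mulrC cIm_Cmul.
Qed.

Lemma normc_zpow (c t s x : vec) : normc (zpow c t x) = normc (zpow c s x).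
Proof.
rewrite /zpow /cvpow !normc_prod; apply: eq_bigr => j _.
by rewrite !normc_cexp !cReM /= !mulr0.
Qed.

Lemma cmfun_mellin (c : vec) (h : vec -> R[i]) : cmeasurable orthant h -> cmfun (mellin c h).
Proof.
move=> mh; rewrite (_ : mellin c h = FTd (Phi c h)).
  by apply: cmfun_FT; [exact: measurable_phase|exact: cmfun_Phi].
by apply/funext => t; rewrite mellinE.
Qed.

Lemma mellin_hatE (c t : vec) n (y : n.-tuple vec) :
  mellin_hat c y t = (n%:R^-1)%:C * \sum_(i < n) zpow c t (tnth y i).
Proof. by []. Qed.

Lemma moment_ge0 (c : vec) (h : vec -> R) : is_density h -> (0 <= moment c h)%E.
Proof.
move=> [_ h0 _]; apply: integral_ge0 => x ox; rewrite lee_fin mulr_ge0 ?h0//.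
exact: (sqpow_ge0 c).
Qed.

Variables (c k : vec) (f g : vec -> R) (n : nat) (w0 v : R).
Hypotheses (hf : is_density f) (hg : is_density g)
  (foo : (moment c f < +oo)%E) (goo : (moment c g < +oo)%E) (n0 : (0 < n)%N)
  (f2 : (\int[leb]_u (normc (Phi c (fun x => (f x)%:C) u) ^+ 2)%:E < +oo)%E)
  (w00 : 0 < w0) (kv : leb (box k) = v%:E)
  (gw : forall t, box k t -> w0 <= normc (mellin c (fun x => (g x)%:C) t)).

Let ft := f \_ orthant.
Let gt := g \_ orthant.
Let rho := conv_density ft gt.
Let Mf := mellin c (fun x => (f x)%:C).
Let Mg := mellin c (fun x => (g x)%:C).
Let S := fine (moment c f) * fine (moment c g).
(** The truncated reciprocal of [M[g]], by which the empirical transform is multiplied. *)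
Let q t : R[i] := (boxind k t)%:C / Mg t.
Let psi (y : n.-tuple vec) (t : vec) := mellin_hat c y t / Mg t.

Let fd : orthant_density ft. Proof. exact: orthant_density_restrict. Qed.
Let gd : orthant_density gt. Proof. exact: orthant_density_restrict. Qed.

Let mrho : measurable_fun setT rho. Proof. exact: measurable_conv_density. Qed.
Let rho0 y : 0 <= rho y. Proof. exact: conv_density_ge0. Qed.
Let rho1 : (\int[leb]_y (rho y)%:E = 1)%E. Proof. exact: integral_conv_density. Qed.

Let ft2 : (\int[leb]_x (sqpow c x * ft x)%:E = moment c f)%E.
Proof. by rewrite integral_restrict_orthant. Qed.

Let gt2 : (\int[leb]_x (sqpow c x * gt x)%:E = moment c g)%E.
Proof. by rewrite integral_restrict_orthant. Qed.

Let rhoS : (\int[leb]_y (sqpow c y * rho y)%:E = S%:E)%E.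
Proof.
rewrite (conv_second_moment c fd gd) ft2 gt2 EFinM !fineK// ge0_fin_numE//; exact: moment_ge0.
Qed.

Let S0 : 0 <= S.
Proof. by rewrite mulr_ge0// fine_ge0// moment_ge0. Qed.

Let mMf : cmfun Mf. Proof. by apply: cmfun_mellin; apply: cmeasurable_real; case: hf. Qed.
Let mMg : cmfun Mg. Proof. by apply: cmfun_mellin; apply: cmeasurable_real; case: hg. Qed.

Let mean t : cint leb (fun y => (rho y)%:C * zpow c t y) = Mf t * Mg t.
Proof. by rewrite /Mf /Mg !mellin_zpow (conv_mean fd gd)// ?ft2 ?gt2. Qed.

Let rho_density : orthant_density rho. Proof. exact: conv_orthant_density. Qed.

Let rhoZi t : cintegrable leb (fun y => (rho y)%:C * zpow c t y).
Proof. by apply: cintegrable_zpow => //; rewrite rhoS ltry. Qed.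

Let rhoi : cintegrable leb (fun y => (rho y)%:C).
Proof.
split; first exact: cmfunC.
by under eq_integral do rewrite normcC ger0_norm//; rewrite rho1 ltry.
Qed.

Let rhoN y : ~ orthant y -> rho y = 0.
Proof. by case: rho_density => _ _ + _; exact. Qed.

Let rhoZ2 t : (\int[leb]_y (normc (zpow c t y) ^+ 2 * rho y)%:E = S%:E)%E.
Proof.
rewrite -rhoS; apply: eq_integral => y _.
have [oy|/rhoN ->] := pselect (orthant y); last by rewrite !mulr0.
by rewrite normc2_zpow.
Qed.

(** Variance is at most the second moment. Finiteness is needed first and comes from
    [|z - m|^2 <= 2 |z|^2 + 2 |m|^2]. *)
Let centered_variance t : exists V : R, [/\ 0 <= V, V <= S &
  (\int[leb]_y (normc (zpow c t y - Mf t * Mg t) ^+ 2 * rho y)%:E = V%:E)%E].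
Proof.
set m := Mf t * Mg t.
have mz := cmfun_zpow c t.
have mW : cmfun (fun y => zpow c t y - m) by apply: cmfunB => //; exact: cmfun_cst.
have mWr : measurable_fun setT (fun y => (normc (zpow c t y - m) ^+ 2 * rho y)%:E).
  by apply/measurable_EFinP; apply: measurable_funM => //; exact: cmfun_normc2.
have W0 y : (0 <= (normc (zpow c t y - m) ^+ 2 * rho y)%:E)%E.
  by rewrite lee_fin mulr_ge0 ?sqr_ge0.
have Woo : (\int[leb]_y (normc (zpow c t y - m) ^+ 2 * rho y)%:E < +oo)%E.
  apply: (@le_lt_trans _ _ (\int[leb]_y ((2 * normc (zpow c t y) ^+ 2 * rho y)%:E +
      (2 * normc m ^+ 2 * rho y)%:E))%E).
    apply: ge0_le_integral => //.
    - apply: emeasurable_funD; apply/measurable_EFinP; apply: measurable_funM => //.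
      by apply: measurable_funM => //; exact: cmfun_normc2.
    - move=> y _; rewrite -EFinD -mulrDl lee_fin ler_wpM2r// !normc2 cReD cImD cReN cImN.
      rewrite -subr_ge0 (_ : _ - _ = (cRe (zpow c t y) + cRe m) ^+ 2 + (cIm (zpow c t y) + cIm m) ^+ 2).
        by rewrite addr_ge0 ?sqr_ge0.
      by ring.
  rewrite ge0_integralD//; last 4 first.
  - by move=> y _; rewrite lee_fin mulr_ge0// mulr_ge0 ?sqr_ge0.
  - apply/measurable_EFinP; apply: measurable_funM => //.
    by apply: measurable_funM => //; exact: cmfun_normc2.
  - by move=> y _; rewrite lee_fin mulr_ge0// mulr_ge0 ?sqr_ge0.
  - by apply/measurable_EFinP; exact: measurable_funM.
  apply: lte_add_pinfty.
    under eq_integral do rewrite -mulrA EFinM.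
    rewrite ge0_integralZl//.
    - by rewrite rhoZ2 -EFinM ltry.
    - by apply/measurable_EFinP; apply: measurable_funM => //; exact: cmfun_normc2.
    - by move=> y _; rewrite lee_fin mulr_ge0 ?sqr_ge0.
  under eq_integral do rewrite EFinM.
  rewrite ge0_integralZl//.
  - by rewrite rho1 mule1 ltry.
  - exact/measurable_EFinP.
  - by move=> y _; rewrite lee_fin.
  - by rewrite lee_fin mulr_ge0 ?sqr_ge0.
pose V := fine (\int[leb]_y (normc (zpow c t y - m) ^+ 2 * rho y)%:E)%E.
have VE : (\int[leb]_y (normc (zpow c t y - m) ^+ 2 * rho y)%:E = V%:E)%E.
  by rewrite fineK// ge0_fin_numE// integral_ge0.
have Wi : cintegrable leb (fun y => (rho y)%:C * (zpow c t y - m)).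
  rewrite (_ : (fun y => _) = fun y => (rho y)%:C * zpow c t y + (- m) * (rho y)%:C).
    by apply: cintegrableD => //; exact: cintegrableZ.
  by apply/funext => y; ring.
have Wc : cint leb (fun y => (rho y)%:C * (zpow c t y - m)) = 0.
  rewrite (_ : (fun y => _) = fun y => (rho y)%:C * zpow c t y + (- m) * (rho y)%:C); last first.
    by apply/funext => y; ring.
  rewrite cintD//; last exact: cintegrableZ.
  rewrite mean cintZ// cint_C /Rintegral rho1 /=.
  by rewrite -/m rmorph1 mulr1 subrr.
exists V; split=> //; first by rewrite fine_ge0// integral_ge0.
(* Shifting the centred variable back by its mean [m] gives [S = |m|^2 + V]. *)
have := integral_shift_normc2 mrho rho0 rho1 mW Wi Wc VE m 0.
rewrite (eq_integral (fun y => (normc (zpow c t y) ^+ 2 * rho y)%:E)).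
  by rewrite rhoZ2 => -[->]; rewrite addr0 lerDr sqr_ge0.
by move=> y _; rewrite addr0 addrC subrK mulrC.
Qed.

Let boxP t : {box k t /\ boxind k t = 1} + {~ box k t /\ boxind k t = 0}.
Proof.
by rewrite /boxind indicE; case: (boolP (t \in box k)) => [/set_mem bt|/negP nt];
  [left|right]; split => // bt; apply: nt; exact/mem_set.
Qed.

Let Mg_neq0 t : box k t -> Mg t != 0.
Proof.
move=> bt; apply/eqP => M0; have := gw bt; rewrite -/Mg M0 Normc.normc0.
by rewrite leNgt w00.
Qed.

Let psi_bound (y : n.-tuple vec) : exists2 C : R, 0 <= C & forall t, box k t -> normc (psi y t) <= C.
Proof.
(* The modulus of [zpow c t x] does not depend on [t], so the sample point itself may stand in for
   the frequency and the bound is uniform in [t]. *)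
pose B := \sum_(i < n) normc (zpow c (tnth y i) (tnth y i)).
have B0 : 0 <= B by apply: sumr_ge0 => i _; exact: normc_ge0.
exists (n%:R^-1 * B / w0) => [|t bt]; first by rewrite divr_ge0 ?mulr_ge0 ?invr_ge0// ltW.
rewrite /psi Normc.normcM Normc.normcV mellin_hatE Normc.normcM normcC ger0_norm ?invr_ge0//.
apply: ler_pM; rewrite ?invr_ge0 ?mulr_ge0 ?normc_ge0 ?invr_ge0//.
  apply: ler_wpM2l; first by rewrite invr_ge0.
  rewrite /B; elim/big_ind2 : _ => [|a1 b1 a2 b2 h1 h2|i _].
  - by rewrite Normc.normc0.
  - by apply: le_trans (normcD_le _ _) _; exact: lerD.
  - by rewrite (normc_zpow c t (tnth y i)).
rewrite lef_pV2 ?posrE//; first exact: gw.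
exact: lt_le_trans w00 (gw bt).
Qed.

Let v0 : 0 <= v. Proof. by rewrite -lee_fin -kv. Qed.

Let integral_boxind (C : R) : 0 <= C -> (\int[leb]_t (C * boxind k t)%:E = (C * v)%:E)%E.
Proof.
move=> C0; under eq_integral do rewrite EFinM.
rewrite ge0_integralZl//.
- rewrite [X in (_ * X)%E](_ : _ = leb (box k)) ?kv//.
  by rewrite integral_indic ?setIT//; exact: measurable_box.
- by apply/measurable_EFinP; exact: measurable_boxind.
- by move=> t _; rewrite lee_fin boxind_ge0.
Qed.

Let mpsi2 : cmfun (fun p : n.-tuple vec * vec => psi p.1 p.2).
Proof.
apply: cmfunM; last by apply: cmfunV; exact: (cmfun_comp mMg).
apply: cmfunM; first exact: cmfun_cst.
apply: cmfun_sum => i.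
apply: (cmfun_comp (h := fun p : vec * vec => zpow c p.1 p.2) (f := fun p : n.-tuple vec * vec => (p.2, tnth p.1 i))).
  exact: cmfun_zpow2.
by apply: measurable_fun_pair => //; apply: (measurableT_comp (measurable_tnth i)).
Qed.

Let mpsi y : cmfun (psi y). Proof. exact: (cmfun_section1 y mpsi2). Qed.

Let psii y : cintegrable leb (fun t => (boxind k t)%:C * psi y t).
Proof.
have [C C0 hC] := psi_bound y.
apply: (@le_cintegrable _ _ _ _ _ (fun t => C * boxind k t)).
- by apply: cmfunM => //; apply: cmfunC; exact: measurable_boxind.
- apply/integrableP; split.
    by apply/measurable_EFinP; apply: measurable_funM => //; exact: measurable_boxind.
  rewrite (eq_integral (fun t => (C * boxind k t)%:E)) ?integral_boxind ?ltry// => t _.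
  by rewrite gee0_abs// lee_fin mulr_ge0 ?boxind_ge0.
move=> t; rewrite Normc.normcM normcC ger0_norm ?boxind_ge0//.
by have [[bt ->]|[_ ->]] := boxP t; rewrite ?mul1r ?mulr1 ?hC// mul0r mulr0.
Qed.

Let psi2 y : (\int[leb]_t (normc ((boxind k t)%:C * psi y t) ^+ 2)%:E < +oo)%E.
Proof.
have [C C0 hC] := psi_bound y.
apply: (@le_lt_trans _ _ (\int[leb]_t (C ^+ 2 * boxind k t)%:E)%E); last first.
  by rewrite integral_boxind ?ltry// sqr_ge0.
apply: ge0_le_integral => //.
- by move=> t _; rewrite lee_fin sqr_ge0.
- by apply/measurable_EFinP; apply: cmfun_normc2; case: (psii y).
- by apply/measurable_EFinP; apply: measurable_funM => //; exact: measurable_boxind.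
move=> t _; rewrite lee_fin Normc.normcM normcC ger0_norm ?boxind_ge0//.
have [[bt ->]|[_ ->]] := boxP t; last by rewrite mul0r mulr0 expr0n.
by rewrite mul1r mulr1 ler_pXn2r ?nnegrE ?normc_ge0// hC.
Qed.

Let D (p : n.-tuple vec * vec) : R := normc (Mf p.2 - (boxind k p.2)%:C * psi p.1 p.2) ^+ 2.
Let P (y : n.-tuple vec) : R := \prod_(i < n) rho (tnth y i).

Let mD : measurable_fun setT D.
Proof.
apply: cmfun_normc2; apply: cmfunB; first exact: (cmfun_comp mMf).
apply: cmfunM => //; apply: cmfunC; exact: (measurableT_comp (measurable_boxind k)).
Qed.

Let mP : measurable_fun setT P.
Proof. exact: (@measurable_prod_tnth _ vec R n (fun=> rho)). Qed.

Let P0 y : 0 <= P y. Proof. by apply: prodr_ge0 => i _. Qed.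

Let D0 p : 0 <= D p. Proof. exact: sqr_ge0. Qed.

(** [normsq_estimator] applies for each sample in the orthant, and Tonelli moves the frequency
    integral outside. The restriction to the orthant disappears because the product density [P]
    vanishes when some observation leaves it. *)
Lemma riskE : risk c g k n f =
  ((K^-1)%:E * \int[leb]_t \int[power_measure leb n]_y (D (y, t) * P y)%:E)%E.
Proof.
have mDP : measurable_fun setT (fun p : n.-tuple vec * vec => (D p * P p.1)%:E).
  by apply/measurable_EFinP; apply: measurable_funM => //; exact: (measurableT_comp mP).
rewrite -(fubini_tonelli (fun p : n.-tuple vec * vec => (D p * P p.1)%:E))//; last first.
  by move=> p; rewrite lee_fin mulr_ge0.
rewrite -ge0_integralZl//; last 3 first.
- apply: (measurable_fun_fubini_tonelli_F (fun p : n.-tuple vec * vec => (D p * P p.1)%:E)) => // p.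
  by rewrite lee_fin mulr_ge0.
- by move=> y _; apply: integral_ge0 => t _; rewrite lee_fin mulr_ge0.
- by rewrite lee_fin invr_ge0 ltW// K_gt0.
rewrite /risk /iid_expectation [LHS]integral_mkcond; apply: eq_integral => y _.
rewrite patchE; case: ifPn => [/set_mem oy|/negP ny].
  have -> : \prod_(i < n) mult_conv f g (tnth y i) = P y.
    by apply: eq_bigr => i _; rewrite mult_convE//; exact: oy.
  have -> : normsq orthant (weight c) (fun x => (f x)%:C - estimator c g k y x) =
      ((K^-1)%:E * \int[leb]_t (D (y, t))%:E)%E.
    apply: (normsq_estimator (mpsi y) (psii y)) => //.
      by apply: cmeasurable_real; case: hf.
    exact: cintegrable_Phi.
  under [X in _ = (_ * X)%E]eq_integral do rewrite EFinM.
  rewrite -muleA; congr (_ * _)%E; rewrite /= ge0_integralZr//.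
  - by apply/measurable_EFinP; apply: (measurableT_comp mD).
  - by move=> t _; rewrite lee_fin.
  - by rewrite lee_fin.
have [i ni] : exists i : 'I_n, ~ orthant (tnth y i).
  by apply: contrapT => H; apply: ny; apply/mem_set => i; apply: contrapT => Hi; apply: H; exists i.
have Py : P y = 0 by rewrite /P (bigD1 i)//= (rhoN ni) mul0r.
by under eq_integral do rewrite Py mulr0; rewrite integral0 mule0.
Qed.

(** The error at a fixed frequency is a constant plus a centred sum. In the box [q t * m = Mf t], so
    the constant is 0; off the box [q t = 0], so the sum is 0 and the constant is [Mf t]. *)
Lemma sampling_error_le t :
  (\int[power_measure leb n]_y (D (y, t) * P y)%:E <=
   ((1 - boxind k t) * normc (Mf t) ^+ 2 + w0 ^- 2 * S / n%:R * boxind k t)%:E)%E.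
Proof.
have [V [V0 VS VE]] := centered_variance t.
set m := Mf t * Mg t in VE.
(* The weight with which each centred observation enters the error; the sign comes from subtracting
   the estimate. *)
pose w : R[i] := - (q t * (n%:R^-1)%:C).
pose W y := w * (zpow c t y - m).
have mz := cmfun_zpow c t.
have mW1 : cmfun (fun y => zpow c t y - m) by apply: cmfunB => //; exact: cmfun_cst.
have mW : cmfun W by apply: cmfunM => //; exact: cmfun_cst.
have Wi1 : cintegrable leb (fun y => (rho y)%:C * zpow c t y + (- m) * (rho y)%:C).
  by apply: cintegrableD => //; exact: cintegrableZ.
have WE : (fun y => (rho y)%:C * W y) =
    fun y => w * ((rho y)%:C * zpow c t y + (- m) * (rho y)%:C).
  by apply/funext => y; rewrite /W; ring.
have Wi : cintegrable leb (fun y => (rho y)%:C * W y) by rewrite WE; exact: cintegrableZ.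
have Wc : cint leb (fun y => (rho y)%:C * W y) = 0.
  rewrite WE cintZ// cintD//; last exact: cintegrableZ.
  rewrite mean cintZ// cint_C /Rintegral rho1 /=.
  by rewrite -/m rmorph1 mulr1 subrr mulr0.
have WV : (\int[leb]_y (normc (W y) ^+ 2 * rho y)%:E = (normc w ^+ 2 * V)%:E)%E.
  under eq_integral do rewrite /W Normc.normcM exprMn -mulrA EFinM.
  rewrite ge0_integralZl ?VE//.
  - by apply/measurable_EFinP; apply: measurable_funM => //; exact: cmfun_normc2.
  - by move=> y _; rewrite lee_fin mulr_ge0 ?sqr_ge0.
  - by rewrite lee_fin sqr_ge0.
have nC : (n%:R)%:C * (n%:R^-1)%:C = 1 :> R[i] by rewrite -CofRM divff// pnatr_eq0 -lt0n.
have DE y : D (y, t) = normc ((Mf t - q t * m) + \sum_(i < n) W (tnth y i)) ^+ 2.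
  rewrite /D /=; congr (normc _ ^+ 2); rewrite /W -mulr_sumr sumrB sumr_const card_ord.
  rewrite /psi mellin_hatE -[m *+ n]mulr_natl.
  have -> : (n%:R : R[i]) = (n%:R)%:C by rewrite rmorph_nat.
  have -> : w * (\sum_(i < n) zpow c t (tnth y i) - (n%:R)%:C * m) =
    - (q t * ((n%:R^-1)%:C * \sum_(i < n) zpow c t (tnth y i))) + q t * m * ((n%:R)%:C * (n%:R^-1)%:C).
    by rewrite /w; ring.
  by rewrite nC /q; ring.
under eq_integral do rewrite DE.
rewrite (iid_variance mrho rho0 rho1 mW Wi Wc WV) lee_fin.
have n0R : 0 < n%:R :> R by rewrite ltr0n.
(* [n] observations, each with variance of order [n^-2], leave the factor [n^-1]. *)
have wE : n%:R * (normc w ^+ 2 * V) = normc (q t) ^+ 2 * V / n%:R.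
  rewrite /w -mulN1r Normc.normcM (Normc.normcM (q t)) (_ : normc (-1) = 1); last first.
    by rewrite (_ : -1 = (-1)%:C :> R[i]) ?rmorphN ?rmorph1// -[X in normc X]rmorphN -?rmorph1 normcC normrN1.
  rewrite mul1r normcC ger0_norm ?invr_ge0 ?ltW// exprMn; field.
  by rewrite pnatr_eq0 -lt0n.
rewrite wE; apply: lerD.
  have [[bt bE]|[_ bE]] := boxP t; rewrite /q bE.
    rewrite subrr mul0r rmorph1 div1r /m mulrCA mulVf ?Mg_neq0// mulr1 subrr.
    by rewrite Normc.normc0 expr0n.
  by rewrite rmorph0 !mul0r !subr0 mul1r.
rewrite [leRHS]mulrAC; apply: ler_wpM2r; first by rewrite invr_ge0 ltW.
have [[bt bE]|[_ bE]] := boxP t; rewrite /q bE; last first.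
  by rewrite rmorph0 mul0r Normc.normc0 expr0n /= mul0r mulr0.
rewrite mulr1 rmorph1 div1r; apply: ler_pM => //; first exact: sqr_ge0.
have Mgt : 0 < normc (Mg t) := lt_le_trans w00 (gw bt).
rewrite Normc.normcV exprVn lef_pV2 ?posrE ?exprn_gt0//.
by rewrite ler_pXn2r ?nnegrE ?normc_ge0 ?(ltW w00)//; exact: gw.
Qed.

Lemma risk_le : (risk c g k n f <=
  (K^-1)%:E * (\int[leb]_t ((1 - boxind k t) * normc (Mf t) ^+ 2)%:E +
               (w0 ^- 2 * S / n%:R * v)%:E))%E.
Proof.
rewrite riskE; apply: lee_wpmul2l; first by rewrite lee_fin invr_ge0 ltW// K_gt0.
have C0 : 0 <= w0 ^- 2 * S / n%:R.
  by rewrite divr_ge0// mulr_ge0// invr_ge0 sqr_ge0.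
have mbias : measurable_fun setT (fun t => ((1 - boxind k t) * normc (Mf t) ^+ 2)%:E).
  apply/measurable_EFinP; apply: measurable_funM; last exact: cmfun_normc2.
  by apply: measurable_funB => //; exact: measurable_boxind.
have bias0 t : (0 <= ((1 - boxind k t) * normc (Mf t) ^+ 2)%:E)%E.
  by rewrite lee_fin mulr_ge0 ?sqr_ge0// subr_ge0 boxind_le1.
have mvar : measurable_fun setT (fun t => (w0 ^- 2 * S / n%:R * boxind k t)%:E).
  by apply/measurable_EFinP; apply: measurable_funM => //; exact: measurable_boxind.
rewrite -integral_boxind// -ge0_integralD//; last first.
  by move=> t _; rewrite lee_fin mulr_ge0// boxind_ge0.
apply: ge0_le_integral => //.
- by move=> t _; apply: integral_ge0 => y _; rewrite lee_fin mulr_ge0.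
- apply: (measurable_fun_fubini_tonelli_G (fun p : n.-tuple vec * vec => (D p * P p.1)%:E)).
    by apply/measurable_EFinP; apply: measurable_funM => //; exact: (measurableT_comp mP).
  by move=> p; rewrite lee_fin mulr_ge0.
- exact: emeasurable_funD.
by move=> t _; rewrite -EFinD; exact: sampling_error_le.
Qed.

End risk_bound.

(** * Bias, volume of the box and rate of convergence *)

Section rate.
Context {R : realType} {d : nat}.
Notation X := (measurableTypeR R).
Notation vec := (d.-tuple X).
Notation leb := (@lebesgue R d).

(** The factor [(2 pi)^(d/2)] of [mellinL2] cancels the normalisation of [fourier]. The moment bound
    makes [Phi c f] integrable, which lets the chosen transform be identified with the integral. *)
Lemma mellinL2_mellin (c : vec) (f : vec -> R) : is_density f -> (moment c f < +oo)%E ->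
  in_L2 orthant (weight c) (fun x => (f x)%:C) ->
  {ae leb, forall t, mellinL2 c (fun x => (f x)%:C) t = mellin c (fun x => (f x)%:C) t} /\
  cmfun (mellinL2 c (fun x => (f x)%:C)).
Proof.
move=> fd foo [mf f2].
have fi := cintegrable_Phi fd foo.
have h1 : in_L1 setT weight1 (Phi c (fun x => (f x)%:C)) by apply/in_L1_cintegrable.
have h2 : in_L2 setT weight1 (Phi c (fun x => (f x)%:C)).
  by split; [case: fi|rewrite normsqT -normsq_orthant].
have [[mP _] _] := plancherelP h1 h2.
split; last by apply: cmfunM => //; exact: cmfun_cst.
have := plancherel_fourier h1 h2; apply: filterS => t tE.
rewrite /mellinL2 tE fourierE mulrA -CofRM -powRD; last first.
  by apply/implyP => _; rewrite gt_eqF// pi2_gt0.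
by rewrite addrN powRr0 rmorph1 mul1r mellinE.
Qed.

(** Off the box one of the weights satisfies [1 <= a * w j t ^+ 2]. Summing over all [j] avoids
    selecting the coordinate measurably and produces the Sobolev norm; [a] stands for the rate. *)
Lemma bias_le (c s k : vec) (f : vec -> R) (a L : R) : 0 <= a ->
  (forall j, 0 <= tnth s j) -> (forall j, 0 <= tnth k j) ->
  (forall j, 1 <= a * (tnth k j `^ tnth s j) ^+ 2) -> density_class s c L f ->
  (\int[leb]_t ((1 - boxind k t) * normc (mellin c (fun x => (f x)%:C) t) ^+ 2)%:E <= (a * L)%:E)%E.
Proof.
move=> a0 s0 k0 ka [[[f2 _] fL] fd fm].
have foo : (moment c f < +oo)%E by apply: le_lt_trans fm _; rewrite ltry.
have [aeM mM2] := mellinL2_mellin fd foo f2.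
set M := mellin c _ in aeM *; set M2 := mellinL2 c _ in aeM mM2.
have mM : cmfun M by apply: cmfun_mellin; case: f2.
pose w j (t : vec) : R := (1 + `|tnth t j|) `^ tnth s j.
have mw j : measurable_fun setT (w j).
  apply: (measurableT_comp (measurable_powR _)).
  apply: measurable_funD => //; apply: measurableT_comp; first exact: normr_measurable.
  exact: (measurable_tnth j).
have mF j : measurable_fun setT (fun t => (a * (w j t ^+ 2 * normc (M t) ^+ 2))%:E).
  apply/measurable_EFinP; apply: measurable_funM => //; apply: measurable_funM; last exact: cmfun_normc2.
  exact: measurable_funX.
have F0 j t : (0 <= (a * (w j t ^+ 2 * normc (M t) ^+ 2))%:E)%E.
  by rewrite lee_fin mulr_ge0// mulr_ge0 ?sqr_ge0.
apply: (@le_trans _ _ (\int[leb]_t \sum_(j < d) (a * (w j t ^+ 2 * normc (M t) ^+ 2))%:E)%E).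
  apply: ge0_le_integral => //.
  - by move=> t _; rewrite lee_fin mulr_ge0 ?sqr_ge0// subr_ge0 boxind_le1.
  - apply/measurable_EFinP; apply: measurable_funM; last exact: cmfun_normc2.
    by apply: measurable_funB => //; exact: measurable_boxind.
  - by apply: emeasurable_sum.
  move=> t _; rewrite sumEFin lee_fin -mulr_sumr -mulr_suml mulrA ler_wpM2r ?sqr_ge0//.
  rewrite /boxind indicE; case: (boolP (t \in box k)) => [_|/negP nt].
    by rewrite subrr mulr_ge0// sumr_ge0// => j _; rewrite sqr_ge0.
  have [j kt] : exists j, tnth k j < `|tnth t j|.
    apply: contrapT => H; apply: nt; apply/mem_set => j; rewrite leNgt; apply/negP => kt.
    by apply: H; exists j.
  rewrite subr0; apply: le_trans (ka j) _; apply: ler_wpM2l => //.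
  rewrite (bigD1 j)//= -[X in X <= _]addr0 lerD//; last by rewrite sumr_ge0// => i _; rewrite sqr_ge0.
  rewrite ler_pXn2r ?nnegrE ?powR_ge0//; apply: ge0_ler_powR; rewrite ?nnegrE ?addr_ge0//.
  by apply: le_trans (ltW kt) _; rewrite lerDr.
rewrite ge0_integral_sum//.
apply: (@le_trans _ _ (a%:E * sobolev_normsq s c (fun x => (f x)%:C))%E); last first.
  by rewrite EFinM lee_wpmul2l.
rewrite /sobolev_normsq ge0_sume_distrr; last first.
  by move=> j _; apply: integral_ge0 => t _; rewrite lee_fin mulr_ge0 ?sqr_ge0.
apply: lee_sum => j _.
have mwM : measurable_fun setT (fun t => (w j t ^+ 2 * normc (M2 t) ^+ 2)%:E).
  by apply/measurable_EFinP; apply: measurable_funM; [exact: measurable_funX|exact: cmfun_normc2].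
rewrite normsqT [X in (_ <= _ * X)%E](eq_integral (fun t => (w j t ^+ 2 * normc (M2 t) ^+ 2)%:E)); last first.
  by move=> t _; rewrite Normc.normcM exprMn normcC (ger0_norm (powR_ge0 _ _)).
rewrite -ge0_integralZl//; last by move=> t _; rewrite lee_fin mulr_ge0 ?sqr_ge0.
rewrite le_eqVlt; apply/orP; left; apply/eqP; apply: ge0_ae_eq_integral => //.
- by apply: measurable_funeM.
- by move=> t _; rewrite -EFinM lee_fin mulr_ge0// mulr_ge0 ?sqr_ge0.
by apply: filterS aeM => t -> _; rewrite -EFinM.
Qed.

Lemma lebesgue_box (k : vec) : (forall j, 0 <= tnth k j) ->
  leb (box k) = (\prod_(j < d) (2 * tnth k j))%:E.
Proof.
move=> k0; pose A (j : 'I_d) : set X := `[- tnth k j, tnth k j]%classic.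
have -> : box k = [set x | forall j, A j (tnth x j)].
  by apply/seteqP; split => x bx j; have := bx j; rewrite /A /= in_itv /= -ler_norml.
have mA j : measurable (A j) by exact: measurable_itv.
rewrite (power_measure_rect (@lebesgue_measure R) mA) -prodEFin; apply: eq_bigr => j _.
apply: (etrans (lebesgue_measure_itv `[- (tnth k j : R), tnth k j])); rewrite /= lte_fin; case: ifPn => [_|].
  by rewrite -EFinB; congr _%:E; ring.
rewrite -leNgt => kN; have -> : tnth k j = 0 by apply/eqP; rewrite eq_le k0 andbT; lra.
by rewrite mulr0.
Qed.

Section exponents.
Variables (gamma s : vec) (n : nat).
Hypotheses (gamma0 : orthant gamma) (s0 : orthant s) (n0 : (0 < n)%N).
Notation S := (smoothness_sum gamma s).
Notation k := (bandwidth gamma s n).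

Lemma smoothness_sum_ge0 : 0 <= S.
Proof.
apply: sumr_ge0 => j _; have gj := gamma0 j; rewrite mulr_ge0 ?invr_ge0//.
  by rewrite addr_ge0 ?mulr_ge0// ltW.
exact/ltW/s0.
Qed.

Let S2 : 0 < 2 + S. Proof. by rewrite ltr_wpDr// smoothness_sum_ge0. Qed.

Lemma bandwidthE j : tnth k j = n%:R `^ ((tnth s j)^-1 * (2 + S)^-1).
Proof.
rewrite tnth_mktuple; congr (_ `^ _); rewrite -invfM; congr (_^-1).
by rewrite mulrDr mulrC.
Qed.

Lemma bandwidth_ge1 j : 1 <= tnth k j.
Proof.
rewrite bandwidthE -[leLHS](powRr0 n%:R); apply: ler_powR; first by rewrite ler1n.
by rewrite mulr_ge0// invr_ge0 ltW// s0.
Qed.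

Lemma rateE : (1 + 2^-1 * S)^-1 = 2 * (2 + S)^-1.
Proof.
have -> : 1 + 2^-1 * S = 2^-1 * (2 + S) by field.
by rewrite invfM invrK.
Qed.

(** The exponent of [tnth k j] is inversely proportional to [tnth s j], so all coordinates
    contribute bias of the same order. *)
Lemma bandwidth_smoothness j :
  n%:R `^ (- (1 + 2^-1 * S)^-1) * (tnth k j `^ tnth s j) ^+ 2 = 1.
Proof.
rewrite bandwidthE -powRrM mulrAC mulVf ?mul1r ?gt_eqF ?s0//.
rewrite -powR_mulrn ?powR_ge0// -powRrM -powRD; last first.
  by apply/implyP => _; rewrite pnatr_eq0 -lt0n.
by rewrite rateE mulrC addNr powRr0.
Qed.

(** The powers of [n] add up to [S / (2 + S)], because [smoothness_sum] is the sum of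
    [(2 gamma_j + 1) / s_j]. *)
Lemma prod_bandwidth :
  \prod_(j < d) (tnth k j `^ (2 * tnth gamma j + 1)) = n%:R `^ (S * (2 + S)^-1).
Proof.
rewrite -[X in _ `^ (X * _)]/(\sum_(j < d) _) mulr_suml.
rewrite (big_morph (fun x => n%:R `^ x) (id1 := 1) (op1 := *%R)).
- by apply: eq_bigr => j _; rewrite bandwidthE -powRrM; congr (_ `^ _); ring.
- by move=> x y; rewrite powRD//; apply/implyP => _; rewrite pnatr_eq0 -lt0n.
- by rewrite powRr0.
Qed.

(** One coordinate of the squared inverse envelope at the corner times the side of the box. As
    [1 <= x], [1 + x ^+ 2] is at most [2 * x ^+ 2], giving the factor [2 ^ e]; the other 2 is from
    the side length [2 * x]. *)
Lemma box_bound (j : 'I_d) (x := tnth k j) (e := tnth gamma j) :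
  ((1 + x ^+ 2) `^ (- (e / 2))) ^- 2 * (2 * x) <= 2 `^ (e + 1) * x `^ (2 * e + 1).
Proof.
have x1 : 1 <= x := bandwidth_ge1 j.
have x0 : 0 < x by exact: lt_le_trans x1.
have e0 : 0 < e := gamma0 j.
have y0 : 0 <= 1 + x ^+ 2 by rewrite addr_ge0// sqr_ge0.
rewrite -exprVn -powRN opprK -[(_ `^ _) ^+ 2]powR_mulrn ?powR_ge0// -powRrM divfK//.
have -> : 2 `^ (e + 1) * x `^ (2 * e + 1) = (2 * x ^+ 2) `^ e * (2 * x).
  have pD y a b : 0 < y -> y `^ (a + b) = y `^ a * y `^ b :> R.
    by move=> yp; rewrite powRD// (gt_eqF yp) implybT.
  rewrite !pD// !powRr1 ?(ltW x0)// powRM ?sqr_ge0//.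
  by rewrite -powR_mulrn ?(ltW x0)// -powRrM; ring.
apply: ler_wpM2r; first by rewrite mulr_ge0// ltW.
have x20 : 0 <= 2 * x ^+ 2 by rewrite mulr_ge0// sqr_ge0.
by apply: ge0_ler_powR => //; [exact: ltW|nra].
Qed.

End exponents.
End rate.

Theorem lemma1 (R : realType) (d : nat) (hd : (0 < d)%N)
    (c s : d.-tuple (measurableTypeR R)) (hc : orthant c) (hs : orthant s)
    (L : R) (hL : 0 < L)
    (g : d.-tuple (measurableTypeR R) -> R) (hg : is_density g)
    (hgm : (moment c g < +oo)%E)
    (hg0 : forall t, mellin c (fun x => (g x)%:C) t != 0)
    (hgk : forall k, orthant k ->
      (\int[lebesgue]_(t in box k)
         (Normc.normc (mellin c (fun x => (g x)%:C) t) ^- 2)%:E < +oo)%E)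
    (cg Cg : R) (hcg : 0 < cg) (hCg : 0 < Cg)
    (gamma : d.-tuple (measurableTypeR R)) (hgamma : orthant gamma)
    (hgb : forall t : d.-tuple (measurableTypeR R),
      let w := \prod_(j < d) (1 + tnth t j ^+ 2) `^ (- (tnth gamma j / 2)) in
      cg * w <= Normc.normc (mellin c (fun x => (g x)%:C) t) <= Cg * w) :
  exists2 C : R, 0 < C & forall n : nat, (0 < n)%N ->
    (ereal_sup [set risk c g (bandwidth gamma s n) n f
               | f in density_class s c L]
     <= (C * n%:R `^ (- (1 + 2^-1 * smoothness_sum gamma s)^-1))%:E)%E.
Proof.
pose m := fine (moment c g).
have m0 : 0 <= m by rewrite fine_ge0// moment_ge0.
pose B : R := cg ^- 2 * \prod_(j < d) 2 `^ (tnth gamma j + 1).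
have B0 : 0 <= B.
  by rewrite mulr_ge0 ?invr_ge0 ?sqr_ge0//; apply: prodr_ge0 => j _; exact: powR_ge0.
have K0 := @K_gt0 R d.
(* The first [L] bounds the Sobolev norm in the bias. In the variance [L] bounds [E X^(2c-2)], [m]
   is [E U^(2c-2)], and [B] collects [cg ^- 2] and the constants of [box_bound]. *)
exists (((2 * pi) ^+ d)^-1 * (L + B * (L * m))).
  rewrite mulr_gt0 ?invr_gt0// ltr_wpDr//; apply: mulr_ge0 => //; apply: mulr_ge0 => //; exact: ltW.
move=> n n0; have n0R : 0 < n%:R :> R by rewrite ltr0n.
set k := bandwidth gamma s n; set r := (_ + _)^-1.
have k1 j : 1 <= tnth k j := bandwidth_ge1 hgamma hs n0 j.
have k0 j : 0 < tnth k j by apply: lt_le_trans (k1 j).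
apply: ge_ereal_sup => _ [f fD <-].
have [[[f2 _] _] fd fL] := fD.
have foo : (moment c f < +oo)%E by apply: le_lt_trans fL _; rewrite ltry.
pose p (x : R) (j : 'I_d) : R := (1 + x ^+ 2) `^ (- (tnth gamma j / 2)).
have p0 x j : 0 < p x j by apply: powR_gt0; rewrite ltr_pwDl// sqr_ge0.
(* Each factor of the lower envelope decreases in [|t_j|], so over the box the envelope is smallest
   at the corner [k]. *)
pose w0 := cg * \prod_(j < d) p (tnth k j) j.
have w00 : 0 < w0 by rewrite mulr_gt0// prodr_gt0.
have gw t : box k t -> w0 <= Normc.normc (mellin c (fun x => (g x)%:C) t).
  move=> bt; have /andP[+ _] := hgb t; apply: le_trans; rewrite ler_wpM2l ?(ltW hcg)//.
  apply: ler_prod => j _; rewrite (ltW (p0 _ _)) /p /= !powRN lef_pV2 ?posrE ?powR_gt0 ?ltr_pwDl ?sqr_ge0//.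
  apply: ge0_ler_powR; rewrite ?nnegrE ?addr_ge0 ?sqr_ge0//.
    by rewrite divr_ge0// ltW// hgamma.
  by rewrite lerD2l -[tnth t j ^+ 2]real_normK ?num_real// ler_pXn2r ?nnegrE ?(ltW (k0 j))//; exact: bt.
apply: le_trans (risk_le fd hg foo hgm n0 _ w00 (lebesgue_box (fun j => ltW (k0 j))) gw) _.
  by rewrite -normsq_orthant; case: f2.
rewrite -/m -[X in (_ <= X%:E)%E]mulrA [leRHS]EFinM lee_wpmul2l ?lee_fin ?invr_ge0 ?(ltW K0)//.
rewrite mulrDl EFinD leeD//.
  rewrite mulrC; apply: bias_le fD; first exact: powR_ge0.
  - by move=> j; exact/ltW/hs.
  - by move=> j; exact/ltW.
  - by move=> j; rewrite bandwidth_smoothness.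
rewrite lee_fin.
have fm0 : 0 <= fine (moment c f) by rewrite fine_ge0// moment_ge0.
have fmL : fine (moment c f) <= L by rewrite -lee_fin fineK// ge0_fin_numE// moment_ge0.
set P := \prod_(j < d) (2 * tnth k j).
pose N : R := n%:R `^ (smoothness_sum gamma s * (2 + smoothness_sum gamma s)^-1).
have S0 := smoothness_sum_ge0 hgamma hs.
have wP : w0 ^- 2 * P <= B * N.
  rewrite /w0 exprMn invfM /B -mulrA -[leRHS]mulrA ler_wpM2l ?invr_ge0 ?sqr_ge0//.
  rewrite -prodrXl -prodfV /P -big_split /N -prod_bandwidth// -big_split /=.
  apply: ler_prod => j _; apply/andP; split; last exact: box_bound.
  by rewrite mulr_ge0 ?invr_ge0 ?sqr_ge0// mulr_ge0// ltW.
(* Here [S / (2 + S) - 1 = - 2 / (2 + S) = - r], so the variance has the same order as the bias. *)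
have NE : N / n%:R = n%:R `^ (- r).
  rewrite /N -{2}(powRr1 (ltW n0R)) -powRN -powRD; last first.
    by apply/implyP => _; rewrite gt_eqF.
  congr (_ `^ _); rewrite /r rateE//; field.
  by rewrite gt_eqF// ltr_wpDr.
rewrite -NE.
have -> : w0 ^- 2 * (fine (moment c f) * m) / n%:R * P =
  (w0 ^- 2 * P) * (fine (moment c f) * m) / n%:R by ring.
rewrite [leRHS]mulrA; apply: ler_wpM2r; first by rewrite invr_ge0 ltW.
rewrite [leRHS]mulrAC.
have N0 : 0 <= N by exact: powR_ge0.
apply: ler_pM => //.
- by rewrite mulr_ge0 ?invr_ge0 ?sqr_ge0//; apply: prodr_ge0 => j _; rewrite mulr_ge0// ltW.
- exact: mulr_ge0.
- exact: ler_wpM2r.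
Qed.
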